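(* Let $n$ be a positive integer. Then $0$ is a local maximal point of the functional $A_n$; that is, there exists $\delta>0$ (depending on $n$) such that for every $\varphi\in C^\infty(C,\mathbb{R})$ with $\int_C|\nabla\varphi|^2\mu<\delta$ one has $$A_n(\varphi)\le A_n(0)=0 .$$
   Context: $C=\mathbb{CP}^1=\mathbb{C}\cup\{\infty\}$ with complex coordinate $z$, identified with the unit round sphere $S^2\subset\mathbb{R}^3$, and $\mu=\frac{\sqrt{-1}\,dz\,d\bar z}{2\pi(1+|z|^2)^2}$, $\int_C\mu=1$; the area form of the unit round sphere is $4\pi\mu$, and $|\nabla\varphi|$ is taken with respect to the round metric of radius $1$. For sections $s,t$ of $\mathcal{O}(n)$ put $\langle s,t\rangle_\varphi=\int_C\frac{s\bar t}{(1+|z|^2)^n}e^{\varphi}\mu$, let $g_\varphi=e^\varphi g_0$ be the metric on $\mathcal{O}(n)$ inducing this product, and let $\alpha_i=\sqrt{(n+1)\binom{n}{i}}\,z^i$, $i=0,\dots,n$, which is a $\langle\cdot,\cdot\rangle_0$-orthonormal basis of the holomorphic sections of $\mathcal{O}(n)$. Let $\Delta_\varphi=\overline\partial_\varphi^{*}\overline\partial$ be the Laplacian on $\Lambda^{0,0}(C,\mathcal{O}(n))$, where $\overline\partial_\varphi^*$ is the adjoint of $\overline\partial$ with respect to $g_\varphi$ and the constant curvature metric on $C$, and let $\det\Delta_\varphi$ be its zeta-regularized determinant (over nonzero eigenvalues). Define $A_n(\varphi)=\log\frac{\det\Delta_\varphi}{\det\Delta_0}$. By the anomaly formula (Bismut-Gillet-Soulé,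 Gillet-Soulé), $$A_n(\varphi)=-\tfrac12\int_C|\nabla\varphi|^2\mu-(n+1)\int_C\varphi\,\mu+\log\det\big(\langle\alpha_i,\alpha_j\rangle_\varphi\big)_{0\le i,j\le n}.$$ $A_n$ is invariant under adding a constant to $\varphi$. *)

(* Defs.v *)
From HB Require Import structures.
From mathcomp Require Import all_boot all_order all_algebra.
From mathcomp Require Import complex.
From mathcomp Require Import all_classical all_reals all_analysis.

Set Implicit Arguments.
Unset Strict Implicit.
Unset Printing Implicit Defensive.

Import Order.TTheory GRing.Theory Num.Theory.
Import numFieldNormedType.Exports.

Local Open Scope classical_set_scope.
Local Open Scope ring_scope.
Local Open Scope complex_scope.

Section Definitions.
Context {R : realType}.
Local Notation C := R[i].

Definition toC (p : R * R) : C := p.1 +i* p.2.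

Definition dx (f : R * R -> R) (p : R * R) : R := 'D_((1, 0) : R * R) f p.
Definition dy (f : R * R -> R) (p : R * R) : R := 'D_((0, 1) : R * R) f p.

Fixpoint Ck (k : nat) (f : R * R -> R) : Prop :=
  continuous f /\
  match k with
  | 0 => True
  | k'.+1 => (forall p, derivable f p (1, 0) /\ derivable f p (0, 1)) /\
             Ck k' (dx f) /\ Ck k' (dy f)
  end.

Definition smooth (f : R * R -> R) : Prop := forall k, Ck k f.

Definition csmooth (f : C -> C) : Prop :=
  smooth (fun p => complex.Re (f (toC p))) /\
  smooth (fun p => complex.Im (f (toC p))).

(* The Riemann sphere: [Some z] is the point of affine coordinate z and [None]
   is the point at infinity. *)
Definition CP1 : Type := option C.

Definition chart0 (phi : CP1 -> R) (p : R * R) : R := phi (Some (toC p)).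

(* phi in the coordinate w = 1/z around infinity. *)
Definition chartoo (phi : CP1 -> R) (p : R * R) : R :=
  if toC p == 0 then phi None else phi (Some (toC p)^-1).

Definition smooth_CP1 (phi : CP1 -> R) : Prop :=
  smooth (chart0 phi) /\ smooth (chartoo phi).

Definition Dplane (f : R * R -> R) : R :=
  Rintegral ((@lebesgue_measure R) \x (@lebesgue_measure R))%E setT f.

(* 1 + |z|^2 *)
Definition weight (p : R * R) : R := 1 + (p.1 ^+ 2 + p.2 ^+ 2).

(* Since i dz dzbar = 2 dx dy, the form mu is dx dy / (pi (1 + |z|^2)^2).
   The point at infinity is negligible. *)
Definition int_mu (f : R * R -> R) : R :=
  Dplane (fun p => f p / (pi * weight p ^+ 2)).

Definition cint_mu (f : R * R -> C) : C :=
  int_mu (fun p => complex.Re (f p)) +i* int_mu (fun p => complex.Im (f p)).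

(* |grad phi|^2 for the round metric 4 (dx^2 + dy^2) / (1 + |z|^2)^2. *)
Definition grad_sq (phi : CP1 -> R) (p : R * R) : R :=
  (weight p / 2) ^+ 2 * (dx (chart0 phi) p ^+ 2 + dy (chart0 phi) p ^+ 2).

Definition dirichlet (phi : CP1 -> R) : R := int_mu (grad_sq phi).

(* A smooth section of O(n) is given by its coefficient f(z) in the standard
   frame over the affine chart; in the frame at infinity the coefficient is
   w^n f(1/w), which must extend smoothly across w = 0. *)
Definition section (n : nat) (f : C -> C) : Prop :=
  csmooth f /\
  exists g : C -> C, csmooth g /\ forall w, w != 0 -> g w = w ^+ n * f w^-1.

Definition sec_prod (n : nat) (phi : CP1 -> R) (s t : C -> C) : C :=
  cint_mu (fun p => s (toC p) * (t (toC p))^* *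
                    (expR (chart0 phi p) / weight p ^+ n)%:C).

Definition alpha (n i : nat) (z : C) : C :=
  (Num.sqrt (n.+1%:R * 'C(n, i)%:R) : R)%:C * z ^+ i.

Definition gram (n : nat) (phi : CP1 -> R) : 'M[C]_n.+1 :=
  \matrix_(i < n.+1, j < n.+1) sec_prod n phi (alpha n i) (alpha n j).

(* The coefficient of dzbar in dbar f, i.e. (f_x + i f_y) / 2. *)
Definition dbar (f : C -> C) (p : R * R) : C :=
  let u q := complex.Re (f (toC q)) in
  let v q := complex.Im (f (toC q)) in
  ((dx u p - dy v p) / 2) +i* ((dx v p + dy u p) / 2).

(* L^2 product of the O(n)-valued (0,1)-forms a dzbar and b dzbar, where
   |dzbar|^2 = (1 + |z|^2)^2 / 2 for the unit round metric. Another
   normalization of the constant curvature metric multiplies every Laplacian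
   below by the same constant; this does not affect the functional A, the value
   at 0 of the zeta function being independent of phi. *)
Definition form_prod (n : nat) (phi : CP1 -> R) (a b : R * R -> C) : C :=
  cint_mu (fun p => a p * (b p)^* *
     (weight p ^+ 2 / 2 * (expR (chart0 phi p) / weight p ^+ n))%:C).

(* u = dbar^* dbar s, the adjoint being taken for the products above. *)
Definition laplacian (n : nat) (phi : CP1 -> R) (s u : C -> C) : Prop :=
  [/\ section n s, section n u &
      forall t, section n t ->
        sec_prod n phi u t = form_prod n phi (dbar s) (dbar t)].

Definition eigensection (n : nat) (phi : CP1 -> R) (c : C) (s : C -> C) :=
  laplacian n phi s (fun z => c * s z).

(* lam enumerates the nonzero eigenvalues with multiplicity: it is the list of
   eigenvalues of an orthonormal family e of eigensections, and the e_k with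
   lam_k = c span the eigenspace of each nonzero eigenvalue c. *)
Definition nonzero_spectrum (n : nat) (phi : CP1 -> R) (lam : nat -> R) :=
  exists e : nat -> C -> C,
  [/\ forall k, 0 < lam k,
      forall k, eigensection n phi (lam k)%:C (e k),
      forall j k, sec_prod n phi (e j) (e k) = (j == k)%:R &
      forall (c : C) (s : C -> C), c != 0 -> eigensection n phi c s ->
        exists (N : nat) (a : nat -> C), forall z,
          s z = \sum_(0 <= k < N | (lam k)%:C == c) a k * e k z].

(* x^(-s) = exp (- s ln x), for x > 0. *)
Definition cpowN (x : R) (s : C) : C :=
  let r := expR (- (complex.Re s * ln x)) in
  let t := - (complex.Im s * ln x) in
  (r * cos t) +i* (r * sin t).

(* Z is the spectral zeta function: the sum of lam_k^(-s) for Re s > 1,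
   continued holomorphically to the complement of its only pole s = 1. *)
Definition spectral_zeta (lam : nat -> R) (Z : C^o -> C^o) : Prop :=
  (forall s : C^o, s != 1 -> derivable Z s 1) /\
  (forall s : C^o, 1 < complex.Re s ->
     (fun N => \sum_(0 <= k < N) cpowN (lam k) s : C^o) @ \oo --> Z s).

(* D = exp (- zeta'(0)) *)
Definition is_zeta_det (n : nat) (phi : CP1 -> R) (D : R) : Prop :=
  exists (lam : nat -> R) (Z : C^o -> C^o) (d : R),
  [/\ nonzero_spectrum n phi lam, spectral_zeta lam Z,
      is_derive (0 : C^o) (1 : C^o) Z (d%:C) & D = expR (- d)].

Definition zeta_det (n : nat) (phi : CP1 -> R) : R :=
  xget 1 [set D | is_zeta_det n phi D].

Definition A (n : nat) (phi : CP1 -> R) : R :=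
  ln (zeta_det n phi / zeta_det n (fun=> 0)).

(* The determinant of a Gram matrix is a nonnegative real number, so nothing is
   lost by taking the real part. *)
Definition anomaly_rhs (n : nat) (phi : CP1 -> R) : R :=
  - (1 / 2) * dirichlet phi - n.+1%:R * int_mu (chart0 phi)
  + ln (complex.Re (\det (gram n phi))).

End Definitions.

(* The anomaly formula of Bismut-Gillet-Soule for the metrics e^phi g_0 on
   O(n). *)
Definition anomaly_formula (R : realType) (n : nat) : Prop :=
  forall phi : @CP1 R -> R, smooth_CP1 phi -> A n phi = anomaly_rhs n phi.

(* Main.v *)
Require Import Defs.
From mathcomp Require Import all_boot all_order all_algebra.
From mathcomp Require Import complex.
From mathcomp Require Import all_classical all_reals all_analysis.
From mathcomp Require Import measurable_realfun.
From mathcomp Require Import ring lra zify.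

(* Write w = 1 + |z|^2, psi = phi - \int phi mu and D for the Dirichlet
   integral of phi, and let T(f) be the Toeplitz matrix of the products
   \int f alpha_i (alpha_j)^* w^-n mu. The Gram matrix of phi is
   e^(\int phi mu) (1 + E) with E = T(psi) + T(e^psi - 1 - psi), and
   ln det (1 + E) <= tr E - (1/2 - k) |E|^2 when the Hilbert-Schmidt norm |E| is
   at most k. With Q_m(f) = |T(f)|^2 / (m + 1) on O(m), this gives
     A_n(phi) <= - D / 2 + (n + 1) / 2 * (\int psi^2 mu - Q_n(psi)) + error.

   Spectral gap: the derivatives along the three rotation fields act on the
   moments of psi through sl_2, and the Casimir identity reads
   Q_m+1 - Q_m = S_m+1 / ((m + 1) (m + 2)), where S_m is the sum of Q_m over the
   three derivatives. Bessel gives S_m <= D, and S_n+1 <= (1 - c_n) D with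
   c_n > 0 because the derivatives have mean zero. Since Q_m(psi) tends to
   \int psi^2 mu, the series telescopes to
     \int psi^2 mu - Q_n(psi) <= (1 / (n + 1) - e) D   with e > 0.

   Error: the Gagliardo-Nirenberg inequality of the plane, applied to
   (cosh (s psi / 2) - 1) / w, bounds \int sinh^2 (s psi / 2) mu by s^2 D when
   s^2 D is small, so \int (e^psi - 1 - psi - psi^2 / 2) mu <= 4 D / s, and s is
   chosen large in terms of e. *)

Set Implicit Arguments.
Unset Strict Implicit.
Unset Printing Implicit Defensive.

Import Order.TTheory GRing.Theory Num.Theory.
Import numFieldNormedType.Exports.

Local Open Scope classical_set_scope.
Local Open Scope ring_scope.

(** * Integrals over the line and the plane *)

(** With the Bessel bound alone the series adds up to exactly D / (n + 1): the second-order terms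
    then cancel and leave no room for the error. The strict loss at the single index n + 1 is what
    closes the argument, and since any positive gain is enough, c_n can be crude.

    A small D does not make psi small: in dimension two the energy does not control the supremum, so
    e^psi cannot be expanded pointwise. The boundedness of phi is used only qualitatively, to have
    finite integrals that can be absorbed; no constant depends on its supremum. The error 4 D / s is
    linear in D, like the gain e D; it is beaten by its coefficient, because s is fixed in terms of
    e before delta is chosen.

    The remainder e^psi - 1 - psi is estimated in L^1 only; being nonnegative, it still has a
    Toeplitz matrix of small Hilbert-Schmidt norm.

    All the analysis takes place in the affine chart. Smoothness at infinity enters as the
    boundedness of phi and of (1 + |z|^2) times its first derivatives, which is what removes the
    boundary terms. *)

Section Continuity.
Context {R : realType} {T : topologicalType}.
Implicit Types u v : T -> R.
Lemma contD u v : continuous u -> continuous v -> continuous (fun p => u p + v p).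
Proof. by move=> cu cv p; apply: cvgD; [exact: cu|exact: cv]. Qed.

Lemma contB u v : continuous u -> continuous v -> continuous (fun p => u p - v p).
Proof. by move=> cu cv p; apply: cvgB; [exact: cu|exact: cv]. Qed.

Lemma contN u : continuous u -> continuous (fun p => - u p).
Proof. by move=> cu p; apply: cvgN; exact: cu. Qed.

Lemma contM u v : continuous u -> continuous v -> continuous (fun p => u p * v p).
Proof. by move=> cu cv p; apply: cvgM; [exact: cu|exact: cv]. Qed.

Lemma cont_cst (c : R) : continuous (fun _ : T => c).
Proof. by move=> p; exact: cvg_cst. Qed.

Lemma contX u n : continuous u -> continuous (fun p => u p ^+ n).
Proof.
move=> cu; elim: n => [|n IH]; first exact: cont_cst.
by under eq_fun do rewrite exprS; exact: contM.
Qed.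

Lemma contV u : (forall p, u p != 0) -> continuous u -> continuous (fun p => (u p)^-1).
Proof. by move=> u0 cu p; apply: cvgV; [exact: u0|exact: cu]. Qed.

Lemma cont_norm u : continuous u -> continuous (fun p => `|u p|).
Proof. by move=> cu p; apply: cvg_norm; exact: cu. Qed.

Lemma cont_comp1 (h : R -> R) u : continuous h -> continuous u -> continuous (fun p => h (u p)).
Proof. by move=> ch cu p; apply: continuous_comp; [exact: cu|exact: ch]. Qed.
End Continuity.

Section OneDim.
Context {R : realType}.
Notation mu := (@lebesgue_measure R).
Implicit Types (f g F : R -> R) (x a b : R).

Lemma is_derive_cst1 x (c : R) : is_derive x 1 (fun=> c) 0.
Proof. exact: is_derive_cst. Qed.

Lemma is_derive_id1 x : is_derive x 1 (fun t : R => t) 1.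
Proof. exact: is_derive_id. Qed.

Lemma is_derive_add x f g a b : is_derive x 1 f a -> is_derive x 1 g b ->
  is_derive x 1 (fun t => f t + g t) (a + b).
Proof. by move=> df dg; exact: is_deriveD. Qed.

Lemma is_derive_opp x f a : is_derive x 1 f a -> is_derive x 1 (fun t => - f t) (- a).
Proof. by move=> df; exact: is_deriveN. Qed.

Lemma is_derive_sub x f g a b : is_derive x 1 f a -> is_derive x 1 g b ->
  is_derive x 1 (fun t => f t - g t) (a - b).
Proof. by move=> df dg; exact: is_deriveB. Qed.

Lemma is_derive_mul x f g a b : is_derive x 1 f a -> is_derive x 1 g b ->
  is_derive x 1 (fun t => f t * g t) (a * g x + f x * b).
Proof.
move=> df dg; have := is_deriveM df dg; rewrite /GRing.scale /= => h.
by apply: is_derive_eq; rewrite addrC mulrC [X in _ + X]mulrC mulrC [g x * _]mulrC.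
Qed.

Lemma is_derive_inv x f a : f x != 0 -> is_derive x 1 f a ->
  is_derive x 1 (fun t => (f t)^-1) (- a / f x ^+ 2).
Proof.
move=> fx df; have := is_deriveV fx df.
by move=> h; apply: is_derive_eq; rewrite /GRing.scale /= mulNr mulNr mulrC.
Qed.

Lemma is_derive_sqrt x f a : 0 < f x -> is_derive x 1 f a ->
  is_derive x 1 (fun t => Num.sqrt (f t)) (a / (2 * Num.sqrt (f x))).
Proof.
move=> fx df; have := is_derive1_comp (is_derive1_sqrt fx) df.
by move=> h; apply: is_derive_eq; rewrite mulrC.
Qed.

Lemma is_derive_expR_comp x f a : is_derive x 1 f a ->
  is_derive x 1 (fun t => expR (f t)) (a * expR (f x)).
Proof.
move=> df; have := is_derive1_comp (is_derive_expR (f x)) df.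
by move=> h; apply: is_derive_eq; rewrite mulrC.
Qed.

Lemma is_derive_atan x f a : is_derive x 1 f a ->
  is_derive x 1 (fun t => atan (f t)) (a / (1 + f x ^+ 2)).
Proof.
move=> df; have := is_derive1_comp (is_derive1_atan (f x)) df.
by move=> h; apply: is_derive_eq; rewrite mulrC.
Qed.

Lemma is_derive_continuous f (df : R -> R) : (forall x, is_derive x 1 f (df x)) -> continuous f.
Proof.
move=> h x; apply/differentiable_continuous/derivable1_diffP.
exact: ex_derive.
Qed.

Lemma ge0_continuous_FTC2T f F (l1 l2 : R) : (forall x, 0 <= f x) -> continuous f ->
  (forall x, is_derive x 1 F (f x)) ->
  F x @[x --> -oo] --> l1 -> F x @[x --> +oo] --> l2 ->
  (\int[mu]_x (f x)%:E = (l2 - l1)%:E)%E.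
Proof.
move=> f0 cf dF Fl1 Fl2.
have cF := is_derive_continuous dF.
have mf : measurable_fun setT (EFin \o f) by apply/measurable_EFinP; exact: continuous_measurable_fun.
have F'E x : derive1 F x = f x by rewrite derive1E; exact: derive_val.
have -> : [set: measurableTypeR R] = `]-oo, (0:R)] `|` `]0, +oo[.
  by rewrite (itv_setU_setT false 0).
rewrite ge0_integral_setU//=; last 3 first.
- exact: measurable_funTS.
- by move=> x _; rewrite lee_fin.
- by apply/disj_setPS => x /= []; rewrite !in_itv/= andbT => /le_lt_trans /[apply]; rewrite ltxx.
rewrite integral_itv_obnd_cbnd; last exact: measurable_funTS.
rewrite (ge0_continuous_FTC2y _ _ Fl2)//; last 2 first.
- by apply: continuous_subspaceT.
- by apply: cvg_at_right_filter; exact: cF.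
have := @ge0_integration_by_substitutionNy R f 0; rewrite oppr0 => ->; last 2 first.
- by apply: continuous_subspaceT.
- by move=> x _.
have dG x : is_derive x 1 (fun t => - F (- t)) (f (- x)).
  have := is_derive_opp (is_derive1_comp (dF (- x)) (is_derive_opp (is_derive_id1 x))).
  by move=> h; apply: is_derive_eq; ring.
have cG := is_derive_continuous dG.
rewrite (@ge0_continuous_FTC2y _ _ (fun x => - F (- x)) _ (- l1))//.
- by rewrite oppr0 -EFinD; congr EFin; ring.
- by move=> x _; exact: f0.
- by apply: continuous_subspaceT => x; apply: continuous_comp; [exact: opp_continuous|exact: cf].
- by apply: cvgN; apply/(cvgNy_compNP F).
- by apply: cvg_at_right_filter; exact: cG.
- by move=> x _; rewrite derive1E; apply: derive_val.
Qed.

Lemma inv_1sq_gt0 x : 0 < (1 + x ^+ 2)^-1.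
Proof. by rewrite invr_gt0 ltr_pwDl// sqr_ge0. Qed.

Lemma continuous_inv_1sq : continuous (fun x : R => (1 + x ^+ 2)^-1).
Proof. exact: continuous_oneDsqrV. Qed.

Lemma cvgNy_atan : (@atan R) x @[x --> -oo] --> - (pi / 2).
Proof.
apply/cvgNy_compNP; rewrite (_ : _ \o _ = fun x => - atan x); last first.
  by apply/funext => x /=; rewrite atanN.
by apply: cvgN; exact: cvgy_atan.
Qed.

Lemma integralT_inv_1sq : (\int[mu]_x ((1 + x ^+ 2)^-1)%:E = (pi : R)%:E)%E.
Proof.
rewrite (ge0_continuous_FTC2T _ continuous_inv_1sq (@is_derive1_atan R) cvgNy_atan (@cvgy_atan R)).
  by congr EFin; field.
by move=> x; exact/ltW/inv_1sq_gt0.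
Qed.

Lemma integrable_inv_1sq : mu.-integrable setT (EFin \o (fun x : R => (1 + x ^+ 2)^-1)).
Proof.
apply/integrableP; split.
  by apply/measurable_EFinP; apply: continuous_measurable_fun; exact: continuous_inv_1sq.
under eq_integral => x _ do rewrite /= ger0_norm ?(ltW (inv_1sq_gt0 _))//.
by rewrite integralT_inv_1sq ltry.
Qed.

Lemma integrable_line f B : continuous f -> (forall x, `|f x| <= B / (1 + x ^+ 2)) ->
  mu.-integrable setT (EFin \o f).
Proof.
move=> cf fB.
apply: (le_integrable measurableT _ _ (integrableZl measurableT B integrable_inv_1sq)).
  by apply/measurable_EFinP; exact: continuous_measurable_fun.
move=> x _ /=; rewrite lee_fin (le_trans (fB x))//; exact: ler_norm.
Qed.

(** Adding [B / (1 + x ^+ 2)] makes the integrand nonnegative, so the fundamental theorem on the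
    whole line applies to [F + B * atan]; the contribution [B * pi] is then subtracted. *)
Lemma integral_line_derive_eq0 f F B : continuous f -> (forall x, `|f x| <= B / (1 + x ^+ 2)) ->
  (forall x, is_derive x 1 F (f x)) -> F x @[x --> -oo] --> (0 : R) -> F x @[x --> +oo] --> (0 : R) ->
  (\int[mu]_x (f x)%:E = 0)%E.
Proof.
move=> cf fB dF F1 F2.
pose b x := B / (1 + x ^+ 2).
have cb : continuous b.
  by move=> x; apply: cvgM; [exact: cvg_cst|exact: continuous_inv_1sq].
have ib : mu.-integrable setT (EFin \o b).
  by apply: (@integrable_line _ `|B|) => // x; rewrite normrM [X in _ * X]ger0_norm// ltW ?inv_1sq_gt0.
have if_ := integrable_line cf fB.
have Eb : (\int[mu]_x (b x)%:E = (B * pi)%:E)%E.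
  under eq_integral do rewrite /b EFinM.
  by rewrite integralZl ?integralT_inv_1sq//; exact: integrable_inv_1sq.
have : (\int[mu]_x (f x + b x)%:E = (B * pi)%:E)%E.
  have dFb (x : R) : is_derive x 1 (fun x => F x + B * atan x) (f x + b x).
    have h := is_derive_mul (is_derive_cst1 x B) (is_derive_atan (is_derive_id1 x)).
    by have := is_derive_add (dF x) h => h2; apply: is_derive_eq; rewrite /b; ring.
  rewrite (@ge0_continuous_FTC2T _ _ (0 + B * (- (pi / 2))) (0 + B * (pi / 2)) _ _ dFb).
  - by congr EFin; field.
  - by move=> x; have := fB x; rewrite ler_norml /b -lerBlDr sub0r => /andP[].
  - by move=> x; apply: cvgD; [exact: cf|exact: cb].
  - by apply: cvgD => //; apply: cvgM; [exact: cvg_cst|exact: cvgNy_atan].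
  - by apply: cvgD => //; apply: cvgM; [exact: cvg_cst|exact: (@cvgy_atan R)].
under eq_integral do rewrite EFinD.
rewrite integralD// Eb => h.
have := integrable_fin_num measurableT if_.
move: h; rewrite /comp; case: (\int[mu]_x (f x)%:E)%E => [r| |]//= [] h _.
by congr EFin; lra.
Qed.

(** With [c = 1 + y ^+ 2] this bounds [kap] on every horizontal line by one integrable function,
    uniformly in y. *)
Lemma inv_w32_le (c x : R) : 1 <= c -> ((c + x ^+ 2) * Num.sqrt (c + x ^+ 2))^-1 <= 1 / (1 + x ^+ 2).
Proof.
move=> c1; have x0 := sqr_ge0 x.
rewrite div1r lef_pV2 ?posrE; first last.
- by lra.
- by apply: mulr_gt0; rewrite ?sqrtr_gt0; lra.
have h : 1 <= Num.sqrt (c + x ^+ 2) by rewrite -[leLHS]sqrtr1; apply: ler_wsqrtr; lra.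
nra.
Qed.

Lemma cvgy_inv : (fun x : R => x^-1) x @[x --> +oo] --> (0:R).
Proof.
apply: (gtr0_cvgV0 _).2; last exact: cvg_id.
by apply: nbhs_pinfty_gt; rewrite num_real.
Qed.

Lemma cvgy_x_sqrt (c : R) : 0 < c -> (fun x => x / Num.sqrt (c + x ^+ 2)) x @[x --> +oo] --> (1:R).
Proof.
move=> c0.
have : (fun x : R => (Num.sqrt (c * (x^-1) ^+ 2 + 1))^-1) x @[x --> +oo] --> (Num.sqrt (c * 0 ^+ 2 + 1))^-1.
  apply: cvgV; first by rewrite expr0n/= mulr0 add0r sqrtr1 oner_neq0.
  apply: continuous_cvg; first exact: sqrt_continuous.
  apply: cvgD; last exact: cvg_cst.
  apply: cvgM; first exact: cvg_cst.
  rewrite expr2; under eq_fun do rewrite expr2.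
  by apply: cvgM; exact: cvgy_inv.
rewrite expr0n/= mulr0 add0r sqrtr1 invr1.
apply: cvg_trans; apply: near_eq_cvg; near=> x.
have x0 : 0 < x by [].
have -> : c * x^-1 ^+ 2 + 1 = (c + x ^+ 2) * (x ^-1) ^+2 by field; lra.
rewrite sqrtrM ?sqrtr_sqr ?ger0_norm ?invr_ge0 ?(ltW x0)//; last by nra.
by rewrite invfM invrK mulrC.
Unshelve. all: by end_near. Qed.

Lemma cvgy_inv_sqrt (c : R) : 0 < c -> (fun x => (Num.sqrt (c + x ^+ 2))^-1) x @[x --> +oo] --> (0:R).
Proof.
move=> c0.
apply: (gtr0_cvgV0 _).2; first by apply: nearW => x; rewrite sqrtr_gt0 ltr_pwDl// sqr_ge0.
apply: (ger_cvgy _ cvg_id).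
near=> x; have x0 : 0 <= x by [].
by rewrite -[leLHS](ger0_norm x0) -sqrtr_sqr ler_wsqrtr// lerDr ltW.
Unshelve. all: by end_near. Qed.

Lemma cvgNy_inv_sqrt (c : R) : 0 < c -> (fun x => (Num.sqrt (c + x ^+ 2))^-1) x @[x --> -oo] --> (0:R).
Proof.
move=> c0; apply/cvgNy_compNP; rewrite (_ : _ \o _ = fun x => (Num.sqrt (c + x ^+ 2))^-1); last first.
  by apply/funext => x /=; rewrite sqrrN.
exact: cvgy_inv_sqrt.
Qed.

Lemma cvg_norm_le0 (G : set_system R) {FG : Filter G} (u v : R -> R) (B : R) :
  (forall x, `|u x| <= B * v x) -> v @ G --> (0 : R) -> u @ G --> (0 : R).
Proof.
move=> uv v0; have h : (fun x => B * v x) @ G --> (0:R).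
  by rewrite -(mulr0 B); apply: cvgM => //; exact: cvg_cst.
apply: (squeeze_cvgr (f := fun x => - (B * v x)) (h := fun x => B * v x)) => //.
  by apply: nearW => x; rewrite -ler_norml.
by rewrite -oppr0; apply: cvgN.
Qed.

(** [F x - F a] is the integral of f over [a, x], and [F a] becomes small as a goes to -oo. *)
Lemma abs_le_integral_derive f F B : continuous f -> (forall x, `|f x| <= B / (1 + x ^+ 2)) ->
  (forall x, is_derive x 1 F (f x)) -> F x @[x --> -oo] --> (0 : R) ->
  forall x, (`|F x|%:E <= \int[mu]_t `|(f t)%:E|)%E.
Proof.
move=> cf fB dF F1 x.
have if_ := integrable_line cf fB.
have cF := is_derive_continuous dF.
have fE t : derive1 F t = f t by rewrite derive1E; exact: derive_val.
have inc a : a < x -> (`|F x - F a|%:E <= \int[mu]_t `|(f t)%:E|)%E.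
  move=> ax; rewrite -abse_EFin EFinB -(@continuous_FTC2 _ f) //.
  - apply: le_trans (le_abse_integral _ _ _) _ => //.
      by apply/measurable_EFinP; apply: measurable_funTS; exact: continuous_measurable_fun.
    apply: ge0_subset_integral => //.
    by apply/measurable_EFinP; apply: continuous_measurable_fun; exact: cont_norm.
  - exact: continuous_subspaceT.
  - split; first by move=> t _; apply: ex_derive.
      by apply: cvg_at_right_filter; exact: cF.
    by apply: cvg_at_left_filter; exact: cF.
have Kfin : (\int[mu]_t `|(f t)%:E|)%E \is a fin_num.
  by have := integrable_fin_num measurableT (integrable_abse if_).
rewrite -(fineK Kfin) lee_fin; apply/ler_addgt0Pr => e e0.
have [a [ax Fa]] : exists a, a < x /\ `|F a| <= e.
  move/cvgrPdist_le: F1 => /(_ e e0) [M [_ MP]].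
  exists (Num.min (M - 1) (x - 1)); split; first by rewrite gt_min gtrBl ltr01 orbT.
  by have := MP (Num.min (M - 1) (x - 1)); rewrite sub0r normrN; apply; rewrite gt_min gtrBl ltr01.
have := inc a ax; rewrite -(fineK Kfin) lee_fin => h.
rewrite -[F x](subrK (F a)); apply: le_trans (ler_normD _ _) _.
exact: lerD.
Qed.

Lemma cvgNy_x_sqrt (c : R) : 0 < c -> (fun x => x / Num.sqrt (c + x ^+ 2)) x @[x --> -oo] --> (-1:R).
Proof.
move=> c0; apply/cvgNy_compNP; rewrite (_ : _ \o _ = fun x => - (x / Num.sqrt (c + x ^+ 2))); last first.
  by apply/funext => x /=; rewrite sqrrN mulNr.
by apply: cvgN; exact: cvgy_x_sqrt.
Qed.

Lemma sqrt_sq_gt0 (c x : R) : 0 < c -> 0 < Num.sqrt (c + x ^+ 2).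
Proof. by move=> c0; rewrite sqrtr_gt0 ltr_pwDl// sqr_ge0. Qed.

Lemma integralT_inv_w32 (c : R) : 0 < c ->
  (\int[mu]_x (((c + x ^+ 2) * Num.sqrt (c + x ^+ 2))^-1)%:E = (2 / c)%:E)%E.
Proof.
move=> c0.
have w0 x : 0 < c + x ^+ 2 by rewrite ltr_pwDl// sqr_ge0.
have s0 x := sqrt_sq_gt0 x c0.
have dsq x : is_derive x 1 (fun x => c + x ^+ 2) (x *+ 2).
  have h := is_derive_add (is_derive_cst1 x c) (is_derive_mul (is_derive_id1 x) (is_derive_id1 x)).
  by apply: is_derive_eq; rewrite mulr2n; ring.
have ds x := is_derive_sqrt (f := fun x => c + x ^+ 2) (w0 x) (dsq x).
have dF x : is_derive x 1 (fun x => c^-1 * (x / Num.sqrt (c + x ^+ 2))) (((c + x ^+ 2) * Num.sqrt (c + x ^+ 2))^-1).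
  have sn0 : Num.sqrt (c + x ^+ 2) != 0 by rewrite gt_eqF.
  have h := is_derive_mul (is_derive_cst1 x c^-1) (is_derive_mul (is_derive_id1 x) (is_derive_inv (f := fun x => Num.sqrt (c + x ^+ 2)) sn0 (ds x))).
  apply: is_derive_eq.
  have := sqr_sqrtr (ltW (w0 x)); set s := Num.sqrt _ => hs.
  have -> : (c + x ^+ 2) = s ^+ 2 by [].
  have -> : c = s ^+ 2 - x ^+ 2 by rewrite hs; ring.
  by field; rewrite sn0 hs addrK gt_eqF.
rewrite (ge0_continuous_FTC2T _ _ dF (l1 := c^-1 * -1) (l2 := c^-1 * 1)).
- by congr EFin; field; rewrite gt_eqF.
- by move=> x; rewrite invr_ge0 mulr_ge0// ltW.
- move=> x; apply: cvgV; first by rewrite mulf_neq0 ?gt_eqF.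
  have cw : {for x, continuous (fun x => c + x ^+ 2)} := is_derive_continuous dsq (x := x).
  by apply: cvgM => //; exact: (is_derive_continuous ds).
- by apply: cvgM; [exact: cvg_cst|exact: cvgNy_x_sqrt].
- by apply: cvgM; [exact: cvg_cst|exact: cvgy_x_sqrt].
Qed.

Lemma integralT_inv_w2 (c : R) : 0 < c ->
  (\int[mu]_x (((c + x ^+ 2) ^+ 2)^-1)%:E = (pi / 2 * (c * Num.sqrt c)^-1)%:E)%E.
Proof.
move=> c0.
have w0 x : 0 < c + x ^+ 2 by rewrite ltr_pwDl// sqr_ge0.
have s0 : 0 < Num.sqrt c by rewrite sqrtr_gt0.
have s2 := sqr_sqrtr (ltW c0).
have dsq x : is_derive x 1 (fun x => c + x ^+ 2) (x *+ 2).
  have h := is_derive_add (is_derive_cst1 x c) (is_derive_mul (is_derive_id1 x) (is_derive_id1 x)).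
  by apply: is_derive_eq; rewrite mulr2n; ring.
set s := Num.sqrt c in s0 s2 *.
pose F x := (2 * s ^+ 2)^-1 * (x / (c + x ^+ 2)) + (2 * s ^+ 3)^-1 * atan (s^-1 * x).
have dF x : is_derive x 1 F (((c + x ^+ 2) ^+ 2)^-1).
  have wn0 : c + x ^+ 2 != 0 by rewrite gt_eqF.
  have h1 := is_derive_mul (is_derive_cst1 x (2 * s ^+ 2)^-1) (is_derive_mul (is_derive_id1 x) (is_derive_inv (f := fun x => c + x ^+ 2) wn0 (dsq x))).
  have h2 := is_derive_mul (is_derive_cst1 x (2 * s ^+ 3)^-1) (is_derive_atan (is_derive_mul (is_derive_cst1 x s^-1) (is_derive_id1 x))).
  have h := is_derive_add h1 h2; rewrite /F.
  apply: is_derive_eq; rewrite -s2.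
  have : s ^+ 2 + x ^+ 2 != 0 by rewrite s2.
  move=> hn; field; rewrite hn gt_eqF//= gt_eqF//.
have lF : F x @[x --> +oo] --> (2 * s ^+ 2)^-1 * (1 * 0) + (2 * s ^+ 3)^-1 * (pi / 2).
  apply: cvgD.
    apply: cvgM; first exact: cvg_cst.
    have -> : (fun x => x / (c + x ^+ 2)) = (fun x => x / Num.sqrt (c + x ^+ 2) * (Num.sqrt (c + x ^+ 2))^-1).
      apply/funext => x; have := sqr_sqrtr (ltW (w0 x)); set t := Num.sqrt _ => ht.
      by rewrite -ht -mulrA -invfM -expr2.
    apply: cvgM; first exact: cvgy_x_sqrt.
    apply: (gtr0_cvgV0 _).2; first by apply: nearW => x; exact: sqrt_sq_gt0.
    apply: (ger_cvgy _ cvg_id).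
    near=> x. have x0 : 0 <= x by [].
    by rewrite -[leLHS](ger0_norm x0) -sqrtr_sqr ler_wsqrtr// lerDr ltW.
  apply: cvgM; first exact: cvg_cst.
  apply: (cvg_comp (fun x => s^-1 * x) atan); last exact: cvgy_atan.
  by apply: gt0_cvgMry; [rewrite invr_gt0|exact: cvg_id].
have lFN : F x @[x --> -oo] --> - ((2 * s ^+ 2)^-1 * (1 * 0) + (2 * s ^+ 3)^-1 * (pi / 2)).
  apply/cvgNy_compNP; rewrite (_ : F \o _ = fun x => - F x); first exact: cvgN.
  by apply/funext => x; rewrite /F /= sqrrN mulrN atanN mulNr !mulrN opprD.
rewrite (ge0_continuous_FTC2T _ _ dF lFN lF).
- by rewrite -s2; congr EFin; field; rewrite gt_eqF.
- by move=> x; rewrite invr_ge0 exprn_ge0// ltW.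
- move=> x; apply: cvgV; first by rewrite expf_neq0 ?gt_eqF.
  have cw : {for x, continuous (fun x => c + x ^+ 2)} := is_derive_continuous dsq (x := x).
  by rewrite expr2; under eq_fun do rewrite expr2; apply: cvgM.
Unshelve. all: by end_near. Qed.
End OneDim.

(** * Planar integrals, integration by parts and the Gagliardo-Nirenberg inequality *)

Section Plane.
Context {R : realType}.
Notation mu := (@lebesgue_measure R).
Notation mu2 := ((@lebesgue_measure R) \x (@lebesgue_measure R))%E.
Implicit Types (f g : R * R -> R) (p q : R * R) (x y B : R).

(** Boxes with rational corners form a countable base, so the product sigma-algebra contains every
    open set. *)
Lemma open_measurable2 (U : set (R * R)) : open U ->
  measurable (U : set (measurableTypeR R * measurableTypeR R)).
Proof.
move=> oU.
pose box (q : (rat * rat) * (rat * rat)) : set (measurableTypeR R * measurableTypeR R) :=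
  `](ratr q.1.1 : R), ratr q.1.2[%classic `*` `](ratr q.2.1 : R), ratr q.2.2[%classic.
pose F (q : (rat * rat) * (rat * rat)) := if `[< box q `<=` U >] then box q else set0.
have -> : U = \bigcup_q F q.
  apply/seteqP; split=> [p Up|p [q _]]; last first.
    by rewrite /F; case: ifPn => // /asboolP bU /bU.
  have := oU; rewrite openE => /(_ p Up).
  rewrite /interior -nbhs_ballE => -[e /= e0 beU].
  have lt x : x - e < x by rewrite ltrBlDr ltrDl.
  have gt x : x < x + e by rewrite ltrDl.
  have [a1] := rat_in_itvoo (lt p.1); rewrite in_itv /= => /andP[a1l a1r].
  have [b1] := rat_in_itvoo (gt p.1); rewrite in_itv /= => /andP[b1l b1r].
  have [a2] := rat_in_itvoo (lt p.2); rewrite in_itv /= => /andP[a2l a2r].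
  have [b2] := rat_in_itvoo (gt p.2); rewrite in_itv /= => /andP[b2l b2r].
  exists ((a1, b1), (a2, b2)) => //; rewrite /F asboolT.
    by split; rewrite /= in_itv/=; apply/andP.
  move=> [u v] [] /=; rewrite !in_itv/= => /andP[q1 q2] /andP[q3 q4]; apply: beU.
  by split; rewrite /ball/= ltr_norml; apply/andP; split; lra.
apply: countable_bigcupT_measurable => // q; rewrite /F; case: ifPn => _ //.
by apply: measurableX; exact: measurable_itv.
Qed.

Lemma continuous_measurable2 f : continuous f ->
  measurable_fun [set: (measurableTypeR R * measurableTypeR R)] f.
Proof.
move=> /continuousP cf; apply: (measurability _ (RGenOpens.measurableE R)).
move=> _ [_ [a [b ->] <-]]; rewrite setTI; apply: open_measurable2.
exact/cf/interval_open.
Qed.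

Lemma cont_fst : continuous (fun p : R * R => p.1).
Proof. by move=> p; exact: cvg_fst. Qed.

Lemma cont_snd : continuous (fun p : R * R => p.2).
Proof. by move=> p; exact: cvg_snd. Qed.

Lemma cont_pair1 f y : continuous f -> continuous (fun x => f (x, y)).
Proof. by move=> cf x; apply: (continuous_comp (f := fun x => (x, y))); [exact: (cvg_pair (F := nbhs x) (G := nbhs x) (H := nbhs y) (f := fun t => t) (g := fun=> y) cvg_id (cvg_cst y))|exact: cf]. Qed.

Lemma cont_pair2 f x : continuous f -> continuous (fun y => f (x, y)).
Proof. by move=> cf y; apply: (continuous_comp (f := fun y => (x, y))); [exact: (cvg_pair (F := nbhs y) (G := nbhs x) (H := nbhs y) (f := fun=> x) (g := fun t => t) (cvg_cst x) cvg_id)|exact: cf]. Qed.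

Lemma weight_ge1 p : 1 <= weight p.
Proof. by rewrite /weight lerDl addr_ge0// sqr_ge0. Qed.

Lemma weight_gt0 p : 0 < weight p.
Proof. exact: lt_le_trans (weight_ge1 p). Qed.

Lemma weight_neq0 p : weight p != 0.
Proof. by rewrite gt_eqF// weight_gt0. Qed.

Lemma cont_weight : continuous (@weight R).
Proof.
apply: contD; first exact: cont_cst.
by apply: contD; apply: contX; [exact: cont_fst|exact: cont_snd].
Qed.

(* (1 + |z|^2)^(-3/2), the envelope dominating the planar integrands. *)
Definition kap p : R := (weight p * Num.sqrt (weight p))^-1.

Lemma sqrt_weight_ge1 p : 1 <= Num.sqrt (weight p).
Proof. by rewrite -[leLHS]sqrtr1 ler_wsqrtr// weight_ge1. Qed.

Lemma kap_gt0 p : 0 < kap p.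
Proof. by rewrite invr_gt0 mulr_gt0 ?weight_gt0// (lt_le_trans ltr01)// sqrt_weight_ge1. Qed.

Lemma cont_kap : continuous kap.
Proof.
apply: contV => [p|]; first by rewrite -invr_eq0 gt_eqF ?kap_gt0.
apply: contM; first exact: cont_weight.
by apply: cont_comp1; [exact: sqrt_continuous|exact: cont_weight].
Qed.

Lemma weight_pair1 x y : weight (x, y) = (1 + y ^+ 2) + x ^+ 2.
Proof. by rewrite /weight/=; ring. Qed.

Lemma weight_pair2 x y : weight (x, y) = (1 + x ^+ 2) + y ^+ 2.
Proof. by rewrite /weight/=; ring. Qed.

Lemma kap_le1 x y : kap (x, y) <= 1 / (1 + x ^+ 2).
Proof. by rewrite /kap weight_pair1; apply: inv_w32_le; rewrite lerDl sqr_ge0. Qed.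

Lemma kap_le2 x y : kap (x, y) <= 1 / (1 + y ^+ 2).
Proof. by rewrite /kap weight_pair2; apply: inv_w32_le; rewrite lerDl sqr_ge0. Qed.

Lemma integral_kap : (\int[mu2]_p (kap p)%:E = (2 * pi)%:E)%E.
Proof.
rewrite fubini_tonelli2; first last.
- by move=> p; rewrite lee_fin ltW ?kap_gt0.
- by apply/measurable_EFinP; apply: continuous_measurable2; exact: cont_kap.
transitivity (\int[mu]_y (2%:E * ((1 + y ^+ 2)^-1)%:E))%E.
  apply: eq_integral => y _; rewrite /fubini_G.
  under eq_integral => x _ do rewrite /kap weight_pair1.
  by rewrite integralT_inv_w32 ?EFinM// ltr_pwDl// sqr_ge0.
rewrite ge0_integralZl//; last 2 first.
- by apply/measurable_EFinP; apply: continuous_measurable_fun; exact: continuous_inv_1sq.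
- by move=> x _; rewrite lee_fin ltW// inv_1sq_gt0.
by rewrite integralT_inv_1sq.
Qed.

Lemma integral_inv_weight2 : (\int[mu2]_p ((weight p ^+ 2)^-1)%:E = (pi : R)%:E)%E.
Proof.
rewrite fubini_tonelli2; first last.
- by move=> p; rewrite lee_fin invr_ge0 sqr_ge0.
- apply/measurable_EFinP; apply: continuous_measurable2; apply: contV; last by apply: contX; exact: cont_weight.
  by move=> p; rewrite expf_neq0// weight_neq0.
have s1 y : 0 < 1 + y ^+ 2 :> R by rewrite ltr_pwDl// sqr_ge0.
transitivity (\int[mu]_y ((pi / 2)%:E * (((1 + y ^+ 2) * Num.sqrt (1 + y ^+ 2))^-1)%:E))%E.
  apply: eq_integral => y _; rewrite /fubini_G.
  under eq_integral => x _ do rewrite weight_pair1.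
  by rewrite integralT_inv_w2.
rewrite ge0_integralZl//; last 3 first.
- apply/measurable_EFinP; apply: continuous_measurable_fun; apply: contV.
    by move=> x; rewrite mulf_neq0// gt_eqF// sqrtr_gt0.
  apply: contM; first by apply: contD; [exact: cont_cst|apply: contX => x; exact: cvg_id].
  apply: cont_comp1; first exact: sqrt_continuous.
  by apply: contD; [exact: cont_cst|apply: contX => x; exact: cvg_id].
- by move=> x _; rewrite lee_fin invr_ge0 mulr_ge0// ltW.
- by rewrite lee_fin divr_ge0// pi_ge0.
by rewrite integralT_inv_w32// -EFinM; congr EFin; field.
Qed.

(** Domination by [kap], rather than bare integrability, also makes the restriction to every line
    integrable. Integration by parts and the Gagliardo-Nirenberg argument can then treat all lines,
    with no exceptional null set. *)
Definition PI f := continuous f /\ exists B, forall p, `|f p| <= B * kap p.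

Lemma PI_integrable f : PI f -> mu2.-integrable setT (EFin \o f).
Proof.
move=> [cf [B fB]].
have ik : mu2.-integrable setT (EFin \o kap).
  apply/integrableP; split.
    by apply/measurable_EFinP; apply: continuous_measurable2; exact: cont_kap.
  under eq_integral => p _ do rewrite /= gtr0_norm ?kap_gt0//.
  by rewrite integral_kap ltry.
apply: (le_integrable measurableT _ _ (integrableZl measurableT B ik)).
  by apply/measurable_EFinP; exact: continuous_measurable2.
by move=> p _ /=; rewrite lee_fin (le_trans (fB p))//; exact: ler_norm.
Qed.

Lemma PI_dom f g : continuous f -> PI g -> (forall p, `|f p| <= `|g p|) -> PI f.
Proof. by move=> cf [cg [B gB]] fg; split=> //; exists B => p; exact: le_trans (fg p) (gB p). Qed.

Lemma PID f g : PI f -> PI g -> PI (fun p => f p + g p).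
Proof.
move=> [cf [B fB]] [cg [B' gB]]; split; first exact: contD.
by exists (B + B') => p; rewrite mulrDl; apply: le_trans (ler_normD _ _) (lerD _ _).
Qed.

Lemma PIM f g B : PI f -> continuous g -> (forall p, `|g p| <= B) -> PI (fun p => f p * g p).
Proof.
move=> [cf [B' fB]] cg gB; split; first exact: contM.
exists (B' * B) => p; rewrite normrM mulrAC; apply: ler_pM => //.
Qed.

Lemma PIZ f c : PI f -> PI (fun p => c * f p).
Proof.
move=> pf; under eq_fun do rewrite mulrC; apply: (PIM (B := `|c|)) => //.
exact: cont_cst.
Qed.

Lemma PIN f : PI f -> PI (fun p => - f p).
Proof. by move=> pf; under eq_fun do rewrite -mulN1r; exact: PIZ. Qed.

Lemma PIB f g : PI f -> PI g -> PI (fun p => f p - g p).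
Proof. by move=> pf pg; apply: PID => //; exact: PIN. Qed.

Lemma PI_norm f : PI f -> PI (fun p => `|f p|).
Proof.
move=> [cf [B fB]]; split; first exact: cont_norm.
by exists B => p; rewrite normr_id.
Qed.

Lemma PI0 : PI (fun=> 0).
Proof. by split; [exact: cont_cst|exists 0 => p; rewrite normr0 mul0r]. Qed.

Lemma DplaneD f g : PI f -> PI g -> Dplane (fun p => f p + g p) = Dplane f + Dplane g.
Proof. by move=> /PI_integrable pf /PI_integrable pg; exact: RintegralD. Qed.

Lemma DplaneB f g : PI f -> PI g -> Dplane (fun p => f p - g p) = Dplane f - Dplane g.
Proof. by move=> /PI_integrable pf /PI_integrable pg; exact: RintegralB. Qed.

Lemma DplaneZ f c : PI f -> Dplane (fun p => c * f p) = c * Dplane f.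
Proof. by move=> /PI_integrable pf; exact: RintegralZl. Qed.

Lemma Dplane0 : Dplane (fun=> 0) = 0 :> R.
Proof. rewrite -[RHS](mul0r (Dplane (fun=> 0))) -(DplaneZ 0 PI0); congr Dplane.
by apply/funext => p; rewrite mul0r. Qed.

Lemma Dplane_le f g : PI f -> PI g -> (forall p, f p <= g p) -> Dplane f <= Dplane g.
Proof. by move=> /PI_integrable pf /PI_integrable pg fg; exact: le_Rintegral. Qed.

Lemma Dplane_ge0 f : (forall p, 0 <= f p) -> 0 <= Dplane f.
Proof. by move=> f0; exact: Rintegral_ge0. Qed.

Lemma PI_bound f : PI f -> exists2 B, 0 <= B & forall p, `|f p| <= B * kap p.
Proof.
move=> [_ [B fB]]; exists B => //.
by rewrite -(pmulr_lge0 _ (kap_gt0 (0,0))); exact: le_trans (normr_ge0 _) (fB _).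
Qed.

Lemma PI_line1 f y : PI f -> exists B, forall x, `|f (x, y)| <= B / (1 + x ^+ 2).
Proof.
move=> /PI_bound[B B0 fB]; exists B => x; apply: le_trans (fB _) _.
by rewrite -[X in _ <= B * X]div1r ler_wpM2l// kap_le1.
Qed.

Lemma PI_line2 f x : PI f -> exists B, forall y, `|f (x, y)| <= B / (1 + y ^+ 2).
Proof.
move=> /PI_bound[B B0 fB]; exists B => y; apply: le_trans (fB _) _.
by rewrite -[X in _ <= B * X]div1r ler_wpM2l// kap_le2.
Qed.

(** Too weak for integrability; it only has to make boundary terms vanish along each line. *)
Definition decay f := exists B, forall p, `|f p| <= B * (Num.sqrt (weight p))^-1.

Lemma decay_cvg1 f y : decay f -> f (x, y) @[x --> +oo] --> (0:R) /\ f (x, y) @[x --> -oo] --> (0:R).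
Proof.
move=> [B fB]; have c0 : 0 < 1 + y ^+ 2 by rewrite ltr_pwDl// sqr_ge0.
have h x : `|f (x, y)| <= B * (Num.sqrt (1 + y ^+ 2 + x ^+ 2))^-1 by rewrite -weight_pair1.
by split; apply: (cvg_norm_le0 h); [exact: cvgy_inv_sqrt|exact: cvgNy_inv_sqrt].
Qed.

Lemma decay_cvg2 f x : decay f -> f (x, y) @[y --> +oo] --> (0:R) /\ f (x, y) @[y --> -oo] --> (0:R).
Proof.
move=> [B fB]; have c0 : 0 < 1 + x ^+ 2 by rewrite ltr_pwDl// sqr_ge0.
have h y : `|f (x, y)| <= B * (Num.sqrt (1 + x ^+ 2 + y ^+ 2))^-1 by rewrite -weight_pair2.
by split; apply: (cvg_norm_le0 h); [exact: cvgy_inv_sqrt|exact: cvgNy_inv_sqrt].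
Qed.

Definition partial1 f g := forall x y, is_derive x 1 (fun t => f (t, y)) (g (x, y)).
Definition partial2 f g := forall x y, is_derive y 1 (fun t => f (x, t)) (g (x, y)).

Lemma Dplane_partial1 f g : partial1 f g -> decay f -> PI g -> Dplane g = 0.
Proof.
move=> fg df pg; have [cg _] := pg.
rewrite /Dplane /Rintegral -[(\int[_]_(_ in _) _)%E](@integral21_prod_meas1 _ _ (measurableTypeR R) (measurableTypeR R) R mu mu (EFin \o g) (PI_integrable pg)).
under eq_integral => y _.
  rewrite /fubini_G /=.
  have [B gB] := PI_line1 y pg.
  have [h1 h2] := decay_cvg1 y df.
  rewrite (integral_line_derive_eq0 (cont_pair1 (y := y) cg) gB (fun x => fg x y) h2 h1).
  over.
by rewrite integral0.
Qed.

Lemma Dplane_partial2 f g : partial2 f g -> decay f -> PI g -> Dplane g = 0.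
Proof.
move=> fg df pg; have [cg _] := pg.
rewrite /Dplane /Rintegral -[(\int[_]_(_ in _) _)%E](@integral12_prod_meas1 _ _ (measurableTypeR R) (measurableTypeR R) R mu mu (EFin \o g) (PI_integrable pg)).
under eq_integral => x _.
  rewrite /fubini_F /=.
  have [B gB] := PI_line2 x pg.
  have [h1 h2] := decay_cvg2 x df.
  rewrite (integral_line_derive_eq0 (cont_pair2 (x := x) cg) gB (fun y => fg x y) h2 h1).
  over.
by rewrite integral0.
Qed.

(** Integrating along the horizontal and the vertical line through (x, y) bounds |g(x, y)| by a
    function [H] of y and by a function [V] of x. The product bounds g^2, and its double integral
    factors. *)
Lemma gagliardo_nirenberg g g1 g2 : partial1 g g1 -> partial2 g g2 -> continuous g -> decay g ->
  PI g1 -> PI g2 ->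
  Dplane (fun p => g p ^+ 2) <= Dplane (fun p => `|g1 p|) * Dplane (fun p => `|g2 p|).
Proof.
move=> d1 d2 cg dg p1 p2.
have [c1 _] := p1; have [c2 _] := p2.
have m1 : measurable_fun [set: (measurableTypeR R * measurableTypeR R)] (fun p => `|(g1 p)%:E|)%E.
  by apply/measurable_EFinP; apply: continuous_measurable2; exact: cont_norm.
have m2 : measurable_fun [set: (measurableTypeR R * measurableTypeR R)] (fun p => `|(g2 p)%:E|)%E.
  by apply/measurable_EFinP; apply: continuous_measurable2; exact: cont_norm.
pose P2 := (measurableTypeR R * measurableTypeR R)%type.
pose H : measurableTypeR R -> \bar R := fubini_G mu (fun p : P2 => `|(g1 p)%:E|)%E.
pose V : measurableTypeR R -> \bar R := fubini_F mu (fun p : P2 => `|(g2 p)%:E|)%E.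
have mH : measurable_fun setT H by apply: measurable_fun_fubini_tonelli_G.
have mV : measurable_fun setT V by apply: measurable_fun_fubini_tonelli_F.
have H0 y : (0 <= H y)%E by apply: integral_ge0.
have V0 x : (0 <= V x)%E by apply: integral_ge0.
have gH x y : (`|g (x, y)|%:E <= H y)%E.
  have [B gB] := PI_line1 y p1; have [_ h2] := decay_cvg1 y dg.
  exact: (abs_le_integral_derive (cont_pair1 (y := y) c1) gB (fun x => d1 x y) h2).
have gV x y : (`|g (x, y)|%:E <= V x)%E.
  have [B gB] := PI_line2 x p2; have [_ h2] := decay_cvg2 x dg.
  exact: (abs_le_integral_derive (cont_pair2 (x := x) c2) gB (fun y => d2 x y) h2).
have G0 (p : P2) : (0 <= (g p ^+ 2)%:E)%E by rewrite lee_fin sqr_ge0.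
have mG : measurable_fun [set: P2] (fun p : P2 => (g p ^+ 2)%:E).
  by apply/measurable_EFinP; apply: continuous_measurable2; exact: contX.
have VH x : (\int[mu]_y (V x * H y) = V x * \int[mu]_y H y)%E by rewrite ge0_integralZl.
have key : (\int[mu2]_p (g p ^+ 2)%:E <= (\int[mu]_x V x) * (\int[mu]_y H y))%E.
  rewrite (fubini_tonelli1 _ mG G0).
  apply: (@le_trans _ _ (\int[mu]_x \int[mu]_y (V x * H y))%E).
    apply: ge0_le_integral => //.
    - by move=> x _; apply: integral_ge0 => y _; exact: (G0 (x, y)).
    - exact: measurable_fun_fubini_tonelli_F.
    - rewrite (_ : (fun x => _) = (fun x => V x * \int[mu]_y H y)%E); last by apply/funext.
      by apply: emeasurable_funM.
    move=> x _; apply: ge0_le_integral => //.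
    - exact: (measurable_fun_pair2 x mG).
    - exact: measurable_funeM.
    move=> y _; rewrite -(real_normK (num_real (g (x, y)))) expr2 EFinM.
    by apply: lee_pmul; rewrite ?lee_fin.
  under eq_integral => x _ do rewrite VH.
  by rewrite ge0_integralZr// integral_ge0.
have e1 : (\int[mu]_y H y = (Dplane (fun p => `|g1 p|))%:E)%E.
  rewrite /H -(fubini_tonelli2 _ m1)//.
  rewrite /Dplane /Rintegral fineK//.
  by apply: (integrable_fin_num measurableT (PI_integrable (PI_norm p1))).
have e2 : (\int[mu]_x V x = (Dplane (fun p => `|g2 p|))%:E)%E.
  rewrite /V -(fubini_tonelli1 _ m2)//.
  rewrite /Dplane /Rintegral fineK//.
  by apply: (integrable_fin_num measurableT (PI_integrable (PI_norm p2))).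
move: key; rewrite e1 e2 -EFinM mulrC => key.
rewrite [leLHS]/Dplane /Rintegral -lee_fin fineK//.
rewrite ge0_fin_numE; first exact: le_lt_trans key (ltry _).
by apply: integral_ge0 => p _; rewrite lee_fin sqr_ge0.
Qed.

End Plane.

(** * Moments, rotation fields and the Bessel inequality *)

Section CPlane.
Context {R : realType}.
Local Notation C := R[i].
Local Open Scope complex_scope.
Implicit Types (F G : R * R -> C) (p : R * R).
Local Notation "z ^J" := (conjc z) (at level 2, format "z ^J").
Notation Re := (@complex.Re R).
Notation Im := (@complex.Im R).

Lemma cReD (x y : C) : Re (x + y) = Re x + Re y. Proof. by case: x; case: y. Qed.

Lemma cImD (x y : C) : Im (x + y) = Im x + Im y. Proof. by case: x; case: y. Qed.

Lemma cReN (x : C) : Re (- x) = - Re x. Proof. by case: x. Qed.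

Lemma cImN (x : C) : Im (- x) = - Im x. Proof. by case: x. Qed.

Lemma cReM (x y : C) : Re (x * y) = Re x * Re y - Im x * Im y. Proof. by case: x; case: y. Qed.

Lemma cImM (x y : C) : Im (x * y) = Re x * Im y + Im x * Re y. Proof. by case: x => a b; case: y => c d /=; ring. Qed.

Lemma cReJ (x : C) : Re x^J = Re x. Proof. by case: x. Qed.

Lemma cImJ (x : C) : Im x^J = - Im x. Proof. by case: x. Qed.

Lemma complexE2 (x y : C) : Re x = Re y -> Im x = Im y -> x = y.
Proof. by case: x => a b; case: y => c d /= -> ->. Qed.

Lemma rcM (a b : R) : (a * b)%:C = a%:C * b%:C. Proof. by apply: complexE2; rewrite ?cReM ?cImM /=; ring. Qed.

Lemma rcD (a b : R) : (a + b)%:C = a%:C + b%:C. Proof. by apply: complexE2; rewrite ?cReD ?cImD /=; ring. Qed.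

Lemma rcX (a : R) n : (a ^+ n)%:C = a%:C ^+ n.
Proof. by elim: n => [|n IH]; rewrite ?expr0// !exprS rcM IH. Qed.

Lemma rcn (n : nat) : (n%:R : R)%:C = n%:R. Proof. by rewrite rmorph_nat. Qed.

Lemma cJD (x y : C) : (x + y)^J = x^J + y^J.
Proof. by apply: complexE2; rewrite ?(cReJ, cImJ, cReD, cImD) ?cReJ ?cImJ //; ring. Qed.

Lemma cJN (x : C) : (- x)^J = - x^J.
Proof. by apply: complexE2; rewrite ?(cReJ, cImJ, cReN, cImN). Qed.

Lemma cJM (x y : C) : (x * y)^J = x^J * y^J.
Proof. by apply: complexE2; rewrite ?(cReJ, cImJ, cReM, cImM); ring. Qed.

Lemma cJR (a : R) : (a%:C)^J = a%:C.
Proof. by apply: complexE2; rewrite ?(cReJ, cImJ) //= oppr0. Qed.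

Lemma cJn (n : nat) : (n%:R : C)^J = n%:R.
Proof. by rewrite -rcn cJR. Qed.

Lemma cJX (x : C) n : (x ^+ n)^J = x^J ^+ n.
Proof. by elim: n => [|n IH]; [rewrite !expr0; apply: (cJn 1)|rewrite !exprS cJM IH]. Qed.

Lemma cJK (x : C) : x^J^J = x.
Proof. by apply: complexE2; rewrite ?(cReJ, cImJ) ?opprK. Qed.

Lemma cJ_sum (T : Type) (r : seq T) (F : T -> C) : (\sum_(i <- r) F i)^J = \sum_(i <- r) (F i)^J.
Proof.
elim: r => [|i r IH]; first by rewrite !big_nil; exact: (cJn 0).
by rewrite !big_cons cJD IH.
Qed.

Definition nrm2 (z : C) : R := Re z ^+ 2 + Im z ^+ 2.
Lemma nrm2_ge0 z : 0 <= nrm2 z. Proof. by rewrite addr_ge0// sqr_ge0. Qed.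

Lemma nrm2M x y : nrm2 (x * y) = nrm2 x * nrm2 y.
Proof. by rewrite /nrm2 cReM cImM; ring. Qed.

Lemma nrm2J x : nrm2 x^J = nrm2 x.
Proof. by rewrite /nrm2 cReJ cImJ sqrrN. Qed.

Lemma nrm2X x n : nrm2 (x ^+ n) = nrm2 x ^+ n.
Proof.
elim: n => [|n IH]; last by rewrite !exprS nrm2M IH.
by rewrite !expr0 /nrm2/= expr0n/= addr0 expr1n.
Qed.

Lemma nrm2R (a : R) : nrm2 a%:C = a ^+ 2.
Proof. by rewrite /nrm2/= expr0n/= addr0. Qed.

Lemma nrm2D_le x y : nrm2 (x + y) <= 2 * (nrm2 x + nrm2 y).
Proof.
rewrite /nrm2 cReD cImD; have := sqr_ge0 (Re x - Re y); have := sqr_ge0 (Im x - Im y); nra.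
Qed.

Lemma Re_sqr_le x : Re x ^+ 2 <= nrm2 x. Proof. by rewrite lerDl sqr_ge0. Qed.

Lemma Im_sqr_le x : Im x ^+ 2 <= nrm2 x. Proof. by rewrite lerDr sqr_ge0. Qed.

Lemma nrm2_toC p : nrm2 (toC p) = weight p - 1.
Proof. by rewrite /nrm2 /weight/=; ring. Qed.

Lemma toCJ p : toC p * (toC p)^J = (weight p - 1)%:C.
Proof. by apply: complexE2; rewrite ?cReM ?cImM ?cReJ ?cImJ /weight /=; ring. Qed.

Lemma mulcJ x : x * x^J = (nrm2 x)%:C.
Proof. by apply: complexE2; rewrite ?cReM ?cImM ?cReJ ?cImJ /nrm2 /=; ring. Qed.

Definition ccont F := continuous (Re \o F) /\ continuous (Im \o F).
Lemma ccont_cst c : ccont (fun=> c). Proof. by split; exact: cont_cst. Qed.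

Lemma ccontD F G : ccont F -> ccont G -> ccont (fun p => F p + G p).
Proof.
move=> [a b] [c d]; split.
  by rewrite (_ : _ \o _ = fun p => Re (F p) + Re (G p)); [exact: contD|apply/funext => p /=; rewrite cReD].
by rewrite (_ : _ \o _ = fun p => Im (F p) + Im (G p)); [exact: contD|apply/funext => p /=; rewrite cImD].
Qed.

Lemma ccontM F G : ccont F -> ccont G -> ccont (fun p => F p * G p).
Proof.
move=> [a b] [c d]; split.
  rewrite (_ : _ \o _ = fun p => Re (F p) * Re (G p) - Im (F p) * Im (G p)); last by apply/funext => p /=; rewrite cReM.
  by apply: contB; exact: contM.
rewrite (_ : _ \o _ = fun p => Re (F p) * Im (G p) + Im (F p) * Re (G p)); last by apply/funext => p /=; rewrite cImM.
by apply: contD; exact: contM.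
Qed.

Lemma ccontX F n : ccont F -> ccont (fun p => F p ^+ n).
Proof.
move=> cF; elim: n => [|n IH]; first exact: ccont_cst.
by under eq_fun do rewrite exprS; exact: ccontM.
Qed.

Lemma ccontJ F : ccont F -> ccont (fun p => (F p)^J).
Proof.
move=> [a b]; split.
  by rewrite (_ : _ \o _ = fun p => Re (F p)) //; apply/funext => p /=; rewrite cReJ.
by rewrite (_ : _ \o _ = fun p => - Im (F p)); [exact: contN|apply/funext => p /=; rewrite cImJ].
Qed.

Lemma ccontR (f : R * R -> R) : continuous f -> ccont (fun p => (f p)%:C).
Proof. by move=> cf; split => //=; exact: cont_cst. Qed.

Lemma ccont_sum (T : Type) (r : seq T) (F : T -> R * R -> C) : (forall i, ccont (F i)) ->
  ccont (fun p => \sum_(i <- r) F i p).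
Proof.
move=> cF; elim: r => [|i r IH].
  by under eq_fun do rewrite big_nil; exact: ccont_cst.
by under eq_fun do rewrite big_cons; exact: ccontD.
Qed.

Lemma ccont_toC : ccont (@toC R).
Proof. by split; [exact: cont_fst|exact: cont_snd]. Qed.

Lemma cont_nrm2 F : ccont F -> continuous (fun p => nrm2 (F p)).
Proof. by move=> [a b]; apply: contD; exact: contX. Qed.

Definition cPI F := PI (Re \o F) /\ PI (Im \o F).
Definition cD F : C := Dplane (Re \o F) +i* Dplane (Im \o F).

Arguments cD : simpl never.

Lemma cPI_nrm2 F B : ccont F -> (forall p, nrm2 (F p) <= B / weight p ^+ 3) -> cPI F.
Proof.
move=> [cr ci] FB.
have B0 : 0 <= B.
  have := FB (0, 0); rewrite ler_pdivlMr ?exprn_gt0 ?weight_gt0//.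
  by apply: le_trans; rewrite mulr_ge0 ?nrm2_ge0// exprn_ge0// ltW// weight_gt0.
have key (x : R) p : x ^+ 2 <= nrm2 (F p) -> `|x| <= Num.sqrt B * kap p.
  move=> xF; rewrite -sqrtr_sqr.
  have -> : Num.sqrt B * kap p = Num.sqrt (B / weight p ^+ 3).
    rewrite sqrtrM// sqrtrV ?exprn_ge0 ?(ltW (weight_gt0 _))//; congr (_ * _^-1).
    have w0 := ltW (weight_gt0 p).
    by rewrite exprS sqrtrM// sqrtr_sqr ger0_norm// mulrC.
  by apply: ler_wsqrtr; exact: le_trans (FB p).
by split; split => //; exists (Num.sqrt B) => p; apply: key; [exact: Re_sqr_le|exact: Im_sqr_le].
Qed.

Lemma cPID F G : cPI F -> cPI G -> cPI (fun p => F p + G p).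
Proof.
move=> [a b] [c d]; split.
  by rewrite (_ : _ \o _ = fun p => Re (F p) + Re (G p)); [exact: PID|apply/funext => p /=; rewrite cReD].
by rewrite (_ : _ \o _ = fun p => Im (F p) + Im (G p)); [exact: PID|apply/funext => p /=; rewrite cImD].
Qed.

Lemma cDD F G : cPI F -> cPI G -> cD (fun p => F p + G p) = cD F + cD G.
Proof.
move=> [a b] [c d]; rewrite /cD; apply: complexE2; rewrite ?cReD ?cImD /=.
  by rewrite -DplaneD//; congr Dplane; apply/funext => p /=; rewrite cReD.
by rewrite -DplaneD//; congr Dplane; apply/funext => p /=; rewrite cImD.
Qed.

Lemma cPIZ F c : cPI F -> cPI (fun p => c * F p).
Proof.
move=> [a b]; split.
  rewrite (_ : _ \o _ = fun p => Re c * Re (F p) - Im c * Im (F p)); last by apply/funext => p /=; rewrite cReM.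
  by apply: PIB; exact: PIZ.
rewrite (_ : _ \o _ = fun p => Re c * Im (F p) + Im c * Re (F p)); last by apply/funext => p /=; rewrite cImM.
by apply: PID; exact: PIZ.
Qed.

Lemma cDZ F c : cPI F -> cD (fun p => c * F p) = c * cD F.
Proof.
move=> [a b]; rewrite /cD; apply: complexE2; rewrite ?cReM ?cImM /=.
  rewrite -!DplaneZ// -DplaneB; [|exact: PIZ..].
  by congr Dplane; apply/funext => p /=; rewrite cReM.
rewrite -!DplaneZ// -DplaneD; [|exact: PIZ..].
by congr Dplane; apply/funext => p /=; rewrite cImM.
Qed.

Lemma cPI_sum (T : Type) (r : seq T) (F : T -> R * R -> C) : (forall i, cPI (F i)) ->
  cPI (fun p => \sum_(i <- r) F i p).
Proof.
move=> PF; elim: r => [|i r IH].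
  by under eq_fun do rewrite big_nil; split; exact: PI0.
by under eq_fun do rewrite big_cons; exact: cPID.
Qed.

Lemma cD_sum (T : Type) (r : seq T) (F : T -> R * R -> C) : (forall i, cPI (F i)) ->
  cD (fun p => \sum_(i <- r) F i p) = \sum_(i <- r) cD (F i).
Proof.
move=> PF; elim: r => [|i r IH].
  rewrite big_nil; under eq_fun do rewrite big_nil.
  by apply: complexE2; rewrite /= -[RHS](@Dplane0 R).
rewrite big_cons -IH -cDD//; last exact: cPI_sum.
by congr cD; apply/funext => p; rewrite big_cons.
Qed.

Lemma cDJ F : cPI F -> cD (fun p => (F p)^J ) = (cD F)^J.
Proof.
move=> [a b]; rewrite /cD; apply: complexE2; rewrite ?cReJ ?cImJ /=.
  by congr Dplane; apply/funext => p /=; rewrite cReJ.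
rewrite -mulN1r -DplaneZ//; congr Dplane; apply/funext => p /=.
by rewrite cImJ mulN1r.
Qed.

Lemma cPIJ F : cPI F -> cPI (fun p => (F p)^J ).
Proof.
move=> [a b]; split.
  by rewrite (_ : _ \o _ = Re \o F)//; apply/funext => p /=; rewrite cReJ.
by rewrite (_ : _ \o _ = fun p => - (Im (F p))); [exact: PIN|apply/funext => p /=; rewrite cImJ].
Qed.

Definition cpartial1 F G := partial1 (Re \o F) (Re \o G) /\ partial1 (Im \o F) (Im \o G).
Definition cpartial2 F G := partial2 (Re \o F) (Re \o G) /\ partial2 (Im \o F) (Im \o G).

Lemma cpartial1M F G F' G' : cpartial1 F F' -> cpartial1 G G' ->
  cpartial1 (fun p => F p * G p) (fun p => F' p * G p + F p * G' p).
Proof.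
move=> [a b] [c d]; split=> x y /=.
  under eq_fun do rewrite cReM.
  have h := is_derive_sub (is_derive_mul (a x y) (c x y)) (is_derive_mul (b x y) (d x y)).
  by apply: is_derive_eq; rewrite /= cReD !cReM; ring.
under eq_fun do rewrite cImM.
have h := is_derive_add (is_derive_mul (a x y) (d x y)) (is_derive_mul (b x y) (c x y)).
by apply: is_derive_eq; rewrite /= cImD !cImM; ring.
Qed.

Lemma cpartial2M F G F' G' : cpartial2 F F' -> cpartial2 G G' ->
  cpartial2 (fun p => F p * G p) (fun p => F' p * G p + F p * G' p).
Proof.
move=> [a b] [c d]; split=> x y /=.
  under eq_fun do rewrite cReM.
  have h := is_derive_sub (is_derive_mul (a x y) (c x y)) (is_derive_mul (b x y) (d x y)).
  by apply: is_derive_eq; rewrite /= cReD !cReM; ring.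
under eq_fun do rewrite cImM.
have h := is_derive_add (is_derive_mul (a x y) (d x y)) (is_derive_mul (b x y) (c x y)).
by apply: is_derive_eq; rewrite /= cImD !cImM; ring.
Qed.

(* [wirt F dF bF]: [dF] and [bF] are the derivatives of [F] in z and in its conjugate. *)
Definition wirt F dF bF := cpartial1 F (fun p => dF p + bF p) /\
  cpartial2 F (fun p => 'i * (dF p - bF p)).

Lemma wirtM F G dF bF dG bG : wirt F dF bF -> wirt G dG bG ->
  wirt (fun p => F p * G p) (fun p => dF p * G p + F p * dG p) (fun p => bF p * G p + F p * bG p).
Proof.
move=> [a b] [c d]; split.
  have := cpartial1M a c; congr cpartial1.
  by apply/funext => p; ring.
have := cpartial2M b d; congr cpartial2.
by apply/funext => p; ring.
Qed.

Lemma wirt_cst c : wirt (fun=> c) (fun=> 0) (fun=> 0).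
Proof.
by split; split => x y /=; apply: (is_derive_eq (is_derive_cst1 _ _)); rewrite ?(cReM, cImM, cReD, cImD, cReN, cImN, cReJ, cImJ) /=; ring.
Qed.

Lemma wirt_toC : wirt (@toC R) (fun=> 1) (fun=> 0).
Proof.
by split; split => x y /=;
  [apply: (is_derive_eq (is_derive_id1 _))|apply: (is_derive_eq (is_derive_cst1 _ _))
  |apply: (is_derive_eq (is_derive_cst1 _ _))|apply: (is_derive_eq (is_derive_id1 _))];
  rewrite ?(cReM, cImM, cReD, cImD, cReN, cImN, cReJ, cImJ) /=; ring.
Qed.

Lemma wirt_toCJ : wirt (fun p => (toC p)^J ) (fun=> 0) (fun=> 1).
Proof.
by split; split => x y /=;
  [apply: (is_derive_eq (is_derive_id1 _))|apply: (is_derive_eq (is_derive_cst1 _ _))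
  |apply: (is_derive_eq (is_derive_cst1 _ _))|apply: (is_derive_eq (is_derive_opp (is_derive_id1 _)))];
  rewrite ?(cReM, cImM, cReD, cImD, cReN, cImN, cReJ, cImJ) /=; ring.
Qed.

Lemma wirtX F dF bF n : wirt F dF bF ->
  wirt (fun p => F p ^+ n) (fun p => n%:R * F p ^+ n.-1 * dF p) (fun p => n%:R * F p ^+ n.-1 * bF p).
Proof.
move=> wF; elim: n => [|n IH].
  by have := wirt_cst 1; congr wirt; apply/funext => p; rewrite ?expr0 ?mul0r.
have := wirtM wF IH; case: n {IH} => [|n]; congr wirt; apply/funext => p; rewrite ?exprS/= ?expr0.
- by [].
- by rewrite !mul0r mulr0 addr0 mulr1 !mul1r.
- by rewrite !mul0r mulr0 addr0 mulr1 !mul1r.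
- by rewrite -[in RHS](natr1 n.+1); ring.
- by rewrite -[in RHS](natr1 n.+1); ring.
Qed.

Lemma wirt_winv : wirt (fun p => ((weight p)^-1)%:C)
  (fun p => - (toC p)^J * ((weight p)^-1 ^+ 2)%:C) (fun p => - toC p * ((weight p)^-1 ^+ 2)%:C).
Proof.
have d1 (x y : R) : is_derive x 1 (fun t => (weight (t, y))^-1) (- (x *+ 2) / weight (x, y) ^+ 2).
  apply: (is_derive_inv (f := fun t => weight (t, y)) (weight_neq0 (x, y))).
  have h := is_derive_add (is_derive_cst1 x 1) (is_derive_add (is_derive_mul (is_derive_id1 x) (is_derive_id1 x)) (is_derive_cst1 x (y ^+ 2))).
  by apply: (is_derive_eq h); ring.
have d2 (x y : R) : is_derive y 1 (fun t => (weight (x, t))^-1) (- (y *+ 2) / weight (x, y) ^+ 2).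
  apply: (is_derive_inv (f := fun t => weight (x, t)) (weight_neq0 (x, y))).
  have h := is_derive_add (is_derive_cst1 y 1) (is_derive_add (is_derive_cst1 y (x ^+ 2)) (is_derive_mul (is_derive_id1 y) (is_derive_id1 y))).
  by apply: (is_derive_eq h); ring.
split; split => x y /=; [apply: (is_derive_eq (d1 x y))|apply: (is_derive_eq (is_derive_cst1 _ _))
  |apply: (is_derive_eq (d2 x y))|apply: (is_derive_eq (is_derive_cst1 _ _))];
  rewrite ?(cReM, cImM, cReD, cImD, cReN, cImN, cReJ, cImJ) -?exprVn /=; ring.
Qed.

Definition mono a b k p : C := toC p ^+ a * (toC p)^J ^+ b * ((weight p)^-1 ^+ k)%:C.

Lemma winv_ge0 p : 0 <= (weight p)^-1.
Proof. by rewrite invr_ge0 ltW// weight_gt0. Qed.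

Lemma winv_le1 p : (weight p)^-1 <= 1.
Proof. by rewrite invf_le1 ?weight_gt0// weight_ge1. Qed.

(** Since |z|^2 = w - 1 <= w, the squared modulus is at most w^(a + b - 2k). The values m = 0, 1, 3
    give boundedness, [decay] and domination by [kap] respectively. *)
Lemma nrm2_mono_le a b k m p : (a + b + m <= k.*2)%N -> nrm2 (mono a b k p) <= (weight p)^-1 ^+ m.
Proof.
move=> abk; rewrite /mono !nrm2M !nrm2X nrm2J nrm2R nrm2_toC -exprD -exprM muln2.
have w0 := weight_gt0 p.
apply: (@le_trans _ _ (weight p ^+ (a + b) * (weight p)^-1 ^+ k.*2)).
  rewrite ler_wpM2r ?exprn_ge0 ?winv_ge0// lerXn2r ?nnegrE ?subr_ge0 ?weight_ge1 ?ltW//.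
  by rewrite ltrBlDr ltrDl.
have -> : k.*2 = (a + b + (k.*2 - (a + b)))%N by lia.
rewrite [X in _ * X]exprD mulrA -exprMn divff ?weight_neq0// expr1n mul1r.
by apply: ler_wiXn2l; rewrite ?winv_ge0 ?winv_le1//; lia.
Qed.

Lemma ccont_winv k : ccont (fun p => ((weight p)^-1 ^+ k)%:C).
Proof.
by apply: ccontR; apply: contX; apply: contV; [exact: weight_neq0|exact: cont_weight].
Qed.

Lemma ccont_mono a b k : ccont (mono a b k).
Proof.
apply: ccontM; last exact: ccont_winv.
by apply: ccontM; apply: ccontX; [exact: ccont_toC|apply: ccontJ; exact: ccont_toC].
Qed.

Definition cB F := ccont F /\ exists B, forall p, nrm2 (F p) <= B.

Lemma cB_mono a b k : (a + b <= k.*2)%N -> cB (mono a b k).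
Proof.
move=> abk; split; first exact: ccont_mono.
by exists 1 => p; have := @nrm2_mono_le a b k 0 p; rewrite addn0 expr0; exact.
Qed.

Lemma cBM F G : cB F -> cB G -> cB (fun p => F p * G p).
Proof.
move=> [cF [B FB]] [cG [B' GB]]; split; first exact: ccontM.
by exists (B * B') => p; rewrite nrm2M ler_pM ?nrm2_ge0.
Qed.

Lemma cBD F G : cB F -> cB G -> cB (fun p => F p + G p).
Proof.
move=> [cF [B FB]] [cG [B' GB]]; split; first exact: ccontD.
by exists (2 * (B + B')) => p; apply: le_trans (nrm2D_le _ _) _; rewrite ler_wpM2l// lerD.
Qed.

Lemma cB_cst c : cB (fun=> c).
Proof. by split; [exact: ccont_cst|exists (nrm2 c)]. Qed.

Lemma cBJ F : cB F -> cB (fun p => (F p)^J ).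
Proof. by move=> [cF [B FB]]; split; [exact: ccontJ|exists B => p; rewrite nrm2J]. Qed.

Lemma cB_ge0 F : cB F -> exists2 B, 0 <= B & forall p, nrm2 (F p) <= B.
Proof. by move=> [_ [B FB]]; exists B => //; exact: le_trans (nrm2_ge0 _) (FB (0, 0)). Qed.

Lemma cPI_mono F a b k : cB F -> (a + b + 3 <= k.*2)%N -> cPI (fun p => F p * mono a b k p).
Proof.
move=> bF abk; have [cF _] := bF; have [B B0 FB] := cB_ge0 bF.
apply: (@cPI_nrm2 _ B); first by apply: ccontM => //; exact: ccont_mono.
move=> p; rewrite nrm2M -exprVn; apply: ler_pM; rewrite ?nrm2_ge0//.
exact: nrm2_mono_le.
Qed.

Lemma sqr_le_sqrt (x y : R) : x ^+ 2 <= y -> `|x| <= Num.sqrt y.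
Proof. by move=> xy; rewrite -sqrtr_sqr ler_wsqrtr. Qed.

Lemma decay_mono F a b k : cB F -> (a + b + 1 <= k.*2)%N ->
  decay (fun p => Re (F p * mono a b k p)) /\ decay (fun p => Im (F p * mono a b k p)).
Proof.
move=> bF abk; have [B B0 FB] := cB_ge0 bF.
have key p : nrm2 (F p * mono a b k p) <= B * (weight p)^-1.
  rewrite nrm2M -[(weight p)^-1]expr1; apply: ler_pM; rewrite ?nrm2_ge0//.
  exact: nrm2_mono_le.
split; exists (Num.sqrt B) => p; rewrite -sqrtrV ?(ltW (weight_gt0 p))// -sqrtrM//;
  apply: sqr_le_sqrt; apply: le_trans (key p); [exact: Re_sqr_le|exact: Im_sqr_le].
Qed.

(** The integrals of the two real partial derivatives vanish, and these are the sum and, up to a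
    factor, the difference of the two integrals in question. *)
Lemma cD_wirt F dF bF : wirt F dF bF -> decay (fun p => Re (F p)) -> decay (fun p => Im (F p)) ->
  cPI dF -> cPI bF -> cD dF = 0 /\ cD bF = 0.
Proof.
move=> [[a b] [c d]] dr di pd pb.
have [s1 s2] := cPID pd pb.
have pm : cPI (fun p => 'i * (dF p - bF p)).
  apply: (cPIZ (F := fun p => dF p - bF p)).
  have := cPID pd (cPIZ (-1) pb); congr cPI; apply/funext => p; ring.
have [m1 m2] := pm.
have e1 : cD (fun p => dF p + bF p) = 0.
  by apply: complexE2; rewrite /cD /=; [exact: (Dplane_partial1 a)|exact: (Dplane_partial1 b)].
have e2 : cD (fun p => 'i * (dF p - bF p)) = 0.
  by apply: complexE2; rewrite /cD /=; [exact: (Dplane_partial2 c)|exact: (Dplane_partial2 d)].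
have e3 : cD dF - cD bF = 0.
  have i0 : ('i : C) != 0 by rewrite eq_complex /= oner_eq0 andbF.
  have pm1 : cPI (fun p => dF p + -1 * bF p) by apply: cPID => //; exact: cPIZ.
  have : 'i * cD (fun p => dF p + -1 * bF p) = 0.
    by rewrite -cDZ//; move: e2; congr (cD _ = 0); apply/funext => p; ring.
  move/eqP; rewrite mulf_eq0 (negbTE i0) /= => /eqP.
  by rewrite cDD//; [rewrite cDZ// mulN1r|exact: cPIZ].
rewrite cDD// in e1.
have h2 : (2 : C) != 0 by rewrite pnatr_eq0.
by split; apply: (mulfI h2); rewrite mulr0; [rewrite -[RHS](addr0 0) -{1}e1 -e3|rewrite -[RHS](subr0 0) -{1}e1 -e3]; ring.
Qed.

(** The round gradient is w / 2 times the planar one, so the last two conditions say that the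
    gradient is bounded on the sphere, including near infinity. *)
Definition tame F dF bF := [/\ wirt F dF bF, cB F,
  cB (fun p => (weight p)%:C * dF p) & cB (fun p => (weight p)%:C * bF p)].

Definition dmono a b k p : C := a%:R * mono a.-1 b k p - k%:R * mono a b.+1 k.+1 p.
Definition bmono a b k p : C := b%:R * mono a b.-1 k p - k%:R * mono a.+1 b k.+1 p.

Lemma wirt_mono a b k : wirt (mono a b k) (dmono a b k) (bmono a b k).
Proof.
have := wirtM (wirtM (wirtX a wirt_toC) (wirtX b wirt_toCJ)) (wirtX k wirt_winv).
congr wirt; apply/funext => p; rewrite /dmono /bmono /mono ?rcX //.
  by case: k => [|k] /=; do ?rewrite exprS; ring.
by case: k => [|k] /=; do ?rewrite exprS; ring.
Qed.

Lemma cPI_dmono F a b k : cB F -> (a + b + 2 <= k.*2)%N -> cPI (fun p => F p * dmono a b k p).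
Proof.
move=> bF abk.
have h1 : cPI (fun p => a%:R * (F p * mono a.-1 b k p)).
  (* For a = 0 the truncated [a.-1] does not lower the degree and the condition on exponents may
     fail; the coefficient a kills the term. *)
  case: a abk => [|a] abk; last by apply: cPIZ; apply: cPI_mono => //=; lia.
  under eq_fun do rewrite mul0r; by split; exact: PI0.
have h2 : cPI (fun p => - k%:R * (F p * mono a b.+1 k.+1 p)).
  by apply: cPIZ; apply: cPI_mono => //=; lia.
have := cPID h1 h2; congr cPI; apply/funext => p; rewrite /dmono; ring.
Qed.

Lemma cPI_bmono F a b k : cB F -> (a + b + 2 <= k.*2)%N -> cPI (fun p => F p * bmono a b k p).
Proof.
move=> bF abk.
have h1 : cPI (fun p => b%:R * (F p * mono a b.-1 k p)).
  case: b abk => [|b] abk; last by apply: cPIZ; apply: cPI_mono => //=; lia.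
  under eq_fun do rewrite mul0r; by split; exact: PI0.
have h2 : cPI (fun p => - k%:R * (F p * mono a.+1 b k.+1 p)).
  by apply: cPIZ; apply: cPI_mono => //=; lia.
have := cPID h1 h2; congr cPI; apply/funext => p; rewrite /bmono; ring.
Qed.

Lemma monoS a b k p : mono a b k.+1 p = ((weight p)^-1)%:C * mono a b k p.
Proof. by rewrite /mono exprS rcM; ring. Qed.

(** This is 1 = (1 + |z|^2) / w. It links the moments of level N to those of level N + 1. *)
Lemma mono_split a b k p : mono a b k p = mono a b k.+1 p + mono a.+1 b.+1 k.+1 p.
Proof.
have -> : mono a.+1 b.+1 k.+1 p = (toC p * (toC p)^J ) * mono a b k.+1 p.
  by rewrite /mono !exprS; ring.
rewrite toCJ monoS mulrA -rcM -mulrDl -rcD mulrBl divff ?weight_neq0// mul1r addrC subrK.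
by rewrite mul1r.
Qed.

Definition mom F a b k := cD (fun p => F p * mono a b k p).

Arguments mom : simpl never.

Lemma cPI_wder F a b k : cB (fun p => (weight p)%:C * F p) -> (a + b + 1 <= k.*2)%N ->
  cPI (fun p => F p * mono a b k p).
Proof.
move=> bF abk.
have := @cPI_mono _ a b k.+1 bF; have -> : (a + b + 3 <= k.+1.*2)%N by lia.
move=> /(_ isT); congr cPI; apply/funext => p; rewrite monoS mulrACA -rcM divff ?weight_neq0//.
by rewrite mul1r.
Qed.

(** The condition on the exponents is met with equality in the extreme case of [Zplus], where a + b
    = 2N + 2 and k = N + 2. *)
Lemma ibp_d F dF bF a b k : tame F dF bF -> (a + b + 2 <= k.*2)%N ->
  mom dF a b k = - a%:R * mom F a.-1 b k + k%:R * mom F a b.+1 k.+1.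
Proof.
move=> [wF cF cdF cbF] abk.
have abk1 : (a + b + 1 <= k.*2)%N by lia.
have [dr di] := decay_mono cF abk1.
have pd1 := cPI_wder cdF abk1; have pb1 := cPI_wder cbF abk1.
have pd2 := cPI_dmono cF abk; have pb2 := cPI_bmono cF abk.
have [h _] := cD_wirt (wirtM wF (wirt_mono a b k)) dr di (cPID pd1 pd2) (cPID pb1 pb2).
move: h; rewrite cDD// -/(mom dF a b k) => /eqP; rewrite addr_eq0 => /eqP ->.
have h1 : cPI (fun p => a%:R * (F p * mono a.-1 b k p)).
  case: a abk {abk1 dr di pd1 pb1 pd2 pb2} => [|a] abk; last by apply: cPIZ; apply: cPI_mono => //=; lia.
  under eq_fun do rewrite mul0r; by split; exact: PI0.
have p2 : cPI (fun p => F p * mono a b.+1 k.+1 p) by apply: cPI_mono => //=; lia.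
have -> : cD (fun p => F p * dmono a b k p) =
   cD (fun p => a%:R * (F p * mono a.-1 b k p) + (- k%:R) * (F p * mono a b.+1 k.+1 p)).
  by congr cD; apply/funext => p; rewrite /dmono; ring.
rewrite cDD//; last exact: cPIZ.
rewrite (cDZ _ p2).
have -> : cD (fun p => a%:R * (F p * mono a.-1 b k p)) = a%:R * mom F a.-1 b k.
  case: a abk {abk1 dr di pd1 pb1 pd2 pb2 h1 p2} => [|a] abk; last by rewrite cDZ//; apply: cPI_mono => //=; lia.
  under eq_fun do rewrite mul0r; rewrite mul0r.
  by apply: complexE2; exact: Dplane0.
by rewrite -/(mom F a b.+1 k.+1); ring.
Qed.

Lemma ibp_b F dF bF a b k : tame F dF bF -> (a + b + 2 <= k.*2)%N ->
  mom bF a b k = - b%:R * mom F a b.-1 k + k%:R * mom F a.+1 b k.+1.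
Proof.
move=> [wF cF cdF cbF] abk.
have abk1 : (a + b + 1 <= k.*2)%N by lia.
have [dr di] := decay_mono cF abk1.
have pd1 := cPI_wder cdF abk1; have pb1 := cPI_wder cbF abk1.
have pd2 := cPI_dmono cF abk; have pb2 := cPI_bmono cF abk.
have [_ h] := cD_wirt (wirtM wF (wirt_mono a b k)) dr di (cPID pd1 pd2) (cPID pb1 pb2).
move: h; rewrite cDD// -/(mom bF a b k) => /eqP; rewrite addr_eq0 => /eqP ->.
have h1 : cPI (fun p => b%:R * (F p * mono a b.-1 k p)).
  case: b abk {abk1 dr di pd1 pb1 pd2 pb2} => [|b] abk; last by apply: cPIZ; apply: cPI_mono => //=; lia.
  under eq_fun do rewrite mul0r; by split; exact: PI0.
have p2 : cPI (fun p => F p * mono a.+1 b k.+1 p) by apply: cPI_mono => //=; lia.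
have -> : cD (fun p => F p * bmono a b k p) =
   cD (fun p => b%:R * (F p * mono a b.-1 k p) + (- k%:R) * (F p * mono a.+1 b k.+1 p)).
  by congr cD; apply/funext => p; rewrite /bmono; ring.
rewrite cDD//; last exact: cPIZ.
rewrite (cDZ _ p2).
have -> : cD (fun p => b%:R * (F p * mono a b.-1 k p)) = b%:R * mom F a b.-1 k.
  case: b abk {abk1 dr di pd1 pb1 pd2 pb2 h1 p2} => [|b] abk; last by rewrite cDZ//; apply: cPI_mono => //=; lia.
  under eq_fun do rewrite mul0r; rewrite mul0r.
  by apply: complexE2; exact: Dplane0.
by rewrite -/(mom F a.+1 b k.+1); ring.
Qed.

Lemma mom_split F a b k : cB F -> (a + b + 3 <= k.*2)%N -> mom F a b k = mom F a b k.+1 + mom F a.+1 b.+1 k.+1.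
Proof.
move=> cF abk; rewrite /mom -cDD; [|by apply: cPI_mono => //; lia..].
by congr cD; apply/funext => p; rewrite mono_split mulrDr.
Qed.

(* \int F z^i zbar^j (1 + |z|^2)^-N mu *)
Definition Mo N F i j : C := (pi^-1)%:C * mom F i j N.+2.

Arguments Mo : simpl never.

(* The complexified rotation fields; |grad F|^2 is
   |Zzero|^2 + (|Zplus|^2 + |Zminus|^2) / 2 for the round metric. *)
Definition Zzero dF bF p : C := toC p * dF p - (toC p)^J * bF p.
Definition Zplus dF bF p : C := toC p ^+ 2 * dF p + bF p.
Definition Zminus dF bF p : C := dF p + (toC p)^J ^+ 2 * bF p.

(** * The action of sl_2 on moments *)

Section Killing.
Variables (N i j : nat) (F dF bF : R * R -> C).
Hypotheses (tF : tame F dF bF) (iN : (i <= N)%N) (jN : (j <= N)%N).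

(** After the two integrations by parts the terms with w^-(N + 3) cancel, because |z|^2 is invariant
    under the rotation about the axis. *)
Lemma Mo_Z0 : Mo N (Zzero dF bF) i j = (j%:R - i%:R) * Mo N F i j.
Proof.
have [_ _ cd cb] := tF.
have -> : Mo N (Zzero dF bF) i j = (pi^-1)%:C * (mom dF i.+1 j N.+2 - mom bF i j.+1 N.+2).
  rewrite /Mo; congr (_ * _); rewrite -mulN1r /mom -cDZ; last by apply: cPI_wder => //; lia.
  rewrite -cDD; last 2 first.
  - by apply: cPI_wder => //; lia.
  - by apply: cPIZ; apply: cPI_wder => //; lia.
  by congr cD; apply/funext => p; rewrite /Zzero /mono !exprS; ring.
rewrite (ibp_d tF); last by lia.
rewrite (ibp_b tF); last by lia.
by rewrite /Mo /= -!(natr1 i) -!(natr1 j); ring.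
Qed.

(** The two terms with w^-(N + 3) recombine through [mom_split]. At i = N the moment of index i + 1
    lies outside the array, and its coefficient N - i vanishes: the formulas close up on (N + 1) x
    (N + 1) arrays. *)
Lemma Mo_Zp : Mo N (Zplus dF bF) i j = (N%:R - i%:R) * Mo N F i.+1 j - j%:R * Mo N F i j.-1.
Proof.
have [_ cF cd cb] := tF.
have -> : Mo N (Zplus dF bF) i j = (pi^-1)%:C * (mom dF i.+2 j N.+2 + mom bF i j N.+2).
  rewrite /Mo; congr (_ * _); rewrite /mom -cDD; [|by apply: cPI_wder => //; lia..].
  by congr cD; apply/funext => p; rewrite /Zplus /mono !exprS; ring.
rewrite (ibp_d tF); last by lia.
rewrite (ibp_b tF); last by lia.
rewrite /Mo /= (mom_split (a := i.+1) (k := N.+2) cF); last by lia.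
by rewrite -!(natr1 i.+1) -!(natr1 i) -!(natr1 N.+1) -!(natr1 N); ring.
Qed.

Lemma Mo_Zm : Mo N (Zminus dF bF) i j = (N%:R - j%:R) * Mo N F i j.+1 - i%:R * Mo N F i.-1 j.
Proof.
have [_ cF cd cb] := tF.
have -> : Mo N (Zminus dF bF) i j = (pi^-1)%:C * (mom dF i j N.+2 + mom bF i j.+2 N.+2).
  rewrite /Mo; congr (_ * _); rewrite /mom -cDD; [|by apply: cPI_wder => //; lia..].
  by congr cD; apply/funext => p; rewrite /Zminus /mono !exprS; ring.
rewrite (ibp_d tF); last by lia.
rewrite (ibp_b tF); last by lia.
rewrite /Mo /= (mom_split (b := j.+1) (k := N.+2) cF); last by lia.
by rewrite -!(natr1 j.+1) -!(natr1 j) -!(natr1 N.+1) -!(natr1 N); ring.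
Qed.
End Killing.

Lemma Mo_contract N F i j : cB F -> (i <= N)%N -> (j <= N)%N ->
  Mo N F i j = Mo N.+1 F i j + Mo N.+1 F i.+1 j.+1.
Proof. by move=> cF iN jN; rewrite /Mo mom_split//; [rewrite mulrDr|lia]. Qed.

Lemma tame1 : tame (fun=> 1) (fun=> 0) (fun=> 0).
Proof.
split; first exact: wirt_cst.
- exact: cB_cst.
- by under eq_fun do rewrite mulr0; exact: cB_cst.
- by under eq_fun do rewrite mulr0; exact: cB_cst.
Qed.

Lemma Mo0 N i j : Mo N (fun=> 0) i j = 0.
Proof.
rewrite /Mo /mom; under eq_fun do rewrite mul0r.
by apply/eqP; rewrite mulf_eq0; apply/orP; right; apply/eqP/complexE2; exact: Dplane0.
Qed.

(** The constant 1 is killed by [Zzero], so j - i times its moment is zero. Applied to [Zplus], the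
    same remark yields the recursion [Mo1_next]. *)
Lemma Mo1_neq N i j : (i <= N)%N -> (j <= N)%N -> i != j -> Mo N (fun=> 1) i j = 0.
Proof.
move=> iN jN ij; have := Mo_Z0 tame1 iN jN.
have -> : Zzero (fun=> 0) (fun=> 0) = fun=> 0 by apply/funext => p; rewrite /Zzero !mulr0 subrr.
rewrite Mo0 => /esym/eqP; rewrite mulf_eq0 subr_eq0 eqr_nat eq_sym (negbTE ij) /=.
by move/eqP.
Qed.

Lemma Mo1_next N i : (i < N)%N -> (N%:R - i%:R) * Mo N (fun=> 1) i.+1 i.+1 = i.+1%:R * Mo N (fun=> 1) i i.
Proof.
move=> iN; have := Mo_Zp tame1 (ltnW iN) iN.
have -> : Zplus (fun=> 0) (fun=> 0) = fun=> 0 by apply/funext => p; rewrite /Zplus !mulr0 addr0.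
by rewrite Mo0 => /esym/eqP; rewrite subr_eq0 => /eqP.
Qed.

Lemma Dplane_inv_weight2 : Dplane (fun p => (weight p ^+ 2)^-1) = pi :> R.
Proof. by rewrite /Dplane /Rintegral integral_inv_weight2. Qed.

(** The orthonormality of the basis [alpha], obtained without computing a Beta integral:
    [Mo_contract] relates levels N and N + 1, and [Mo1_next] expresses both terms on the right by
    one of them. *)
Lemma Mo1_eq N i : (i <= N)%N -> (N.+1%:R * 'C(N, i)%:R) * Mo N (fun=> 1) i i = 1.
Proof.
elim: N i => [|N IH] i.
  rewrite leqn0 => /eqP ->; rewrite bin0 !mul1r /Mo /mom.
  have -> : (fun p => 1 * mono 0 0 2 p) = fun p => ((weight p ^+ 2)^-1)%:C.
    by apply/funext => p; rewrite /mono !expr0 !mul1r exprVn.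
  apply: complexE2; rewrite ?cReM ?cImM /= Dplane_inv_weight2 Dplane0.
    by rewrite mul0r subr0 mulVf// gt_eqF// pi_gt0.
  by rewrite mulr0 mul0r addr0.
have main k : (k <= N)%N -> (N.+2%:R * 'C(N.+1, k)%:R) * Mo N.+1 (fun=> 1) k k = 1.
  move=> kN; have := IH k kN; rewrite (Mo_contract (cB_cst 1) kN kN).
  have := @Mo1_next N.+1 k; rewrite ltnS => /(_ kN).
  set a := Mo _ _ k k; set b := Mo _ _ k.+1 k.+1 => ab h.
  have hb : (N.+1%:R * 'C(N, k)%:R : C) = (N.+1%:R - k%:R) * 'C(N.+1, k)%:R.
    rewrite -natrB ?leqW// -!natrM; congr (_%:R); exact: mul_bin_down.
  apply: etrans h; rewrite hb.
  have -> : (N.+1%:R - k%:R) * 'C(N.+1, k)%:R * (a + b) = 'C(N.+1, k)%:R * ((N.+1%:R - k%:R) * a + (N.+1%:R - k%:R) * b) by ring.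
  by rewrite ab -(natr1 N.+1) -(natr1 k); ring.
(* The top index i = N + 1 has no counterpart at level N; it is reached from i = N by [Mo1_next]. *)
rewrite leq_eqVlt => /predU1P[->|]; last by rewrite ltnS; exact: main.
have := main N (leqnn N); have := Mo1_next (ltnSn N).
rewrite -(natr1 N) addrAC subrr add0r mul1r natr1 => ->.
by rewrite binn binSn mulr1 mulrA.
Qed.

Lemma cD_R (f : R * R -> R) : cD (fun p => (f p)%:C) = (Dplane f)%:C.
Proof. by apply: complexE2 => //=; exact: Dplane0. Qed.

Definition qC N (c : nat -> nat -> C) : R :=
  \sum_(i < N.+1) \sum_(j < N.+1) ('C(N, i)%:R * 'C(N, j)%:R) * nrm2 (c i j).

Lemma sumr_mono N p : \sum_(i < N.+1) 'C(N, i)%:R * mono i i N.+2 p = ((weight p)^-1 ^+ 2)%:C.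
Proof.
have -> : \sum_(i < N.+1) 'C(N, i)%:R * mono i i N.+2 p = (1 + toC p * (toC p)^J ) ^+ N * ((weight p)^-1 ^+ N.+2)%:C.
  rewrite exprDn mulr_suml; apply: eq_bigr => i _.
  by rewrite expr1n mul1r /mono exprMn -mulr_natl; ring.
rewrite toCJ -(rcD 1) addrC subrK -rcX -rcM -addn2 exprD mulrA -exprMn divff ?weight_neq0//.
by rewrite expr1n mul1r.
Qed.

Lemma nrm2RE z : ((nrm2 z)%:C : C) = z * z^J. Proof. by rewrite mulcJ. Qed.

(** Here x is a raw moment, A is 1 / pi, b is (N + 1) times a binomial coefficient and I1 is the raw
    moment of 1. With the optimal coefficient b A x, the two cross terms and the square collapse to
    a single negative square. *)
Lemma bessel_alg (A b x I1 : C) : A^J = A -> b^J = b -> b * (A * I1) = 1 ->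
  A * (- (b * (A * x))^J * x) + (A * (- (b * (A * x)) * x^J) + A * ((b * (A * x)) * (b * (A * x))^J * I1))
  = - (b * (A * x * (A * x)^J)).
Proof.
move=> AJ bJ bE; rewrite !cJM AJ bJ.
transitivity (- (b * (A * x * (A * x^J))) * 2 + b * (A * x) * (A * x^J) * (b * (A * I1))); first by ring.
by rewrite bE; ring.
Qed.

(** Bessel's inequality for F z^i against the monomials of degree at most N, which are orthogonal
    for w^-N mu: [c] holds the coefficients of the projection and [G] is the residual, whose squared
    norm is nonnegative. *)
Lemma bessel_row N F i : cB F -> (i <= N)%N ->
  \sum_(j < N.+1) (N.+1%:R * 'C(N, j)%:R) * nrm2 (Mo N F i j) <=
  Re ((pi^-1)%:C * mom (fun p => F p * (F p)^J ) i i N.+2).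
Proof.
move=> cF iN.
pose c (j : 'I_N.+1) : C := (N.+1%:R * 'C(N, j)%:R) * Mo N F i j.
pose G p : C := F p * toC p ^+ i - \sum_j c j * toC p ^+ j.
have cFJ := cBJ cF.
have p1 : cPI (fun p => F p * (F p)^J * mono i i N.+2 p) by apply: cPI_mono; [exact: cBM|lia].
have p2 (j : 'I_N.+1) : cPI (fun p => - (c j)^J * (F p * mono i j N.+2 p)).
  by apply: cPIZ; apply: cPI_mono => //; have := ltn_ord j; lia.
have p3 (j : 'I_N.+1) : cPI (fun p => - c j * ((F p)^J * mono j i N.+2 p)).
  by apply: cPIZ; apply: cPI_mono => //; have := ltn_ord j; lia.
have p4 (j k : 'I_N.+1) : cPI (fun p => (c j * (c k)^J ) * (1 * mono j k N.+2 p)).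
  apply: cPIZ; apply: (cPI_mono (F := fun=> 1)); first exact: cB_cst.
  by have := ltn_ord j; have := ltn_ord k; lia.
have q2 := cPI_sum (index_enum _) p2.
have q3 := cPI_sum (index_enum _) p3.
have q4' j := cPI_sum (index_enum _) (p4 j).
have q4 := cPI_sum (index_enum _) q4'.
have key : cD (fun p => (nrm2 (G p) * (weight p)^-1 ^+ N.+2)%:C) =
   mom (fun p => F p * (F p)^J ) i i N.+2 + \sum_j (- (c j)^J * mom F i j N.+2)
   + \sum_j (- c j * (mom F i j N.+2)^J ) + \sum_j \sum_k (c j * (c k)^J ) * mom (fun=> 1) j k N.+2.
  have -> : (fun p => (nrm2 (G p) * (weight p)^-1 ^+ N.+2)%:C) = (fun p =>
     F p * (F p)^J * mono i i N.+2 p + \sum_j (- (c j)^J * (F p * mono i j N.+2 p))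
     + \sum_j (- c j * ((F p)^J * mono j i N.+2 p)) + \sum_j \sum_k (c j * (c k)^J ) * (1 * mono j k N.+2 p)).
    apply/funext => p; rewrite rcM nrm2RE /G cJD cJN cJM cJX cJ_sum mulrDl !mulrDr.
    set W := (_ ^+ N.+2)%:C.
    pose s := \sum_j c j * toC p ^+ j; pose s' := \sum_j (c j * toC p ^+ j)^J.
    rewrite -/s -/s'.
    have e1 : \sum_j (- (c j)^J * (F p * mono i j N.+2 p)) = - (F p * toC p ^+ i * s' * W).
      rewrite /s' mulr_sumr mulr_suml -sumrN; apply: eq_bigr => j _.
      by rewrite cJM cJX /mono -/W; ring.
    have e2 : \sum_j (- c j * ((F p)^J * mono j i N.+2 p)) = - (s * ((F p)^J * (toC p)^J ^+ i) * W).
      rewrite /s !mulr_suml -sumrN; apply: eq_bigr => j _.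
      by rewrite /mono -/W; ring.
    have e3 : \sum_j \sum_k (c j * (c k)^J ) * (1 * mono j k N.+2 p) = s * s' * W.
      rewrite /s /s' !mulr_suml; apply: eq_bigr => j _.
      rewrite mulr_sumr mulr_suml; apply: eq_bigr => k _.
      by rewrite cJM cJX /mono -/W; ring.
    by rewrite e1 e2 e3 /mono -/W; ring.
  rewrite (cDD (cPID (cPID p1 q2) q3) q4) (cDD (cPID p1 q2) q3) (cDD p1 q2) (cD_sum _ p2) (cD_sum _ p3) (cD_sum _ q4').
  congr (_ + _ + _ + _).
  - apply: eq_bigr => j _; rewrite cDZ//; apply: cPI_mono => //; have := ltn_ord j; lia.
  - apply: eq_bigr => j _; rewrite cDZ; last by apply: cPI_mono => //; have := ltn_ord j; lia.
    congr (_ * _); rewrite /mom -cDJ; last by apply: cPI_mono => //; have := ltn_ord j; lia.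
    congr cD; apply/funext => p; rewrite /mono !cJM !cJX cJK cJR; ring.
  - apply: eq_bigr => j _; rewrite (cD_sum _ (p4 j)); apply: eq_bigr => k _.
    rewrite cDZ//; apply: (cPI_mono (F := fun=> 1)); first exact: cB_cst.
    by have := ltn_ord j; have := ltn_ord k; lia.
have pos : 0 <= Re ((pi^-1)%:C * cD (fun p => (nrm2 (G p) * (weight p)^-1 ^+ N.+2)%:C)).
  rewrite cD_R -rcM /= mulr_ge0//; first by rewrite invr_ge0 pi_ge0.
  by apply: Dplane_ge0 => p; rewrite mulr_ge0 ?nrm2_ge0// exprn_ge0// winv_ge0.
have tot : (pi^-1)%:C * cD (fun p => (nrm2 (G p) * (weight p)^-1 ^+ N.+2)%:C) =
   (pi^-1)%:C * mom (fun p => F p * (F p)^J ) i i N.+2 - (\sum_(j < N.+1) (N.+1%:R * 'C(N, j)%:R) * nrm2 (Mo N F i j))%:C.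
  rewrite key /c /Mo; move: (mom F) => IF.
  rewrite !mulrDr -!addrA; congr (_ + _); rewrite rmorph_sum !mulr_sumr -!big_split -sumrN.
  apply: eq_bigr => j _ /=.
  have jN : (j <= N)%N by have := ltn_ord j.
  rewrite mulr_sumr (bigD1 j)// big1; last first.
    move=> k kj; have kN : (k <= N)%N by have := ltn_ord k.
    move: (@Mo1_neq N j k jN kN); rewrite eq_sym => /(_ kj) h0.
    by rewrite mulrCA -/(Mo N (fun=> 1) j k) h0 mulr0.
  rewrite /= addr0 !rcM !rcn nrm2RE; apply: bessel_alg; first exact: cJR.
    by rewrite cJM !cJn.
  exact: Mo1_eq.
move: pos; rewrite tot cReD cReN /= subr_ge0; exact.
Qed.

Lemma int_muE (f : R * R -> R) : PI (fun p => f p * (weight p)^-1 ^+ 2) ->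
  int_mu f = pi^-1 * Dplane (fun p => f p * (weight p)^-1 ^+ 2).
Proof.
move=> pf; rewrite /int_mu -DplaneZ//; congr Dplane; apply/funext => p.
by rewrite invfM exprVn mulrCA.
Qed.

Lemma PI_winv2 : PI (fun p : R * R => (weight p)^-1 ^+ 2).
Proof.
split; first by apply: contX; apply: contV; [exact: weight_neq0|exact: cont_weight].
exists 1 => p; rewrite mul1r /kap ger0_norm ?exprn_ge0 ?winv_ge0// expr2 invfM.
rewrite ler_wpM2l ?winv_ge0// lef_pV2 ?posrE ?weight_gt0 ?(lt_le_trans ltr01 (sqrt_weight_ge1 p))//.
have w0 := ltW (weight_gt0 p).
rewrite -[leRHS](sqr_sqrtr w0) expr2 -[leLHS]mul1r ler_wpM2r ?sqrtr_ge0//.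
exact: sqrt_weight_ge1.
Qed.

Lemma PI_bounded (f : R * R -> R) B : continuous f -> (forall p, `|f p| <= B) ->
  PI (fun p => f p * (weight p)^-1 ^+ 2).
Proof. by move=> cf fB; under eq_fun do rewrite mulrC; exact: (PIM PI_winv2 cf fB). Qed.

Lemma cB_nrm2 F : cB F -> PI (fun p => nrm2 (F p) * (weight p)^-1 ^+ 2).
Proof.
move=> [cF [B FB]]; apply: (@PI_bounded _ B); first exact: cont_nrm2.
by move=> p; rewrite ger0_norm ?nrm2_ge0.
Qed.

(** By the binomial theorem the weights add up to w^N. The mean of F thus becomes a trace of its
    array, which is how a zero mean enters [qf_gap]. *)
Lemma sum_Mo_diag N F : cB F ->
  \sum_(i < N.+1) 'C(N, i)%:R * Mo N F i i = Mo 0 F 0 0.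
Proof.
move=> cF; have hp (i : 'I_N.+1) : cPI (fun p => 'C(N, i)%:R * (F p * mono i i N.+2 p)).
  by apply: cPIZ; apply: cPI_mono => //; have := ltn_ord i; lia.
have -> : Mo 0 F 0 0 = (pi^-1)%:C * cD (fun p => \sum_(i < N.+1) 'C(N, i)%:R * (F p * mono i i N.+2 p)).
  rewrite /Mo /mom; congr (_ * cD _); apply/funext => p.
  rewrite {1}/mono !expr0 !mul1r -(sumr_mono N p) mulr_sumr; apply: eq_bigr => i _; ring.
rewrite (cD_sum _ hp) mulr_sumr; apply: eq_bigr => i _.
rewrite cDZ; last by apply: cPI_mono => //; have := ltn_ord i; lia.
by rewrite /Mo /mom; ring.
Qed.

(** The rows are added with weights C(N, i); on the right the factors |z|^(2i) then add up to w^N by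
    [sum_Mo_diag], leaving the plain L^2 norm. *)
Lemma bessel N F : cB F -> N.+1%:R * qC N (Mo N F) <= int_mu (fun p => nrm2 (F p)).
Proof.
move=> cF.
have -> : int_mu (fun p => nrm2 (F p)) = \sum_(i < N.+1) 'C(N, i)%:R * Re ((pi^-1)%:C * mom (fun p => F p * (F p)^J) i i N.+2).
  have cFF := cBM cF (cBJ cF).
  have -> : \sum_(i < N.+1) 'C(N, i)%:R * Re ((pi^-1)%:C * mom (fun p => F p * (F p)^J) i i N.+2) =
    Re (\sum_(i < N.+1) 'C(N, i)%:R * Mo N (fun p => F p * (F p)^J) i i).
    elim/big_rec2: _ => // i x y _ ->; rewrite cReD; congr (_ + _).
    have -> : ('C(N, i)%:R : C) = ('C(N, i)%:R : R)%:C by rewrite rcn.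
    by rewrite [RHS]cReM [Im _%:C](_ : _ = 0)// mul0r subr0.
  rewrite sum_Mo_diag// /Mo /mom.
  have -> : (fun p => F p * (F p)^J * mono 0 0 2 p) = fun p => (nrm2 (F p) * (weight p)^-1 ^+ 2)%:C.
    by apply/funext => p; rewrite /mono !expr0 !mul1r mulcJ rcM.
  by rewrite cD_R -rcM /= int_muE//; exact: cB_nrm2.
rewrite /qC mulr_sumr; apply: ler_sum => i _.
have iN : (i <= N)%N by have := ltn_ord i.
apply: le_trans (ler_wpM2l (ler0n _ _) (bessel_row cF iN)).
rewrite !mulr_sumr; apply: ler_sum => j _; rewrite le_eqVlt; apply/orP; left; apply/eqP; ring.
Qed.
End CPlane.

(** * The Casimir identity on arrays of moments *)

Section Arrays.
Context {R : rcfType}.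
Implicit Types (c : nat -> nat -> R) (N i j m : nat).

Definition qf N c : R := \sum_(i < N.+1) \sum_(j < N.+1) ('C(N, i)%:R * 'C(N, j)%:R) * c i j ^+ 2.
(** [ar0], [arp] and [arm] are the right sides of [Mo_Z0], [Mo_Zp] and [Mo_Zm], and [arcon] is that
    of [Mo_contract]. Their coefficients are real, so real and imaginary parts of moments can be
    treated separately. *)
Definition ar0 c i j : R := (j%:R - i%:R) * c i j.
Definition arp N c i j : R := (N%:R - i%:R) * c i.+1 j - j%:R * c i j.-1.
Definition arm N c i j : R := (N%:R - j%:R) * c i j.+1 - i%:R * c i.-1 j.
Definition arcon c i j : R := c i j + c i.+1 j.+1.

Lemma bin_up m i : (m.+1%:R - i%:R) * 'C(m.+1, i)%:R = m.+1%:R * 'C(m, i)%:R :> R.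
Proof.
have [im|im] := leqP i m.+1; last first.
  by rewrite !bin_small ?mulr0//; lia.
by rewrite -natrB// -!natrM; congr (_%:R); rewrite -mul_bin_down.
Qed.

Lemma bin_diag m i : i.+1%:R * 'C(m.+1, i.+1)%:R = m.+1%:R * 'C(m, i)%:R :> R.
Proof. by rewrite -!natrM; congr (_%:R); rewrite -mul_bin_diag. Qed.

Lemma sum_up m (h : nat -> R) : \sum_(i < m.+2) 'C(m.+1, i)%:R * ((m.+1%:R - i%:R) * h i) =
  m.+1%:R * \sum_(i < m.+1) 'C(m, i)%:R * h i.
Proof.
rewrite big_ord_recr /= subrr mul0r mulr0 addr0 mulr_sumr; apply: eq_bigr => i _.
by rewrite mulrA [_ * (_ - _)]mulrC bin_up mulrA.
Qed.

Lemma sum_down m (h : nat -> R) : \sum_(i < m.+2) 'C(m.+1, i)%:R * (i%:R * h i) =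
  m.+1%:R * \sum_(i < m.+1) 'C(m, i)%:R * h i.+1.
Proof.
rewrite big_ord_recl /= mul0r mulr0 add0r mulr_sumr; apply: eq_bigr => i _.
by rewrite mulrA [_ * _%:R]mulrC bin_diag mulrA.
Qed.

(** One factor N - i lowers the binomial weight to level m, and reading [sum_down] backwards raises
    it again with the index shifted; the shift of h is traded for a polynomial coefficient. *)
Lemma sum_up2 m (h : nat -> R) : \sum_(i < m.+2) 'C(m.+1, i)%:R * ((m.+1%:R - i%:R) ^+ 2 * h i.+1) =
  \sum_(i < m.+2) 'C(m.+1, i)%:R * (i%:R * (m.+1%:R - i%:R + 1) * h i).
Proof.
transitivity (\sum_(i < m.+2) 'C(m.+1, i)%:R * ((m.+1%:R - i%:R) * ((m.+1%:R - i%:R) * h i.+1))).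
  by apply: eq_bigr => i _; ring.
rewrite (sum_up m (fun i => (m.+1%:R - i%:R) * h i.+1)).
transitivity (\sum_(i < m.+2) 'C(m.+1, i)%:R * (i%:R * ((m.+1%:R - i%:R + 1) * h i))); last first.
  by apply: eq_bigr => i _; ring.
rewrite (sum_down m (fun i => (m.+1%:R - i%:R + 1) * h i)); congr (_ * _); apply: eq_bigr => i _.
by rewrite -[i.+1%:R]natr1; ring.
Qed.

Lemma sum_down2 m (h : nat -> R) : \sum_(i < m.+2) 'C(m.+1, i)%:R * (i%:R ^+ 2 * h i.-1) =
  \sum_(i < m.+2) 'C(m.+1, i)%:R * ((i%:R + 1) * (m.+1%:R - i%:R) * h i).
Proof.
transitivity (\sum_(i < m.+2) 'C(m.+1, i)%:R * (i%:R * (i%:R * h i.-1))).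
  by apply: eq_bigr => i _; ring.
rewrite (sum_down m (fun i => i%:R * h i.-1)).
transitivity (\sum_(i < m.+2) 'C(m.+1, i)%:R * ((m.+1%:R - i%:R) * ((i%:R + 1) * h i))); last first.
  by apply: eq_bigr => i _; ring.
rewrite (sum_up m (fun i => (i%:R + 1) * h i)); congr (_ * _); apply: eq_bigr => i _.
by rewrite -[i.+1%:R]natr1 /=; ring.
Qed.

Let S N (F : nat -> nat -> R) : R := \sum_(i < N.+1) 'C(N, i)%:R * \sum_(j < N.+1) 'C(N, j)%:R * F i j.

Let S_eq N F G : (forall i j, F i j = G i j) -> S N F = S N G.
Proof. by move=> FG; apply: eq_bigr => i _; congr (_ * _); apply: eq_bigr => j _; rewrite FG. Qed.

Let SD N F G : S N (fun i j => F i j + G i j) = S N F + S N G.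
Proof.
rewrite /S -big_split; apply: eq_bigr => i _ /=; rewrite -mulrDr -big_split; congr (_ * _).
by apply: eq_bigr => j _ /=; rewrite mulrDr.
Qed.

Let SZ N F a : S N (fun i j => a * F i j) = a * S N F.
Proof.
rewrite /S mulr_sumr; apply: eq_bigr => i _ /=; rewrite mulrCA; congr (_ * _); rewrite mulr_sumr.
by apply: eq_bigr => j _ /=; rewrite mulrCA.
Qed.

Let S_swap N F : S N F = S N (fun i j => F j i).
Proof.
rewrite /S; under eq_bigr do rewrite mulr_sumr.
rewrite exchange_big; apply: eq_bigr => i _; rewrite mulr_sumr.
by apply: eq_bigr => j _; ring.
Qed.

Lemma qfE N c : qf N c = S N (fun i j => c i j ^+ 2).
Proof. by apply: eq_bigr => i _; rewrite mulr_sumr; apply: eq_bigr => j _; rewrite mulrA. Qed.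

Let S1 N (F G : nat -> nat -> R) : (forall j, \sum_(i < N.+1) 'C(N, i)%:R * F i j = \sum_(i < N.+1) 'C(N, i)%:R * G i j) ->
  S N F = S N G.
Proof. by move=> FG; rewrite S_swap [RHS]S_swap; apply: eq_bigr => i _; rewrite FG. Qed.

Let S2 N (F G : nat -> nat -> R) : (forall i, \sum_(j < N.+1) 'C(N, j)%:R * F i j = \sum_(j < N.+1) 'C(N, j)%:R * G i j) ->
  S N F = S N G.
Proof. by move=> FG; apply: eq_bigr => i _; rewrite FG. Qed.

Let S_cross m (h : nat -> nat -> R) :
  S m.+1 (fun i j => (m.+1%:R - i%:R) * (j%:R * h i j)) = m.+1%:R ^+ 2 * S m (fun i j => h i j.+1).
Proof.
rewrite /S.
under eq_bigr => i _.
  rewrite (eq_bigr (fun j : 'I_m.+2 => (m.+1%:R - i%:R) * ('C(m.+1, j)%:R * (j%:R * h i j)))); last first.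
    by move=> j _; ring.
  rewrite -mulr_sumr (sum_down m (h i)); over.
rewrite (sum_up m (fun i => m.+1%:R * \sum_(j < m.+1) 'C(m, j)%:R * h i j.+1)).
rewrite expr2 -mulrA; congr (_ * _); rewrite mulr_sumr; apply: eq_bigr => i _; ring.
Qed.

Let S_up m (h : nat -> nat -> R) :
  S m.+1 (fun i j => (m.+1%:R - i%:R) * ((m.+1%:R - j%:R) * h i j)) = m.+1%:R ^+ 2 * S m h.
Proof.
rewrite /S.
under eq_bigr => i _.
  rewrite (eq_bigr (fun j : 'I_m.+2 => (m.+1%:R - i%:R) * ('C(m.+1, j)%:R * ((m.+1%:R - j%:R) * h i j)))); last first.
    by move=> j _; ring.
  rewrite -mulr_sumr (sum_up m (h i)); over.
rewrite (sum_up m (fun i => m.+1%:R * \sum_(j < m.+1) 'C(m, j)%:R * h i j)).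
rewrite expr2 -mulrA; congr (_ * _); rewrite mulr_sumr; apply: eq_bigr => i _; ring.
Qed.

Let S_down m (h : nat -> nat -> R) :
  S m.+1 (fun i j => i%:R * (j%:R * h i j)) = m.+1%:R ^+ 2 * S m (fun i j => h i.+1 j.+1).
Proof.
rewrite /S.
under eq_bigr => i _.
  rewrite (eq_bigr (fun j : 'I_m.+2 => i%:R * ('C(m.+1, j)%:R * (j%:R * h i j)))); last first.
    by move=> j _; ring.
  rewrite -mulr_sumr (sum_down m (h i)); over.
rewrite (sum_down m (fun i => m.+1%:R * \sum_(j < m.+1) 'C(m, j)%:R * h i j.+1)).
rewrite expr2 -mulrA; congr (_ * _); rewrite mulr_sumr; apply: eq_bigr => i _; ring.
Qed.

(** In the expanded square the two pure terms are shifted back to c i j at the same level, while the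
    cross term drops to level m, where it will meet the cross term of [arcon]. *)
Let qf_arp m c : qf m.+1 (arp m.+1 c) =
  S m.+1 (fun i j => i%:R * (m.+1%:R - i%:R + 1) * c i j ^+ 2)
  + S m.+1 (fun i j => (j%:R + 1) * (m.+1%:R - j%:R) * c i j ^+ 2)
  - 2 * (m.+1%:R ^+ 2 * S m (fun i j => c i.+1 j.+1 * c i j)).
Proof.
rewrite qfE.
transitivity (S m.+1 (fun i j => (m.+1%:R - i%:R) ^+ 2 * c i.+1 j ^+ 2 + j%:R ^+ 2 * c i j.-1 ^+ 2
   + -2 * ((m.+1%:R - i%:R) * (j%:R * (c i.+1 j * c i j.-1))))).
  by apply: S_eq => i j; rewrite /arp; ring.
rewrite !SD SZ S_cross /= mulNr; congr (_ + _ - _).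
  by apply: S1 => j; rewrite (sum_up2 m (fun i => c i j ^+ 2)).
by apply: S2 => i; rewrite (sum_down2 m (fun j => c i j ^+ 2)).
Qed.

Lemma qf_tr N c : qf N (fun i j => c j i) = qf N c.
Proof. by rewrite !qfE S_swap. Qed.

(** The cross terms of [arp], [arm] and [arcon] are all multiples of the same sum and cancel. What
    remains is diagonal in the c i j and reduces to an identity between polynomials in i, j and
    m. *)
Lemma qf_casimir m c :
  qf m.+1 (ar0 c) + 2^-1 * qf m.+1 (arp m.+1 c) + 2^-1 * qf m.+1 (arm m.+1 c) =
  m.+1%:R * m.+2%:R * qf m.+1 c - m.+1%:R ^+ 2 * qf m (arcon c).
Proof.
have -> : qf m.+1 (arm m.+1 c) = qf m.+1 (arp m.+1 (fun i j => c j i)) by rewrite -qf_tr.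
rewrite !qf_arp.
rewrite [S m.+1 (fun i j => _ * c j i ^+ 2)]S_swap [X in _ + X - 2 * (_ * S m (fun i j => c j.+1 i.+1 * _))]S_swap.
rewrite [S m (fun i j => c j.+1 i.+1 * _)]S_swap.
rewrite [qf m (arcon c)]qfE.
have -> : S m (fun i j => arcon c i j ^+ 2) = S m (fun i j => c i j ^+ 2) + 2 * S m (fun i j => c i.+1 j.+1 * c i j)
    + S m (fun i j => c i.+1 j.+1 ^+ 2).
  by rewrite -SZ -!SD; apply: S_eq => i j; rewrite /arcon; ring.
rewrite [m.+1%:R ^+ 2 * (_ + _ + _)]mulrDr [m.+1%:R ^+ 2 * (_ + _)]mulrDr -(S_up m (fun i j => c i j ^+ 2)) -(S_down m (fun i j => c i j ^+ 2)).
rewrite !qfE; set X := S m _.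
(* With M = m + 1, both coefficients of c i j ^+ 2 equal M + M (i + j) - 2 i j. *)
have key : S m.+1 (fun i j => ar0 c i j ^+ 2) +
  2^-1 * (S m.+1 (fun i j => i%:R * (m.+1%:R - i%:R + 1) * c i j ^+ 2)
  + S m.+1 (fun i j => (j%:R + 1) * (m.+1%:R - j%:R) * c i j ^+ 2)) +
  2^-1 * (S m.+1 (fun i j => j%:R * (m.+1%:R - j%:R + 1) * c i j ^+ 2)
  + S m.+1 (fun i j => (i%:R + 1) * (m.+1%:R - i%:R) * c i j ^+ 2)) =
  m.+1%:R * m.+2%:R * S m.+1 (fun i j => c i j ^+ 2)
  - (S m.+1 (fun i j => (m.+1%:R - i%:R) * ((m.+1%:R - j%:R) * c i j ^+ 2))
  + S m.+1 (fun i j => i%:R * (j%:R * c i j ^+ 2))).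
  rewrite -!SD -!SZ -mulN1r -SZ -!SD; apply: S_eq => i j; rewrite /ar0 -[m.+2%:R]natr1; by field.
move: key; lra.
Qed.

Let t N c i : R := 'C(N, i)%:R * c i i.

Let qf_ge0 N c : 0 <= qf N c.
Proof. by apply: sumr_ge0 => i _; apply: sumr_ge0 => j _; rewrite mulr_ge0 ?sqr_ge0. Qed.

Let qf_term N c i j : (i <= N)%N -> (j <= N)%N -> 'C(N, i)%:R * 'C(N, j)%:R * c i j ^+ 2 <= qf N c.
Proof.
move=> iN jN; rewrite /qf (bigD1 (inord i))//= (bigD1 (inord j))//= !inordK ?ltnS//.
rewrite -addrA lerDl addr_ge0//.
  by apply: sumr_ge0 => k _; rewrite mulr_ge0 ?sqr_ge0.
by apply: sumr_ge0 => k _; apply: sumr_ge0 => l _; rewrite mulr_ge0 ?sqr_ge0.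
Qed.

(** The entry (l, l + 1) of [arp N c] compares neighbouring diagonal entries. Writing the two
    binomials as q s and p s with p = N - l and q = l + 1, its weighted square is p q times the
    squared increment of [t], and p q >= 1. *)
Let step N c l : (l < N)%N -> `|t N c l.+1 - t N c l| <= Num.sqrt (qf N (arp N c)).
Proof.
case: N => // m lm.
rewrite -sqrtr_sqr ler_wsqrtr//; apply: le_trans (qf_term _ (ltnW lm) lm).
rewrite /t /arp /=.
set a : R := 'C(m.+1, l)%:R; set b : R := 'C(m.+1, l.+1)%:R.
set p : R := m.+1%:R - l%:R; set q : R := l.+1%:R.
have ab : p * a = q * b by rewrite /p /a bin_up -bin_diag.
have q1 : 1 <= q by rewrite /q ler1n.
have p1 : 1 <= p by rewrite /p -natrB ?(ltnW lm)// ler1n subn_gt0.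
have q0 : q != 0 by rewrite gt_eqF// (lt_le_trans ltr01).
pose s := a / q.
have -> : a = q * s by rewrite /s mulrC divfK.
have -> : b = p * s by rewrite /s mulrA ab mulrC mulKf.
set y := c l.+1 l.+1; set x := c l l.
have -> : q * s * (p * s) * (p * y - q * x) ^+ 2 = (p * q) * (p * s * y - q * s * x) ^+ 2 by ring.
by rewrite ler_peMl ?sqr_ge0//; apply: mulr_ege1.
Qed.

Let diff N c i k : (i + k <= N)%N -> `|t N c (i + k) - t N c i| <= k%:R * Num.sqrt (qf N (arp N c)).
Proof.
elim: k => [|k IH] ikN; first by rewrite addn0 subrr normr0 mul0r.
rewrite -natr1 mulrDl mul1r addnS.
have -> : t N c (i + k).+1 - t N c i = (t N c (i + k) - t N c i) + (t N c (i + k).+1 - t N c (i + k)) by ring.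
apply: le_trans (ler_normD _ _) (lerD _ _); first by apply: IH; lia.
by apply: step; lia.
Qed.

Let diff_le N c i j : (i <= N)%N -> (j <= N)%N -> `|t N c i - t N c j| <= N%:R * Num.sqrt (qf N (arp N c)).
Proof.
wlog ij : i j / (i <= j)%N.
  by move=> h iN jN; have [ij|/ltnW ij] := leqP i j; [exact: h|rewrite distrC; exact: h].
move=> iN jN; have := @diff N c i (j - i); rewrite subnKC// => /(_ jN).
rewrite distrC => /le_trans; apply; rewrite ler_wpM2r ?sqrtr_ge0// ler_nat; lia.
Qed.

(** Off the diagonal, [ar0] multiplies by j - i, of modulus at least 1. On the diagonal the entries
    [t] have sum zero, so each is bounded by the largest difference, hence by N increments
    controlled by [arp]. The factor 2 offsets the weight 1/2 of [arp]; the power 4 is not sharp. *)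
Lemma qf_gap N c : \sum_(i < N.+1) 'C(N, i)%:R * c i i = 0 ->
  qf N c <= 2 * N.+1%:R ^+ 4 *
    (qf N (ar0 c) + 2^-1 * qf N (arp N c) + 2^-1 * qf N (arm N c)).
Proof.
move=> tr0.
set e := Num.sqrt (qf N (arp N c)).
have e0 : 0 <= e by exact: sqrtr_ge0.
have eE : e ^+ 2 = qf N (arp N c) by rewrite sqr_sqrtr.
have N0 : 0 < N.+1%:R :> R by rewrite ltr0n.
have tE i : (i <= N)%N -> `|t N c i| <= N%:R * e.
  move=> iN; rewrite -(ler_pM2l N0).
  (* As the [t N c j] sum to zero, N + 1 copies of [t N c i] equal the sum of its differences with
     all of them. *)
  have -> : N.+1%:R * `|t N c i| = `|\sum_(j < N.+1) (t N c i - t N c j)|.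
    rewrite sumrB [X in _ - X](_ : _ = 0) // subr0 sumr_const card_ord.
    by rewrite normrMn mulr_natl.
  apply: le_trans (ler_norm_sum _ _ _) _.
  have -> : N.+1%:R * (N%:R * e) = \sum_(j < N.+1) (N%:R * e).
    by rewrite sumr_const card_ord -[RHS]mulr_natl.
  by apply: ler_sum => j _; apply: diff_le => //; have := ltn_ord j; lia.
have termE (i j : 'I_N.+1) : 'C(N, i)%:R * 'C(N, j)%:R * c i j ^+ 2 <=
   'C(N, i)%:R * 'C(N, j)%:R * ar0 c i j ^+ 2 + N%:R ^+ 2 * e ^+ 2.
  have [<-|ij] := eqVneq i j.
    rewrite /ar0 subrr mul0r expr0n mulr0 add0r.
    have iN : (i <= N)%N by have := ltn_ord i; lia.
    have -> : 'C(N, i)%:R * 'C(N, i)%:R * c i i ^+ 2 = `|t N c i| ^+ 2.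
      by rewrite real_normK ?num_real// /t; ring.
    by rewrite -exprMn lerXn2r ?nnegrE ?mulr_ge0//; exact: tE.
  apply: (@le_trans _ _ ('C(N, i)%:R * 'C(N, j)%:R * ar0 c i j ^+ 2)); last first.
    by rewrite lerDl mulr_ge0 ?sqr_ge0.
  rewrite ler_wpM2l ?mulr_ge0// /ar0 exprMn ler_peMl ?sqr_ge0//.
  rewrite -real_normK ?num_real// exprn_ege1//.
  have [ltij|ltji|eqij] := ltngtP i j.
  - by rewrite -natrB ?(ltnW ltij)// normr_nat ler1n subn_gt0.
  - by rewrite distrC -natrB ?(ltnW ltji)// normr_nat ler1n subn_gt0.
  - by move/eqP: ij; case; apply: val_inj.
have h1 : qf N c <= qf N (ar0 c) + N.+1%:R ^+ 2 * (N%:R ^+ 2 * e ^+ 2).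
  have -> : N.+1%:R ^+ 2 * (N%:R ^+ 2 * e ^+ 2) = \sum_(i < N.+1) \sum_(j < N.+1) N%:R ^+ 2 * e ^+ 2.
    rewrite !sumr_const card_ord -mulrnA; move: (N%:R ^+ 2 * e ^+ 2) => x.
    by rewrite -[x *+ _]mulr_natl natrM expr2.
  rewrite -big_split; apply: ler_sum => i _ /=; rewrite -big_split; apply: ler_sum => j _ /=.
  exact: termE.
apply: le_trans h1 _; rewrite eE.
have a0 := qf_ge0 N (ar0 c); have p0 := qf_ge0 N (arp N c); have m0 := qf_ge0 N (arm N c).
have k1 : 1 <= 2 * N.+1%:R ^+ 4 :> R.
  by rewrite (@le_trans _ _ (N.+1%:R ^+ 4))// ?expr_ge1 ?ler1n// ler_peMl ?exprn_ge0// ler1n.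
have k2 : N.+1%:R ^+ 2 * N%:R ^+ 2 <= N.+1%:R ^+ 4 :> R.
  have -> : N.+1%:R ^+ 4 = N.+1%:R ^+ 2 * N.+1%:R ^+ 2 :> R by ring.
  by rewrite ler_wpM2l ?exprn_ge0// lerXn2r ?nnegrE// ler_nat.
have k3 : N.+1%:R ^+ 2 * (N%:R ^+ 2 * qf N (arp N c)) <= N.+1%:R ^+ 4 * qf N (arp N c).
  by rewrite mulrA ler_wpM2r.
have k4 : qf N (ar0 c) <= 2 * N.+1%:R ^+ 4 * qf N (ar0 c) by rewrite ler_peMl.
have k5 : 0 <= 2 * N.+1%:R ^+ 4 * qf N (arm N c) by rewrite mulr_ge0// mulr_ge0// exprn_ge0.
move: k3 k4 k5; lra.
Qed.
End Arrays.

(** * Spectral gap *)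

Section Gap.
Context {R : realType}.
Local Open Scope complex_scope.
Local Notation "z ^J" := (conjc z) (at level 2, format "z ^J").
Local Notation C := R[i].
Notation Re := (@complex.Re R).
Notation Im := (@complex.Im R).
Implicit Types (F dF bF G : R * R -> C) (p q : R * R) (f g : R * R -> R).

Definition Qn N F : R := N.+1%:R * qC N (Mo N F).
Definition reA (c : nat -> nat -> C) i j : R := Re (c i j).
Definition imA (c : nat -> nat -> C) i j : R := Im (c i j).
Lemma qC_qf N (c : nat -> nat -> C) : qC N c = qf N (reA c) + qf N (imA c).
Proof.
rewrite /qC /qf -big_split; apply: eq_bigr => i _ /=; rewrite -big_split; apply: eq_bigr => j _ /=.
by rewrite /nrm2 mulrDr.
Qed.

Lemma qC_ge0 N (c : nat -> nat -> C) : 0 <= qC N c.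
Proof. by apply: sumr_ge0 => i _; apply: sumr_ge0 => j _; rewrite mulr_ge0 ?nrm2_ge0. Qed.

Lemma eq_qf N (c d : nat -> nat -> R) : (forall i j, (i <= N)%N -> (j <= N)%N -> c i j = d i j) -> qf N c = qf N d.
Proof. by move=> cd; apply: eq_bigr => i _; apply: eq_bigr => j _; rewrite cd//; [have := ltn_ord i|have := ltn_ord j]; lia. Qed.

Definition casR N (c : nat -> nat -> R) := qf N (ar0 c) + 2^-1 * qf N (arp N c) + 2^-1 * qf N (arm N c).
Definition casC N (c : nat -> nat -> C) := casR N (reA c) + casR N (imA c).

Lemma ReZB (i j : nat) (z : C) : Re ((i%:R - j%:R) * z) = (i%:R - j%:R) * Re z.
Proof. by rewrite -(rcn i) -(rcn j) cReM cReD cImD cReN cImN /= oppr0 addr0 mul0r subr0. Qed.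

Lemma ImZB (i j : nat) (z : C) : Im ((i%:R - j%:R) * z) = (i%:R - j%:R) * Im z.
Proof. by rewrite -(rcn i) -(rcn j) cImM cReD cImD cReN cImN /= oppr0 addr0 mul0r addr0. Qed.

Lemma ReZn (i : nat) (z : C) : Re (i%:R * z) = i%:R * Re z.
Proof. by have := ReZB i 0 z; rewrite !subr0. Qed.

Lemma ImZn (i : nat) (z : C) : Im (i%:R * z) = i%:R * Im z.
Proof. by have := ImZB i 0 z; rewrite !subr0. Qed.

Lemma Qn_step m F : cB F ->
  m.+2%:R * casC m.+1 (Mo m.+1 F) = (m.+1%:R * m.+2%:R) * (Qn m.+1 F - Qn m F).
Proof.
move=> cF; rewrite /Qn /casC /casR !qf_casimir !qC_qf.
have -> : qf m (reA (Mo m F)) = qf m (arcon (reA (Mo m.+1 F))).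
  by apply: eq_qf => i j iN jN; rewrite /reA Mo_contract// cReD.
have -> : qf m (imA (Mo m F)) = qf m (arcon (imA (Mo m.+1 F))).
  by apply: eq_qf => i j iN jN; rewrite /imA Mo_contract// cImD.
ring.
Qed.

Definition Sn N dF bF := Qn N (Zzero dF bF) + 2^-1 * Qn N (Zplus dF bF) + 2^-1 * Qn N (Zminus dF bF).

Lemma Sn_cas N F dF bF : tame F dF bF -> Sn N dF bF = N.+1%:R * casC N (Mo N F).
Proof.
move=> tF; rewrite /Sn /Qn /casC /casR !qC_qf.
have -> : qf N (reA (Mo N (Zzero dF bF))) = qf N (ar0 (reA (Mo N F))).
  by apply: eq_qf => i j iN jN; rewrite /reA (Mo_Z0 tF)// ReZB.
have -> : qf N (imA (Mo N (Zzero dF bF))) = qf N (ar0 (imA (Mo N F))).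
  by apply: eq_qf => i j iN jN; rewrite /imA (Mo_Z0 tF)// ImZB.
have -> : qf N (reA (Mo N (Zplus dF bF))) = qf N (arp N (reA (Mo N F))).
  by apply: eq_qf => i j iN jN; rewrite /reA (Mo_Zp tF)// cReD cReN ReZB ReZn.
have -> : qf N (imA (Mo N (Zplus dF bF))) = qf N (arp N (imA (Mo N F))).
  by apply: eq_qf => i j iN jN; rewrite /imA (Mo_Zp tF)// cImD cImN ImZB ImZn.
have -> : qf N (reA (Mo N (Zminus dF bF))) = qf N (arm N (reA (Mo N F))).
  by apply: eq_qf => i j iN jN; rewrite /reA (Mo_Zm tF)// cReD cReN ReZB ReZn.
have -> : qf N (imA (Mo N (Zminus dF bF))) = qf N (arm N (imA (Mo N F))).
  by apply: eq_qf => i j iN jN; rewrite /imA (Mo_Zm tF)// cImD cImN ImZB ImZn.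
ring.
Qed.

Definition gapK N : R := 2 * N.+1%:R ^+ 4.
Lemma gapK_gt0 N : 0 < gapK N.
Proof. by rewrite mulr_gt0// exprn_gt0// ltr0n. Qed.

Lemma casC_gap N F : cB F -> Mo 0 F 0 0 = 0 -> qC N (Mo N F) <= gapK N * casC N (Mo N F).
Proof.
move=> cF F0; have tr := sum_Mo_diag N cF; rewrite F0 in tr.
rewrite qC_qf /casC mulrDr; apply: lerD; apply: qf_gap.
  transitivity (Re (\sum_(i < N.+1) 'C(N, i)%:R * Mo N F i i)); last by rewrite tr.
  by elim/big_rec2: _ => // i x y _ ->; rewrite cReD ReZn.
transitivity (Im (\sum_(i < N.+1) 'C(N, i)%:R * Mo N F i i)); last by rewrite tr.
by elim/big_rec2: _ => // i x y _ ->; rewrite cImD ImZn.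
Qed.

Definition gape m : R := (gapK m.+1 * (m.+1%:R * m.+2%:R))^-1.
Lemma gape_gt0 m : 0 < gape m.
Proof. by rewrite invr_gt0 mulr_gt0 ?gapK_gt0// mulr_gt0// ltr0n. Qed.

(** The Casimir energy at level m + 1 is, up to a factor, the increment of Q_m. Its lower bound by
    Q_(m+1) therefore makes the increment at least [gape m] times Q_(m+1). *)
Lemma Qn_gap m F : cB F -> Mo 0 F 0 0 = 0 -> Qn m F <= (1 - gape m) * Qn m.+1 F.
Proof.
move=> cF F0; have h1 := casC_gap m.+1 cF F0; have h2 := Qn_step m cF.
have k0 := gapK_gt0 m.+1.
have m0 : 0 < m.+1%:R * m.+2%:R :> R by rewrite mulr_gt0// ltr0n.
rewrite mulrBl mul1r lerBrDl -lerBrDr /gape.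
rewrite mulrC ler_pdivrMr ?(mulr_gt0 k0 m0)//.
have -> : (Qn m.+1 F - Qn m F) * (gapK m.+1 * (m.+1%:R * m.+2%:R)) = gapK m.+1 * (m.+1%:R * m.+2%:R * (Qn m.+1 F - Qn m F)) by ring.
by rewrite -h2 {1}/Qn [leRHS]mulrCA ler_wpM2l.
Qed.

Lemma Qn_le N F : cB F -> Qn N F <= int_mu (fun p => nrm2 (F p)).
Proof. exact: bessel. Qed.

Lemma cB_Z0 F dF bF : tame F dF bF -> cB (Zzero dF bF).
Proof.
move=> [_ _ cd cb].
have h1 := cBM (cB_mono (a := 1) (b := 0) (k := 1) isT) cd.
have h2 := cBM (cB_cst (-1)) (cBM (cB_mono (a := 0) (b := 1) (k := 1) isT) cb).
have := cBD h1 h2; congr cB; apply/funext => p; rewrite /Zzero /mono !expr1 expr0.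
have : ((weight p)^-1)%:C * (weight p)%:C = 1 :> C by rewrite -rcM mulVf ?weight_neq0.
set u := _%:C; set v := _%:C => uv; ring: uv.
Qed.

Lemma cB_Zp F dF bF : tame F dF bF -> cB (Zplus dF bF).
Proof.
move=> [_ _ cd cb].
have h1 := cBM (cB_mono (a := 2) (b := 0) (k := 1) isT) cd.
have h2 := (cBM (cB_mono (a := 0) (b := 0) (k := 1) isT) cb).
have := cBD h1 h2; congr cB; apply/funext => p; rewrite /Zplus /mono !expr1 !expr0.
have : ((weight p)^-1)%:C * (weight p)%:C = 1 :> C by rewrite -rcM mulVf ?weight_neq0.
set u := _%:C; set v := _%:C => uv; ring: uv.
Qed.

Lemma cB_Zm F dF bF : tame F dF bF -> cB (Zminus dF bF).
Proof.
move=> [_ _ cd cb].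
have h1 := cBM (cB_mono (a := 0) (b := 0) (k := 1) isT) cd.
have h2 := (cBM (cB_mono (a := 0) (b := 2) (k := 1) isT) cb).
have := cBD h1 h2; congr cB; apply/funext => p; rewrite /Zminus /mono !expr1 !expr0.
have : ((weight p)^-1)%:C * (weight p)%:C = 1 :> C by rewrite -rcM mulVf ?weight_neq0.
set u := _%:C; set v := _%:C => uv; ring: uv.
Qed.

(** Rotations preserve mu, so derivatives along them have mean zero: at N = i = j = 0 the
    coefficients of the sl_2 formulas vanish. *)
Lemma Mo00_Z0 F dF bF : tame F dF bF -> Mo 0 (Zzero dF bF) 0 0 = 0.
Proof. by move=> tF; rewrite (Mo_Z0 tF)// subrr mul0r. Qed.

Lemma Mo00_Zp F dF bF : tame F dF bF -> Mo 0 (Zplus dF bF) 0 0 = 0.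
Proof. by move=> tF; rewrite (Mo_Zp tF)// subrr !mul0r subrr. Qed.

Lemma Mo00_Zm F dF bF : tame F dF bF -> Mo 0 (Zminus dF bF) 0 0 = 0.
Proof. by move=> tF; rewrite (Mo_Zm tF)// subrr !mul0r subrr. Qed.

Definition Dir dF bF : R := int_mu (fun p => nrm2 (Zzero dF bF p)) + 2^-1 * int_mu (fun p => nrm2 (Zplus dF bF p))
  + 2^-1 * int_mu (fun p => nrm2 (Zminus dF bF p)).

Lemma Sn_le N F dF bF : tame F dF bF -> Sn N dF bF <= Dir dF bF.
Proof.
move=> tF; have := Qn_le N (cB_Z0 tF); have := Qn_le N (cB_Zp tF); have := Qn_le N (cB_Zm tF).
rewrite /Sn /Dir; lra.
Qed.

Lemma Sn_gap N F dF bF : tame F dF bF -> Sn N dF bF <= (1 - gape N) * Sn N.+1 dF bF.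
Proof.
move=> tF; have := Qn_gap N (cB_Z0 tF) (Mo00_Z0 tF).
have := Qn_gap N (cB_Zp tF) (Mo00_Zp tF); have := Qn_gap N (cB_Zm tF) (Mo00_Zm tF).
rewrite /Sn; lra.
Qed.

Lemma Sn_ge0 N dF bF : 0 <= Sn N dF bF.
Proof. by rewrite /Sn /Qn !addr_ge0// ?mulr_ge0// ?mulr_ge0// qC_ge0. Qed.

Lemma gape_le1 m : gape m <= 1.
Proof.
rewrite invf_le1 ?mulr_gt0 ?gapK_gt0 ?ltr0n//.
rewrite /gapK -natrX -!natrM ler1n; lia.
Qed.

Lemma Qn_succ m F dF bF : tame F dF bF -> Qn m.+1 F = Qn m F + Sn m.+1 dF bF / (m.+1%:R * m.+2%:R).
Proof.
move=> tF; have [_ cF _ _] := tF.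
rewrite (Sn_cas _ tF) Qn_step// mulrC mulKf ?mulf_neq0 ?pnatr_eq0//.
by rewrite addrC subrK.
Qed.

Lemma inv_succ (k : nat) : k.+1%:R^-1 - k.+2%:R^-1 = (k.+1%:R * k.+2%:R)^-1 :> R.
Proof.
have : 0 < k.+1%:R :> R by rewrite ltr0n.
have -> : k.+2%:R = k.+1%:R + 1 :> R by rewrite natr1.
move: k.+1%:R => x x0; have x1 : 0 < x + 1 by lra.
by field; do ?[apply/andP; split]; rewrite gt_eqF.
Qed.

(** Only the increment from n to n + 1 uses the gap, through [Sn_gap] followed by Bessel at level n
    + 2; the later ones use Bessel alone, and 1 / ((m + 1) (m + 2)) telescopes. *)
Lemma Qn_tele n k F dF bF : tame F dF bF ->
  Qn (n + k.+1) F <= Qn n F + (n.+1%:R^-1 - (n + k.+2)%:R^-1 - gape n.+1 / (n.+1%:R * n.+2%:R)) * Dir dF bF.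
Proof.
move=> tF; elim: k => [|k IH].
  rewrite addn1 (Qn_succ _ tF) lerD2l addn2.
  have -> : n.+1%:R^-1 - n.+2%:R^-1 - gape n.+1 / (n.+1%:R * n.+2%:R) = (1 - gape n.+1) / (n.+1%:R * n.+2%:R) :> R.
    by rewrite inv_succ mulrBl mul1r.
  rewrite mulrAC ler_wpM2r ?invr_ge0 ?mulr_ge0//.
  apply: le_trans (Sn_gap _ tF) _; rewrite ler_wpM2l ?subr_ge0 ?gape_le1//.
  exact: (Sn_le _ tF).
rewrite addnS (Qn_succ _ tF); set N := (n + k.+1)%N in IH *.
have -> : (n + k.+3)%N = N.+2 by rewrite /N; lia.
have E : (n + k.+2)%N = N.+1 by rewrite /N; lia.
rewrite E in IH.
have h := Sn_le N.+1 tF.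
have : Sn N.+1 dF bF / (N.+1%:R * N.+2%:R) <= Dir dF bF / (N.+1%:R * N.+2%:R).
  by rewrite ler_wpM2r// invr_ge0 mulr_ge0.
have -> : Dir dF bF / (N.+1%:R * N.+2%:R) = (N.+1%:R^-1 - N.+2%:R^-1) * Dir dF bF.
  by rewrite inv_succ mulrC.
move=> h2; apply: le_trans (lerD IH h2) _; rewrite -addrA -mulrDl.
by rewrite le_eqVlt; apply/orP; left; apply/eqP; congr (_ + _ * _); ring.
Qed.

(* (M + 1) kap2^M is the squared modulus of the normalized Bergman kernel of O(M),
   so that [Bn] below is the Berezin transform. *)
Definition kap2 p q : R := nrm2 (1 + toC p * (toC q)^J) * (weight p)^-1 * (weight q)^-1.

(** The right side is a quarter of the squared chordal distance on the unit sphere. *)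
Lemma kap2E p q : 1 - kap2 p q = ((p.1 - q.1) ^+ 2 + (p.2 - q.2) ^+ 2) * (weight p)^-1 * (weight q)^-1.
Proof.
rewrite /kap2 /nrm2 cReD cImD cReM cImM cReJ cImJ /=.
have wp := weight_neq0 p; have wq := weight_neq0 q.
rewrite /weight in wp wq *; by field; rewrite wp wq.
Qed.

Lemma kap2_ge0 p q : 0 <= kap2 p q.
Proof. by rewrite /kap2 !mulr_ge0 ?nrm2_ge0 ?winv_ge0. Qed.

Lemma kap2_le1 p q : kap2 p q <= 1.
Proof. by rewrite -subr_ge0 kap2E !mulr_ge0 ?winv_ge0// addr_ge0 ?sqr_ge0. Qed.

Lemma cont_kap2 p : continuous (kap2 p).
Proof.
apply: contM; last by apply: contV; [exact: weight_neq0|exact: cont_weight].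
apply: contM; last exact: cont_cst.
by apply: cont_nrm2; apply: ccontD; [exact: ccont_cst|apply: ccontM; [exact: ccont_cst|apply: ccontJ; exact: ccont_toC]].
Qed.

Lemma kap2_expand M p q : (kap2 p q ^+ M)%:C =
  \sum_(i < M.+1) \sum_(j < M.+1) 'C(M, i)%:R * 'C(M, j)%:R * ((mono i j M q)^J * mono i j M p).
Proof.
rewrite /kap2 !exprMn 2!rcM rcX nrm2RE exprMn cJD cJM cJK -[1^J]/((1%:R : C)^J) (cJn 1).
rewrite !exprDn.
set u := ((weight p)^-1 ^+ M)%:C; set v := ((weight q)^-1 ^+ M)%:C.
rewrite !mulr_suml; apply: eq_bigr => i _; rewrite mulr_sumr !mulr_suml; apply: eq_bigr => j _.
rewrite !expr1n !mul1r /mono !cJM !cJX cJK cJR -/u -/v !exprMn.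
rewrite -[_ *+ 'C(M, i)]mulr_natl -[_ *+ 'C(M, j)]mulr_natl.
by move: ('C(M, i)%:R) ('C(M, j)%:R) => x y; ring.
Qed.

Lemma int_q f B M p : continuous f -> (forall q, `|f q| <= B) ->
  (int_mu (fun q => f q * kap2 p q ^+ M))%:C =
  \sum_(i < M.+1) \sum_(j < M.+1) 'C(M, i)%:R * 'C(M, j)%:R * ((Mo M (fun q => (f q)%:C) i j)^J * mono i j M p).
Proof.
move=> cf fB.
have cF : cB (fun q => (f q)%:C).
  split; first exact: ccontR.
  by exists (B ^+ 2) => q; rewrite nrm2R -real_normK ?num_real// lerXn2r ?nnegrE// (le_trans _ (fB q)).
rewrite int_muE; last first.
  apply: (@PI_bounded _ _ B); first by apply: contM => //; apply: contX; exact: cont_kap2.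
  move=> q; rewrite normrM [`|kap2 _ _ ^+ _|]ger0_norm ?exprn_ge0 ?kap2_ge0// -[leRHS]mulr1.
  by apply: ler_pM; rewrite ?exprn_ge0 ?kap2_ge0// exprn_ile1 ?kap2_ge0 ?kap2_le1.
rewrite rcM -cD_R.
have pm (i j : 'I_M.+1) : cPI (fun q => (f q)%:C * mono i j M.+2 q).
  by apply: cPI_mono => //; have := ltn_ord i; have := ltn_ord j; lia.
have pij (i j : 'I_M.+1) : cPI (fun q => 'C(M, i)%:R * 'C(M, j)%:R * mono i j M p * ((f q)%:C * mono i j M.+2 q)^J).
  by apply: cPIZ; apply: cPIJ.
have -> : (fun q => (f q * kap2 p q ^+ M * (weight q)^-1 ^+ 2)%:C) = (fun q =>
   \sum_(i < M.+1) \sum_(j < M.+1) 'C(M, i)%:R * 'C(M, j)%:R * mono i j M p * ((f q)%:C * mono i j M.+2 q)^J).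
  apply/funext => q; rewrite 2!rcM kap2_expand mulr_sumr mulr_suml; apply: eq_bigr => i _.
  rewrite mulr_sumr mulr_suml; apply: eq_bigr => j _.
  rewrite [in RHS]cJM cJR.
  have -> : mono i j M.+2 q = ((weight q)^-1 ^+ 2)%:C * mono i j M q.
    by rewrite !monoS expr2 rcM mulrA.
  by rewrite [in RHS]cJM cJR; ring.
rewrite cD_sum; last by move=> i; apply: cPI_sum.
rewrite mulr_sumr; apply: eq_bigr => i _; rewrite cD_sum// mulr_sumr; apply: eq_bigr => j _.
rewrite cDZ; last exact: cPIJ.
by rewrite cDJ// /Mo cJM cJR; ring.
Qed.

Definition Bn M f p : R := M.+1%:R * int_mu (fun q => f q * kap2 p q ^+ M).

(** Continuity in p is read off the finite expansion of the kernel in monomials, with no limit under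
    the integral. *)
Lemma cont_Bn f B M : continuous f -> (forall q, `|f q| <= B) -> continuous (Bn M f).
Proof.
move=> cf fB; apply: contM; first exact: cont_cst.
suff [] : ccont (fun p => (int_mu (fun q => f q * kap2 p q ^+ M))%:C) by [].
under eq_fun do rewrite (int_q _ _ cf fB).
apply: ccont_sum => i; apply: ccont_sum => j.
apply: ccontM; first exact: ccont_cst.
by apply: ccontM; [exact: ccont_cst|exact: ccont_mono].
Qed.

Lemma Bn_C f B M p : continuous f -> (forall q, `|f q| <= B) ->
  (Bn M f p)%:C = M.+1%:R * \sum_(i < M.+1) \sum_(j < M.+1) 'C(M, i)%:R * 'C(M, j)%:R * ((Mo M (fun q => (f q)%:C) i j)^J * mono i j M p).
Proof. by move=> cf fB; rewrite /Bn rcM rcn (int_q _ _ cf fB). Qed.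

(** In the expansion of the kernel only the diagonal moments of 1 survive, and [Mo1_eq] normalizes
    them. *)
Lemma kap2_int1 M p : M.+1%:R * int_mu (fun q => kap2 p q ^+ M) = 1.
Proof.
have h := @Bn_C (fun=> 1) 1 M p (@cont_cst R _ 1).
have {}h : (Bn M (fun=> 1) p)%:C = 1.
  rewrite h; last by move=> _; rewrite normr1.
  have -> : (fun q : R * R => (1 : R)%:C) = fun=> 1 by [].
  rewrite mulr_sumr.
  transitivity (\sum_(i < M.+1) 'C(M, i)%:R * mono i i M p).
    apply: eq_bigr => i _; have iM : (i <= M)%N by have := ltn_ord i; lia.
    rewrite (bigD1 i)// big1; last first.
      move=> j ji; have jM : (j <= M)%N by have := ltn_ord j; lia.
      rewrite Mo1_neq//; last by rewrite eq_sym.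
      by rewrite (cJn 0) mul0r mulr0.
    have e := @Mo1_eq R M i iM.
    have eJ : M.+1%:R * 'C(M, i)%:R * (Mo M (fun=> 1) i i)^J = 1 :> C.
      have := congr1 conjc e; move: (Mo M (fun=> 1) i i) => u; rewrite !cJM !cJn => ->.
      exact: (@cJn R 1).
    transitivity ('C(M, i)%:R * mono i i M p * (M.+1%:R * 'C(M, i)%:R * (Mo M (fun=> 1) i i)^J)).
      move: (Mo M (fun=> 1) i i) (mono i i M p) => u v.
      by rewrite [X in _ * X]addr0; ring.
    by rewrite eJ mulr1.
  have -> : \sum_(i < M.+1) 'C(M, i)%:R * mono i i M p = (weight p ^+ 2)%:C * \sum_(i < M.+1) 'C(M, i)%:R * mono i i M.+2 p.
    rewrite mulr_sumr; apply: eq_bigr => i _; rewrite !monoS !mulrA; congr (_ * _).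
    have : (weight p ^+ 2)%:C * ((weight p)^-1)%:C * ((weight p)^-1)%:C = 1 :> C.
      by rewrite -!rcM expr2 mulfK ?weight_neq0// divff ?weight_neq0.
    move: (toC p) ((weight p ^+ 2)%:C) (((weight p)^-1)%:C : C) => x y u yu.
    by ring: yu.
  by rewrite sumr_mono -rcM exprVn divff// expf_neq0// weight_neq0.
transitivity (Bn M (fun=> 1) p); last exact: (congr1 Re h).
rewrite /Bn; congr (_ * int_mu _).
by apply/funext => q; rewrite mul1r.
Qed.

(** Expanding the kernel in monomials turns the double integral into the sum of squared moments that
    defines Q_M. The limit of Q_M is thereby reduced to that of the Berezin transform. *)
Lemma Qn_Bn f B M : continuous f -> (forall q, `|f q| <= B) ->
  Qn M (fun q => (f q)%:C) = int_mu (fun p => f p * Bn M f p).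
Proof.
move=> cf fB.
have cF : cB (fun q => (f q)%:C).
  split; first exact: ccontR.
  by exists (B ^+ 2) => q; rewrite nrm2R -real_normK ?num_real// lerXn2r ?nnegrE// (le_trans _ (fB q)).
pose F q := (f q)%:C.
suff : (int_mu (fun p => f p * Bn M f p))%:C = (Qn M F)%:C by move=> /(congr1 Re).
pose t (i j : 'I_M.+1) : C := M.+1%:R * ('C(M, i)%:R * 'C(M, j)%:R * (Mo M F i j)^J).
have pm (i j : 'I_M.+1) : cPI (fun q => F q * mono i j M.+2 q).
  by apply: cPI_mono => //; have := ltn_ord i; have := ltn_ord j; lia.
have pij (i j : 'I_M.+1) : cPI (fun p => t i j * (F p * mono i j M.+2 p)) by apply: cPIZ.
have pi_ (i : 'I_M.+1) := cPI_sum (index_enum _) (pij i).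
have E : (fun p => (f p * Bn M f p * (weight p)^-1 ^+ 2)%:C) =
   fun p => \sum_(i < M.+1) \sum_(j < M.+1) t i j * (F p * mono i j M.+2 p).
  apply/funext => p; rewrite 2!rcM (Bn_C _ _ cf fB) -/F mulr_sumr mulr_sumr mulr_suml; apply: eq_bigr => i _.
  rewrite !mulr_sumr mulr_suml; apply: eq_bigr => j _.
  have -> : mono i j M.+2 p = ((weight p)^-1 ^+ 2)%:C * mono i j M p.
    by rewrite !monoS expr2 rcM mulrA.
  by rewrite /t /F; ring.
rewrite int_muE; last first.
  by have [] := cPI_sum (index_enum _) pi_; rewrite -E.
rewrite rcM -cD_R E (cD_sum _ pi_) /Qn rcM rcn /qC (rmorph_sum (real_complex R)) /= !mulr_sumr.
apply: eq_bigr => i _; rewrite (cD_sum _ (pij i)) (rmorph_sum (real_complex R)) /= !mulr_sumr; apply: eq_bigr => j _.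
by rewrite cDZ// 2!rcM !rcn nrm2RE /t {2}/Mo -/(mom F i j M.+2); ring.
Qed.

Definition bc f := continuous f /\ exists B, forall p, `|f p| <= B.
Lemma bc_PI f : bc f -> PI (fun p => f p * (weight p)^-1 ^+ 2).
Proof. by move=> [cf [B fB]]; exact: PI_bounded fB. Qed.

Lemma bcD f g : bc f -> bc g -> bc (fun p => f p + g p).
Proof.
move=> [cf [B fB]] [cg [B' gB]]; split; first exact: contD.
by exists (B + B') => p; apply: le_trans (ler_normD _ _) (lerD _ _).
Qed.

Lemma bcM f g : bc f -> bc g -> bc (fun p => f p * g p).
Proof.
move=> [cf [B fB]] [cg [B' gB]]; split; first exact: contM.
by exists (B * B') => p; rewrite normrM ler_pM.
Qed.

Lemma bc_cst c : bc (fun=> c).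
Proof. by split; [exact: cont_cst|exists `|c|]. Qed.

Lemma bcZ c f : bc f -> bc (fun p => c * f p).
Proof. by apply: bcM; exact: bc_cst. Qed.

Lemma bcN f : bc f -> bc (fun p => - f p).
Proof. by move=> bf; under eq_fun do rewrite -mulN1r; exact: bcZ. Qed.

Lemma bcB f g : bc f -> bc g -> bc (fun p => f p - g p).
Proof. by move=> bf bg; apply: bcD => //; exact: bcN. Qed.

Lemma bcX f n : bc f -> bc (fun p => f p ^+ n).
Proof.
move=> bf; elim: n => [|n IH]; first exact: bc_cst.
by under eq_fun do rewrite exprS; exact: bcM.
Qed.

Lemma bc_norm f : bc f -> bc (fun p => `|f p|).
Proof. by move=> [cf [B fB]]; split; [exact: cont_norm|exists B => p; rewrite normr_id]. Qed.

Lemma bc_comp (h : R -> R) f : continuous h -> bc f -> bc (fun p => h (f p)).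
Proof.
move=> ch [cf [B fB]]; split; first exact: cont_comp1.
have B0 : 0 <= B by apply: le_trans (fB (0, 0)).
have [] := @EVT_max R (fun x => `|h x|) (- B) B.
- by rewrite -subr_ge0 opprK addr_ge0.
- apply: continuous_subspaceT; exact: cont_norm.
move=> c _ cM; exists `|h c| => p; apply: cM.
by rewrite in_itv /= -ler_norml.
Qed.

Lemma int_muD f g : bc f -> bc g -> int_mu (fun p => f p + g p) = int_mu f + int_mu g.
Proof.
move=> bf bg; have bfg := bcD bf bg.
rewrite !int_muE; try exact: bc_PI.
rewrite -mulrDr -DplaneD; try exact: bc_PI.
by congr (_ * Dplane _); apply/funext => p; rewrite mulrDl.
Qed.

Lemma int_muZ c f : bc f -> int_mu (fun p => c * f p) = c * int_mu f.
Proof.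
move=> bf; have bfg := bcZ c bf.
rewrite !int_muE; try exact: bc_PI.
rewrite mulrCA -[c * Dplane _]DplaneZ; try exact: bc_PI.
by congr (_ * Dplane _); apply/funext => p; rewrite mulrA.
Qed.

Lemma int_muB f g : bc f -> bc g -> int_mu (fun p => f p - g p) = int_mu f - int_mu g.
Proof.
move=> bf bg; rewrite -mulN1r -int_muZ// -int_muD//; last exact: bcZ.
by congr int_mu; apply/funext => p; rewrite mulN1r.
Qed.

Lemma int_mu_ge0 f : bc f -> (forall p, 0 <= f p) -> 0 <= int_mu f.
Proof.
move=> bf f0; rewrite int_muE; last exact: bc_PI.
rewrite mulr_ge0 ?invr_ge0 ?pi_ge0// Dplane_ge0// => p.
by rewrite mulr_ge0// exprn_ge0// winv_ge0.
Qed.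

Lemma int_mu_le f g : bc f -> bc g -> (forall p, f p <= g p) -> int_mu f <= int_mu g.
Proof.
move=> bf bg fg; rewrite -subr_ge0 -int_muB// int_mu_ge0//; first exact: bcB.
by move=> p; rewrite subr_ge0.
Qed.

Lemma int_mu_norm f : bc f -> `|int_mu f| <= int_mu (fun p => `|f p|).
Proof.
move=> bf; have bn := bc_norm bf; rewrite ler_norml; apply/andP; split.
  rewrite -mulN1r -int_muZ//; apply: int_mu_le => //; first exact: bcZ.
  by move=> p; rewrite mulN1r lerNl -normrN ler_norm.
by apply: int_mu_le => // p; exact: ler_norm.
Qed.

Lemma int_mu1 : int_mu (fun=> 1) = 1 :> R.
Proof.
rewrite int_muE; last by apply: (bc_PI (f := fun=> 1)); exact: bc_cst.
have -> : (fun p => 1 * (weight p)^-1 ^+ 2) = fun p : R * R => (weight p ^+ 2)^-1.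
  by apply/funext => p; rewrite mul1r exprVn.
by rewrite Dplane_inv_weight2 mulVf// gt_eqF// pi_gt0.
Qed.

Lemma int_mu_cst c : int_mu (fun=> c) = c :> R.
Proof.
rewrite -[RHS]mulr1 -int_mu1 -int_muZ; last exact: bc_cst.
by congr int_mu; apply/funext => p; rewrite mulr1.
Qed.

Lemma bc_kap2 p : bc (kap2 p).
Proof.
split; first exact: cont_kap2.
by exists 1 => q; rewrite ger0_norm ?kap2_ge0 ?kap2_le1.
Qed.

(** Near p continuity gives e; away from p the chordal distance is bounded below, so a multiple of
    [1 - kap2 p q] exceeds the oscillation of f. The constant may depend on p, as pointwise
    convergence is all that is needed. *)
Lemma Bn_approx f e p : bc f -> 0 < e ->
  exists K, forall q, `|f q - f p| <= e + K * (1 - kap2 p q).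
Proof.
move=> [cf [B fB]] e0.
have B0 : 0 <= B by apply: le_trans (fB (0, 0)).
have /cvgrPdist_le /(_ e e0) := cf p; rewrite -nbhs_ballE => -[d /= d0 dP].
(* Outside the ball D >= d^2, so w(q) <= 2 w(p) + 2 D <= L D. *)
pose L := 2 * weight p / d ^+ 2 + 2.
have wp := weight_gt0 p.
have L0 : 0 <= L by rewrite addr_ge0// mulr_ge0 ?invr_ge0 ?sqr_ge0// mulr_ge0// ltW.
exists (2 * B * weight p * L) => q.
set D := (p.1 - q.1) ^+ 2 + (p.2 - q.2) ^+ 2.
have D0 : 0 <= D by rewrite addr_ge0// sqr_ge0.
have wq := weight_gt0 q.
have -> : 2 * B * weight p * L * (1 - kap2 p q) = 2 * B * (L * D / weight q).
  by rewrite kap2E -/D; field; rewrite !gt_eqF.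
have K0 : 0 <= 2 * B * (L * D / weight q) by rewrite !mulr_ge0// invr_ge0 ltW.
have [/dP h|nb] := pselect (ball p d q).
  by rewrite distrC; apply: le_trans h _; rewrite lerDl.
have dD : d ^+ 2 <= D.
  rewrite leNgt; apply/negP => Dd; apply: nb.
  have aux (x : R) : x ^+ 2 < d ^+ 2 -> `|x| < d.
    by move=> xd; rewrite -(ltr_pXn2r (n := 2))// ?nnegrE ?(ltW d0)// real_normK// num_real.
  have s1 := sqr_ge0 (p.1 - q.1); have s2 := sqr_ge0 (p.2 - q.2).
  by split; rewrite /ball /=; apply: aux; apply: le_lt_trans Dd; rewrite /D; lra.
have wqle : weight q <= 2 * weight p + 2 * D.
  rewrite /weight /D; have := sqr_ge0 (2 * p.1 - q.1); have := sqr_ge0 (2 * p.2 - q.2); nra.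
have LD : weight q <= L * D.
  apply: (le_trans wqle); have -> : L * D = 2 * weight p / d ^+ 2 * D + 2 * D by rewrite /L mulrDl.
  rewrite lerD2r mulrAC ler_pdivlMr ?exprn_gt0//.
  by rewrite ler_wpM2l// mulr_ge0// ltW.
apply: (@le_trans _ _ (2 * B)).
  by apply: le_trans (ler_normB _ _) _; have := fB q; have := fB p; lra.
apply: (@le_trans _ _ (2 * B * (L * D / weight q))); last by rewrite lerDr ltW.
by rewrite -[leLHS]mulr1 ler_wpM2l ?mulr_ge0// ler_pdivlMr// mul1r.
Qed.

(** Under the probability density (M + 1) [kap2]^M, the mean of 1 - [kap2] is 1 - (M + 1) / (M + 2)
    = 1 / (M + 2), by [kap2_int1] at M and M + 1. *)
Lemma Bn_dist f e K M p : bc f -> (forall q, `|f q - f p| <= e + K * (1 - kap2 p q)) ->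
  `|Bn M f p - f p| <= e + K / M.+2%:R.
Proof.
move=> bf fe.
have bk := bc_kap2 p; have bM := bcX M bk.
have b1 : bc (fun q => f q * kap2 p q ^+ M) by exact: bcM.
have b2 : bc (fun q => (f q - f p) * kap2 p q ^+ M) by apply: bcM => //; apply: bcB => //; exact: bc_cst.
have M0 : M.+1%:R != 0 :> R by rewrite pnatr_eq0.
have eM := kap2_int1 M p; have eM1 := kap2_int1 M.+1 p.
have -> : Bn M f p - f p = M.+1%:R * int_mu (fun q => (f q - f p) * kap2 p q ^+ M).
  have -> : (fun q => (f q - f p) * kap2 p q ^+ M) = fun q => f q * kap2 p q ^+ M - f p * kap2 p q ^+ M.
    by apply/funext => q; rewrite mulrBl.
  rewrite int_muB//; last exact: bcZ.
  by rewrite int_muZ// mulrBr mulrCA eM mulr1.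
rewrite normrM normr_nat.
apply: (@le_trans _ _ (M.+1%:R * int_mu (fun q => (e + K) * kap2 p q ^+ M - K * kap2 p q ^+ M.+1))).
  rewrite ler_wpM2l//; apply: le_trans (int_mu_norm b2) _.
  apply: int_mu_le; first exact: bc_norm.
    by apply: bcB; apply: bcZ => //; exact: bcX.
  move=> q; rewrite normrM [`|_ ^+ M|]ger0_norm ?exprn_ge0 ?kap2_ge0//.
  apply: (@le_trans _ _ ((e + K * (1 - kap2 p q)) * kap2 p q ^+ M)).
    by rewrite ler_wpM2r ?exprn_ge0 ?kap2_ge0.
  by rewrite exprS le_eqVlt; apply/orP; left; apply/eqP; ring.
rewrite int_muB ?int_muZ//; [|exact: bcX|exact: bcZ|by apply: bcZ; exact: bcX].
set a := int_mu _ in eM *; set b := int_mu (fun q => _ ^+ M.+1) in eM1 *.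
have -> : M.+1%:R * ((e + K) * a - K * b) = (e + K) * (M.+1%:R * a) - K * (M.+2%:R * b) + K * b.
  by rewrite -(natr1 M.+1); ring.
rewrite eM eM1.
have -> : b = M.+2%:R^-1.
  have M2 : M.+2%:R != 0 :> R by rewrite pnatr_eq0.
  by apply: (mulfI M2); rewrite eM1 divff.
by rewrite !mulr1 addrK.
Qed.

Lemma Bn_cvg f p : bc f -> (fun M => Bn M f p) @ \oo --> f p.
Proof.
move=> bf; apply/cvgrPdist_le => e e0.
have e20 : 0 < e / 2 by rewrite divr_gt0.
have [K fK] := Bn_approx p bf e20.
have := @cvg_harmonic R => /cvgrPdist_le.
have e30 : 0 < e / 2 / (`|K| + 1) by rewrite divr_gt0// ltr_wpDl.
move=> /(_ _ e30) [N0 _ hN]; exists N0 => // M /= NM.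
rewrite distrC; apply: le_trans (Bn_dist M bf fK) _.
have := hN M NM; rewrite sub0r normrN /= ger0_norm// => h.
have h1 : K / M.+2%:R <= (`|K| + 1) / M.+2%:R.
  by rewrite ler_wpM2r ?invr_ge0//; have := ler_norm K; lra.
have h2 : (`|K| + 1) / M.+2%:R <= (`|K| + 1) / M.+1%:R.
  by rewrite ler_wpM2l ?lef_pV2 ?posrE ?ltr0n ?ler_nat// addr_ge0.
have h3 : (`|K| + 1) / M.+1%:R <= e / 2.
  by rewrite mulrC -ler_pdivlMr// ltr_wpDl.
by rewrite [leRHS]splitr lerD2l (le_trans h1)// (le_trans h2).
Qed.

(** The Berezin transform does not increase the supremum, so pointwise convergence and dominated
    convergence suffice. *)
Lemma Qn_cvg f : bc f -> (fun M => Qn M (fun q => (f q)%:C)) @ \oo --> int_mu (fun p => f p ^+ 2).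
Proof.
move=> bf; have [cf [B fB]] := bf.
have B0 : 0 <= B by apply: le_trans (fB (0, 0)).
have BnB M p : `|Bn M f p| <= B.
  rewrite /Bn -int_muZ; last by apply: bcM => //; apply: bcX; exact: bc_kap2.
  have bk := bcX M (bc_kap2 p).
  apply: le_trans (int_mu_norm _) _; first by apply: bcZ; exact: bcM.
  have -> : B = int_mu (fun q => B * (M.+1%:R * kap2 p q ^+ M)).
    by rewrite int_muZ ?int_muZ ?kap2_int1 ?mulr1//; exact: bcZ.
  apply: int_mu_le; [apply: bc_norm; apply: bcZ; exact: bcM|apply: bcZ; exact: bcZ|].
  move=> q; have k0 : 0 <= kap2 p q ^+ M by rewrite exprn_ge0// kap2_ge0.
  rewrite !normrM normr_nat (ger0_norm k0) mulrCA.
  by apply: ler_wpM2r; rewrite ?mulr_ge0.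
have bB M : bc (Bn M f) by split; [exact: cont_Bn fB|exists B; exact: BnB].
have -> : (fun M => Qn M (fun q => (f q)%:C)) = fun M => int_mu (fun p => f p * Bn M f p).
  by apply/funext => M; rewrite (Qn_Bn _ cf fB).
have bfB M := bcM bf (bB M).
under eq_fun do rewrite (int_muE (bc_PI (bfB _))).
rewrite (int_muE (bc_PI (bcX 2 bf))).
apply: cvgMr.
pose h p : \bar R := (f p ^+ 2 * (weight p)^-1 ^+ 2)%:E.
pose hM M p : \bar R := (f p * Bn M f p * (weight p)^-1 ^+ 2)%:E.
pose mu2 := (@lebesgue_measure R \x @lebesgue_measure R)%E.
have ph : PI (fun p => f p ^+ 2 * (weight p)^-1 ^+ 2) by apply: bc_PI; exact: bcX.
have phM M : PI (fun p => f p * Bn M f p * (weight p)^-1 ^+ 2) by exact: bc_PI.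
have pg : PI (fun p => B ^+ 2 * (weight p)^-1 ^+ 2) by apply: PIZ; exact: PI_winv2.
have [] := @dominated_convergence _ _ R mu2 setT measurableT hM h (fun p => (B ^+ 2 * (weight p)^-1 ^+ 2)%:E).
- by move=> M; have /PI_integrable/measurable_int := phM M.
- by have /PI_integrable/measurable_int := ph.
- apply: aeW => p _; apply: cvg_EFin; first by apply: nearW.
  by rewrite expr2; apply: cvgMl; apply: cvgMr; exact: Bn_cvg.
- by have /PI_integrable := pg.
- apply: aeW => p M _; rewrite lee_fin normrM [`|_ ^+ 2|]ger0_norm ?exprn_ge0 ?winv_ge0//.
  apply: ler_wpM2r; first by rewrite exprn_ge0 ?winv_ge0.
  by rewrite normrM [leRHS]expr2; apply: ler_pM => //; exact: BnB.
move=> _ _ hc.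
have E : (\int[mu2]_x h x)%E = (Dplane (fun p => f p ^+ 2 * (weight p)^-1 ^+ 2))%:E.
  by rewrite fineK//; apply: integrable_fin_num => //; exact: PI_integrable.
by rewrite E in hc; exact: fine_cvg hc.
Qed.

Lemma sqr_gap n (f : R * R -> R) dF bF : tame (fun p => (f p)%:C) dF bF -> bc f ->
  int_mu (fun p => f p ^+ 2) <= Qn n (fun p => (f p)%:C) +
   (n.+1%:R^-1 - gape n.+1 / (n.+1%:R * n.+2%:R)) * Dir dF bF.
Proof.
move=> tF bf; apply: (cvgr_to_le (Qn_cvg bf)).
have D0 : 0 <= Dir dF bF by apply: le_trans (Sn_le 0 tF); exact: Sn_ge0.
exists n.+1 => // M /= nM; have -> : M = (n + (M - n.+1).+1)%N by lia.
apply: le_trans (Qn_tele _ _ tF) _; rewrite lerD2l ler_wpM2r// lerD2r.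
by rewrite gerDl oppr_le0 invr_ge0.
Qed.
End Gap.

(** * A weak Moser-Trudinger inequality *)

Section Calc.
Context {R : realType}.
Implicit Types (x a : R) (h k : R -> R).

Lemma mul_monotone_ge0 k k' x : (forall t : R, is_derive t 1 k (k' t)) -> k 0 = 0 -> (forall t, 0 <= k' t) -> 0 <= x * k x.
Proof.
move=> dk k0 k'0; have ck := is_derive_continuous dk.
have ndk (u v : R) : u <= v -> k u <= k v.
  move=> uv; have [t _] := MVT_segment uv (fun t _ => dk t) (continuous_subspaceT ck).
  by move=> e; rewrite -subr_ge0 e mulr_ge0// subr_ge0.
have [x0|x0] := leP 0 x; first by rewrite mulr_ge0// -k0 ndk.
have := ndk x 0 (ltW x0); rewrite k0 => kx; apply: mulr_le0 => //; exact: ltW.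
Qed.

(** The condition says that h decreases before 0 and increases after it. Combined with
    [mul_monotone_ge0], it reduces a pointwise inequality to the sign of a second derivative. *)
Lemma mul_derive_ge0 h h' x : (forall t : R, is_derive t 1 h (h' t)) -> h 0 = 0 -> (forall t, 0 <= t * h' t) -> 0 <= h x.
Proof.
move=> dh h0 h'0; have ch := is_derive_continuous dh.
have [x0|x0|<-] := ltgtP 0 x; last by rewrite h0.
  have [t] := MVT x0 (fun t _ => dh t) (continuous_subspaceT ch).
  rewrite in_itv /= => /andP[t0 _]; rewrite h0 !subr0 => ->; rewrite mulr_ge0 ?(ltW x0)//.
  by rewrite -(pmulr_rge0 _ t0).
have [t] := MVT x0 (fun t _ => dh t) (continuous_subspaceT ch).
rewrite in_itv /= => /andP[_ t0]; rewrite h0 !sub0r => e; rewrite -oppr_le0 e mulr_le0_ge0//.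
  by rewrite -(nmulr_rge0 _ t0).
by rewrite oppr_ge0 ltW.
Qed.

Definition shh x : R := (expR x - expR (- x)) / 2.
Definition chh x : R := (expR x + expR (- x)) / 2.

Lemma is_derive_expRZ (c x : R) : is_derive x 1 (fun t => expR (c * t)) (c * expR (c * x)).
Proof.
have := is_derive_expR_comp (is_derive_mul (is_derive_cst1 x c) (is_derive_id1 x)).
by move=> h; apply: is_derive_eq; rewrite mul0r add0r mulr1.
Qed.

Lemma is_derive_expRN x : is_derive x 1 (fun t => expR (- t)) (- expR (- x)).
Proof. have := is_derive_expRZ (-1) x; rewrite !mulN1r. by under [fun t => _]eq_fun do rewrite mulN1r. Qed.

Lemma is_derive_scaler x f (a c : R) : is_derive x 1 f a -> is_derive x 1 (fun t => f t / c) (a / c).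
Proof.
move=> df; have := is_derive_mul df (is_derive_cst1 x c^-1).
by move=> h; apply: is_derive_eq; rewrite mulr0 addr0.
Qed.

Lemma is_derive_expR1 x : is_derive x 1 (@expR R) (expR x).
Proof. exact: is_derive_expR. Qed.

Lemma is_derive_shh x : is_derive x 1 shh (chh x).
Proof.
have := is_derive_scaler 2 (is_derive_sub (is_derive_expR1 x) (is_derive_expRN x)).
by rewrite opprK.
Qed.

Lemma is_derive_chh x : is_derive x 1 chh (shh x).
Proof. exact: (is_derive_scaler 2 (is_derive_add (is_derive_expR1 x) (is_derive_expRN x))). Qed.

Lemma shh0 : shh 0 = 0. Proof. by rewrite /shh oppr0 subrr mul0r. Qed.

Lemma chh0 : chh 0 = 1. Proof. by rewrite /chh oppr0 expR0; field. Qed.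

Lemma chh_ge0 x : 0 <= chh x. Proof. by rewrite divr_ge0// addr_ge0// expR_ge0. Qed.

Lemma mulx_shh_ge0 x : 0 <= x * shh x.
Proof. exact: mul_monotone_ge0 is_derive_shh shh0 chh_ge0. Qed.

Lemma shh2 x : shh x ^+ 2 = (chh x - 1) ^+ 2 + 2 * (chh x - 1).
Proof.
have e : expR x * expR (- x) = 1 by rewrite -expRD subrr expR0.
rewrite /shh /chh; move: (expR x) (expR (- x)) e => u v e.
by field: e.
Qed.

Lemma chh_ge1 x : 0 <= chh x - 1.
Proof.
apply: (@mul_derive_ge0 (fun t => chh t - 1) shh).
- by move=> t; have := is_derive_sub (is_derive_chh t) (is_derive_cst1 t 1); rewrite subr0.
- by rewrite chh0 subrr.
exact: mulx_shh_ge0.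
Qed.

Lemma chh_le x : chh x - 1 <= 2^-1 * (x * shh x).
Proof.
rewrite -subr_ge0.
apply: (@mul_derive_ge0 (fun t => 2^-1 * (t * shh t) - (chh t - 1)) (fun t => 2^-1 * (t * chh t - shh t))).
- move=> t; have h1 := is_derive_sub (is_derive_chh t) (is_derive_cst1 t 1).
  have h2 := is_derive_mul (is_derive_id1 t) (is_derive_shh t).
  have := is_derive_sub (is_derive_mul (is_derive_cst1 t 2^-1) h2) h1.
  by move=> h; apply: is_derive_eq; field.
- by rewrite chh0 mul0r mulr0 !subrr.
move=> t; rewrite mulrCA mulr_ge0//.
apply: (@mul_monotone_ge0 (fun t => t * chh t - shh t) (fun t => t * shh t)).
- move=> u; have := is_derive_sub (is_derive_mul (is_derive_id1 u) (is_derive_chh u)) (is_derive_shh u).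
  by move=> h; apply: is_derive_eq; ring.
- by rewrite shh0 mul0r subrr.
exact: mulx_shh_ge0.
Qed.

Lemma bernoulli (u : R) n : -1 <= u -> 1 + n%:R * u <= (1 + u) ^+ n.
Proof.
move=> u1; elim: n => [|n IH]; first by rewrite mul0r addr0 expr0.
have u0 : 0 <= 1 + u by lra.
rewrite exprS; apply: le_trans (ler_wpM2l u0 IH).
rewrite -natr1; have : 0 <= n%:R * u ^+ 2 by rewrite mulr_ge0// sqr_ge0.
move: (n%:R : R) => m; nra.
Qed.

Definition r3 x : R := expR x - 1 - x - x ^+ 2 / 2.
(** Both sides vanish to first order at 0, so it is enough to compare second derivatives: s (e^u -
    1) <= e^(s u) + e^(- s u), which is Bernoulli's inequality for (1 + (e^u - 1))^s. The factor
    s^-3 against an s^2 in [shh_int_le] is what leaves a gain 1 / s. *)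
Lemma r3_le (s : nat) x : (0 < s)%N -> r3 x <= (s%:R ^+ 3)^-1 * (4 * shh (s%:R * x / 2) ^+ 2).
Proof.
move=> s0; have {}s0 : 0 < s%:R :> R by rewrite ltr0n.
have sn0 : s%:R != 0 :> R by rewrite gt_eqF.
have -> : 4 * shh (s%:R * x / 2) ^+ 2 = expR (s%:R * x) + expR (- s%:R * x) - 2.
  have e : expR (s%:R * x / 2) * expR (- (s%:R * x / 2)) = 1 by rewrite -expRD subrr expR0.
  have -> : s%:R * x = s%:R * x / 2 + s%:R * x / 2 by field.
  have -> : - s%:R * x = - (s%:R * x / 2) + - (s%:R * x / 2) by field.
  rewrite /shh !expRD; have -> : (s%:R * x / 2 + s%:R * x / 2) / 2 = s%:R * x / 2 by field.
  by move: (expR (s%:R * x / 2)) (expR (- (s%:R * x / 2))) e => u v e; field: e.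
rewrite -subr_ge0 /r3.
set S := s%:R in s0 sn0 *.
pose h1 t := (S ^+ 2)^-1 * (expR (S * t) - expR (- S * t)) - (expR t - 1 - t).
pose h2 t := S^-1 * (expR (S * t) + expR (- S * t)) - (expR t - 1).
apply: (@mul_derive_ge0 (fun t => (S ^+ 3)^-1 * (expR (S * t) + expR (- S * t) - 2) - (expR t - 1 - t - t ^+ 2 / 2)) h1).
- move=> t; have d1 := is_derive_expRZ S t; have d2 := is_derive_expRZ (- S) t.
  have d3 := is_derive_mul (is_derive_cst1 t (S ^+ 3)^-1) (is_derive_sub (is_derive_add d1 d2) (is_derive_cst1 t 2)).
  have d4 := is_derive_scaler 2 (is_derive_mul (is_derive_id1 t) (is_derive_id1 t)).
  have d5 := is_derive_sub (is_derive_sub (is_derive_sub (is_derive_expR1 t) (is_derive_cst1 t 1)) (is_derive_id1 t)) d4.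
  have := is_derive_sub d3 d5; under [fun t => _]eq_fun do rewrite -expr2.
  by move=> h; apply: is_derive_eq; rewrite /h1; field.
- by rewrite !mulr0 expR0; field.
move=> t; apply: (@mul_monotone_ge0 h1 h2).
- move=> u; have d1 := is_derive_expRZ S u; have d2 := is_derive_expRZ (- S) u.
  have d3 := is_derive_mul (is_derive_cst1 u (S ^+ 2)^-1) (is_derive_sub d1 d2).
  have d5 := is_derive_sub (is_derive_sub (is_derive_expR1 u) (is_derive_cst1 u 1)) (is_derive_id1 u).
  have := is_derive_sub d3 d5.
  by move=> h; apply: is_derive_eq; rewrite /h2; field.
- by rewrite /h1 !mulr0 expR0; field.
move=> u; rewrite /h2 subr_ge0 mulrC ler_pdivlMr//.
have := @bernoulli (expR u - 1) s; have := expR_ge0 u; have := expR_ge0 (- S * u).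
rewrite [1 + (_ - 1)]addrC subrK -expRM_natl -/S => e1 e2 /(_ _); move=> h.
have := h ltac:(lra); lra.
Qed.

Lemma r2_ge0 x : 0 <= expR x - 1 - x.
Proof. by have := expR_ge1Dx x; lra. Qed.
End Calc.

(** * The Sobolev inequality on the sphere and exponential integrability *)

Section MT.
Context {R : realType}.
Local Open Scope complex_scope.
Local Notation "z ^J" := (conjc z) (at level 2, format "z ^J").
Local Notation C := R[i].
Implicit Types (p q : R * R) (f g fx fy : R * R -> R).

Definition tameR f fx fy := [/\ partial1 f fx, partial2 f fy, bc f,
  bc (fun p => weight p * fx p) & bc (fun p => weight p * fy p)].

Lemma bc_cB f g : bc f -> bc g -> cB (fun p => f p +i* g p).
Proof.
move=> [cf [B fB]] [cg [B' gB]]; split; first by split.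
exists (B ^+ 2 + B' ^+ 2) => p; rewrite /nrm2 /=; apply: lerD.
  by rewrite -real_normK ?num_real// lerXn2r ?nnegrE// (le_trans _ (fB p)).
by rewrite -real_normK ?num_real// lerXn2r ?nnegrE// (le_trans _ (gB p)).
Qed.

Lemma tameR_tame f fx fy : tameR f fx fy ->
  tame (fun p => (f p)%:C) (fun p => (fx p / 2) +i* (- fy p / 2)) (fun p => (fx p / 2) +i* (fy p / 2)).
Proof.
move=> [d1 d2 bf bx b_y]; split.
- split; split => x y; rewrite /comp; apply: is_derive_eq.
  + exact: d1.
  + by rewrite cReD /=; field.
  + exact: is_derive_cst1.
  + by rewrite cImD /=; field.
  + exact: d2.
  + by rewrite cReM cReD cImD cReN cImN /=; field.
  + exact: is_derive_cst1.
  by rewrite cImM cReD cImD cReN cImN /=; field.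
- exact: (bc_cB bf (bc_cst 0)).
- have := bc_cB (bcZ 2^-1 bx) (bcZ (- 2^-1) b_y); congr cB; apply/funext => p.
  by apply: complexE2; rewrite ?cReM ?cImM /=; ring.
have := bc_cB (bcZ 2^-1 bx) (bcZ 2^-1 b_y); congr cB; apply/funext => p.
by apply: complexE2; rewrite ?cReM ?cImM /=; ring.
Qed.

Definition DirR fx fy := int_mu (fun p : R * R => (weight p / 2) ^+ 2 * (fx p ^+ 2 + fy p ^+ 2)).

Lemma cB_bc_nrm2 (F : R * R -> C) : cB F -> bc (fun p => nrm2 (F p)).
Proof.
move=> [cF [B FB]]; split; first exact: cont_nrm2.
by exists B => p; rewrite ger0_norm ?nrm2_ge0.
Qed.

Lemma Dir_DirR f fx fy : tameR f fx fy ->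
  Dir (fun p => (fx p / 2) +i* (- fy p / 2)) (fun p => (fx p / 2) +i* (fy p / 2)) = DirR fx fy.
Proof.
move=> /tameR_tame tf; rewrite /Dir.
have b0 := cB_bc_nrm2 (cB_Z0 tf); have bp := cB_bc_nrm2 (cB_Zp tf); have bm := cB_bc_nrm2 (cB_Zm tf).
rewrite -!int_muZ// -int_muD//; last exact: bcZ.
rewrite -int_muD//; [|by apply: bcD => //; exact: bcZ|exact: bcZ].
congr int_mu; apply/funext => p.
rewrite /Zzero /Zplus /Zminus /nrm2 !expr2 !(cReD, cImD, cReN, cImN, cReM, cImM, cReJ, cImJ) /= /weight.
by field.
Qed.

Lemma cont_div_weight f : continuous (fun p => weight p * f p) -> continuous f.
Proof.
move=> h; have -> : f = fun p => (weight p)^-1 * (weight p * f p).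
  by apply/funext => p; rewrite mulKf// weight_neq0.
by apply: contM => //; apply: contV; [exact: weight_neq0|exact: cont_weight].
Qed.

Lemma cont_winv : continuous (fun p : R * R => (weight p)^-1).
Proof. by apply: contV; [exact: weight_neq0|exact: cont_weight]. Qed.

Lemma bc_x_winv : bc (fun p : R * R => p.1 * (weight p)^-1).
Proof.
split; first by apply: contM; [exact: cont_fst|exact: cont_winv].
exists 1 => p; rewrite normrM [`|_^-1|]ger0_norm ?winv_ge0// ler_pdivrMr ?weight_gt0// mul1r /weight.
have := real_normK (num_real p.1); have := normr_ge0 p.1; have := sqr_ge0 p.2; nra.
Qed.

Lemma bc_y_winv : bc (fun p : R * R => p.2 * (weight p)^-1).
Proof.
split; first by apply: contM; [exact: cont_snd|exact: cont_winv].
exists 1 => p; rewrite normrM [`|_^-1|]ger0_norm ?winv_ge0// ler_pdivrMr ?weight_gt0// mul1r /weight.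
have := real_normK (num_real p.2); have := normr_ge0 p.2; have := sqr_ge0 p.1; nra.
Qed.

Lemma is_derive_sqr (x c : R) : is_derive x 1 (fun t => c + t ^+ 2) (2 * x).
Proof.
have := is_derive_add (is_derive_cst1 x c) (is_derive_mul (is_derive_id1 x) (is_derive_id1 x)).
under [fun t => _]eq_fun do rewrite -expr2.
by move=> h; apply: is_derive_eq; ring.
Qed.

Lemma partial1_winv : partial1 (fun p : R * R => (weight p)^-1) (fun p => - (2 * p.1) * (weight p)^-1 ^+ 2).
Proof.
move=> x y; have w0 := weight_neq0 (x, y); rewrite weight_pair1 in w0.
have := is_derive_inv (f := fun t => 1 + y ^+ 2 + t ^+ 2) w0 (is_derive_sqr x (1 + y ^+ 2)).
under [fun t => _]eq_fun do rewrite -weight_pair1.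
by move=> h; apply: is_derive_eq; rewrite /= weight_pair1 exprVn.
Qed.

Lemma partial2_winv : partial2 (fun p : R * R => (weight p)^-1) (fun p => - (2 * p.2) * (weight p)^-1 ^+ 2).
Proof.
move=> x y; have w0 := weight_neq0 (x, y); rewrite weight_pair2 in w0.
have := is_derive_inv (f := fun t => 1 + x ^+ 2 + t ^+ 2) w0 (is_derive_sqr y (1 + x ^+ 2)).
under [fun t => _]eq_fun do rewrite -weight_pair2.
by move=> h; apply: is_derive_eq; rewrite /= weight_pair2 exprVn.
Qed.

Lemma is_derive_kap (c x : R) : 0 < c -> is_derive x 1 (fun t => ((c + t ^+ 2) * Num.sqrt (c + t ^+ 2))^-1)
  (- (3 * x) * (c + x ^+ 2)^-1 * ((c + x ^+ 2) * Num.sqrt (c + x ^+ 2))^-1).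
Proof.
move=> c0; have w0 : 0 < c + x ^+ 2 by rewrite ltr_wpDr ?sqr_ge0.
have s0 : 0 < Num.sqrt (c + x ^+ 2) by rewrite sqrtr_gt0.
have ds := is_derive_sqrt (f := fun t => c + t ^+ 2) w0 (is_derive_sqr x c).
have wn : (c + x ^+ 2) * Num.sqrt (c + x ^+ 2) != 0 by rewrite mulf_neq0// gt_eqF.
have := is_derive_inv (f := fun t => (c + t ^+ 2) * Num.sqrt (c + t ^+ 2)) wn (is_derive_mul (is_derive_sqr x c) ds).
move=> h; apply: is_derive_eq.
have e := sqr_sqrtr (ltW w0); move: s0 e; set u := Num.sqrt _ => s0 e.
rewrite -e; field; rewrite gt_eqF//.
Qed.

Lemma partial1_kap : partial1 (@kap R) (fun p => - (3 * p.1) * (weight p)^-1 * kap p).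
Proof.
move=> x y; have c0 : 0 < 1 + y ^+ 2 by rewrite ltr_wpDr ?sqr_ge0.
have := is_derive_kap x c0.
under [fun t => _]eq_fun do rewrite -weight_pair1.
by move=> h; apply: is_derive_eq; rewrite /= /kap weight_pair1.
Qed.

Lemma partial2_kap : partial2 (@kap R) (fun p => - (3 * p.2) * (weight p)^-1 * kap p).
Proof.
move=> x y; have c0 : 0 < 1 + x ^+ 2 by rewrite ltr_wpDr ?sqr_ge0.
have := is_derive_kap y c0.
under [fun t => _]eq_fun do rewrite -weight_pair2.
by move=> h; apply: is_derive_eq; rewrite /= /kap weight_pair2.
Qed.

Lemma partial1M f g fx gx : partial1 f fx -> partial1 g gx -> partial1 (fun p => f p * g p) (fun p => fx p * g p + f p * gx p).
Proof. by move=> df dg x y; exact: is_derive_mul. Qed.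

Lemma partial2M f g fx gx : partial2 f fx -> partial2 g gx -> partial2 (fun p => f p * g p) (fun p => fx p * g p + f p * gx p).
Proof. by move=> df dg x y; exact: is_derive_mul. Qed.

Lemma partial1_x : partial1 (fun p : R * R => p.1) (fun=> 1).
Proof. by move=> x y; exact: is_derive_id1. Qed.

Lemma partial2_y : partial2 (fun p : R * R => p.2) (fun=> 1).
Proof. by move=> x y; exact: is_derive_id1. Qed.

Lemma norm1_sqrt_weight p : `|p.1| <= Num.sqrt (weight p).
Proof. by apply: sqr_le_sqrt; rewrite /weight; have := sqr_ge0 p.2; lra. Qed.

Lemma norm2_sqrt_weight p : `|p.2| <= Num.sqrt (weight p).
Proof. by apply: sqr_le_sqrt; rewrite /weight; have := sqr_ge0 p.1; lra. Qed.

Lemma sqrt_weight_kap p : Num.sqrt (weight p) * kap p = (weight p)^-1.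
Proof.
rewrite /kap invfM mulrCA divff ?mulr1//.
by rewrite gt_eqF// (lt_le_trans ltr01 (sqrt_weight_ge1 p)).
Qed.

Lemma sqrt_weight_winv2 p : Num.sqrt (weight p) * (weight p)^-1 ^+ 2 = kap p.
Proof.
rewrite -sqrt_weight_kap exprMn expr2 -!mulrA.
have -> : Num.sqrt (weight p) * (Num.sqrt (weight p) * (Num.sqrt (weight p) * kap p ^+ 2)) =
  Num.sqrt (weight p) ^+ 2 * (Num.sqrt (weight p) * kap p) * kap p by ring.
by rewrite sqrt_weight_kap sqr_sqrtr ?(ltW (weight_gt0 p))// divff ?weight_neq0 ?mul1r.
Qed.

Lemma winv_le_sqrt p : (weight p)^-1 <= (Num.sqrt (weight p))^-1.
Proof.
have s1 := sqrt_weight_ge1 p; have s0 := lt_le_trans ltr01 s1.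
rewrite lef_pV2 ?posrE ?weight_gt0// -[leRHS](sqr_sqrtr (ltW (weight_gt0 p))) expr2.
by rewrite ler_peMl// ltW.
Qed.

Lemma PI_kap : PI (@kap R).
Proof. by split; [exact: cont_kap|exists 1 => p; rewrite mul1r gtr0_norm ?kap_gt0]. Qed.

Lemma bc_PI_kap f : bc f -> PI (fun p => f p * kap p).
Proof. by move=> [cf [B fB]]; under eq_fun do rewrite mulrC; exact: PIM PI_kap cf fB. Qed.

Lemma Dplane_int_mu f : bc f -> Dplane (fun p => f p * (weight p)^-1 ^+ 2) = pi * int_mu f.
Proof. by move=> bf; rewrite int_muE ?mulVKf ?gt_eqF ?pi_gt0//; exact: bc_PI. Qed.

Definition Jn fx fy := int_mu (fun p => weight p * (`|fx p| + `|fy p|)).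

Section Sobolev.
Variables f fx fy : R * R -> R.
Hypothesis tf : tameR f fx fy.
Hypothesis f0 : forall p, 0 <= f p.

Let bf : bc f. Proof. by have [] := tf. Qed.

Let bx : bc (fun p => weight p * fx p). Proof. by have [] := tf. Qed.

Let b_y : bc (fun p => weight p * fy p). Proof. by have [] := tf. Qed.

Let bnx : bc (fun p => weight p * `|fx p|).
Proof. by have := bc_norm bx; congr bc; apply/funext => p; rewrite normrM [`|weight p|]gtr0_norm ?weight_gt0. Qed.

Let bny : bc (fun p => weight p * `|fy p|).
Proof. by have := bc_norm b_y; congr bc; apply/funext => p; rewrite normrM [`|weight p|]gtr0_norm ?weight_gt0. Qed.

Let cx : continuous fx. Proof. by case: bx => /cont_div_weight. Qed.

Let cy : continuous fy. Proof. by case: b_y => /cont_div_weight. Qed.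

Lemma Jn_split : Jn fx fy = int_mu (fun p => weight p * `|fx p|) + int_mu (fun p => weight p * `|fy p|).
Proof. by rewrite -int_muD//; congr int_mu; apply/funext => p; rewrite mulrDr. Qed.

Let kw p : kap p <= (weight p)^-1.
Proof. by rewrite -sqrt_weight_kap ler_peMl// ?sqrt_weight_ge1// ltW// kap_gt0. Qed.

Let xkap p : `|p.1| * kap p <= (weight p)^-1.
Proof. by rewrite -sqrt_weight_kap ler_wpM2r ?(ltW (kap_gt0 _))// norm1_sqrt_weight. Qed.

Let ykap p : `|p.2| * kap p <= (weight p)^-1.
Proof. by rewrite -sqrt_weight_kap ler_wpM2r ?(ltW (kap_gt0 _))// norm2_sqrt_weight. Qed.

Let bx2 : bc (fun p : R * R => p.1 ^+ 2 * (weight p)^-1).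
Proof.
split; first by apply: contM; [apply: contX; exact: cont_fst|exact: cont_winv].
exists 1 => p.
have h : 0 <= p.1 ^+ 2 * (weight p)^-1 by rewrite mulr_ge0 ?sqr_ge0 ?winv_ge0.
by rewrite (ger0_norm h) ler_pdivrMr ?weight_gt0// mul1r /weight; have := sqr_ge0 p.2; lra.
Qed.

Let by2 : bc (fun p : R * R => p.2 ^+ 2 * (weight p)^-1).
Proof.
split; first by apply: contM; [apply: contX; exact: cont_snd|exact: cont_winv].
exists 1 => p.
have h : 0 <= p.2 ^+ 2 * (weight p)^-1 by rewrite mulr_ge0 ?sqr_ge0 ?winv_ge0.
by rewrite (ger0_norm h) ler_pdivrMr ?weight_gt0// mul1r /weight; have := sqr_ge0 p.1; lra.
Qed.

(** [kap] is not dominated by the density w^-2 of mu. The field p [kap] has divergence - [kap] + 3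
    [kap] / w, so integrating the divergence of p [kap] f replaces the integral of f [kap] by one
    with weight [kap] / w <= w^-2 and one of the gradient, where |p| [kap] <= 1 / w. *)
Lemma kap_bound : Dplane (fun p => f p * kap p) <= pi * (3 * int_mu f + Jn fx fy).
Proof.
have [d1 d2 _ _ _] := tf; have [cf [B fB]] := bf.
have P1 := partial1M (partial1M partial1_x partial1_kap) d1.
have P2 := partial2M (partial2M partial2_y partial2_kap) d2.
have wV p : weight p * (weight p)^-1 = 1 by rewrite divff ?weight_neq0.
have B1 : bc (fun p => f p * (1 - 3 * (p.1 ^+ 2 * (weight p)^-1)) + p.1 * (weight p)^-1 * (weight p * fx p)).
  apply: bcD; last by apply: bcM => //; exact: bc_x_winv.
  by apply: bcM => //; apply: bcB; [exact: bc_cst|exact: bcZ].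
have B2 : bc (fun p => f p * (1 - 3 * (p.2 ^+ 2 * (weight p)^-1)) + p.2 * (weight p)^-1 * (weight p * fy p)).
  apply: bcD; last by apply: bcM => //; exact: bc_y_winv.
  by apply: bcM => //; apply: bcB; [exact: bc_cst|exact: bcZ].
have {}B1 := bc_PI_kap B1; have {}B2 := bc_PI_kap B2.
have E1 : (fun p : R * R => (1 * kap p + p.1 * (- (3 * p.1) * (weight p)^-1 * kap p)) * f p + p.1 * kap p * fx p) =
  fun p => (f p * (1 - 3 * (p.1 ^+ 2 * (weight p)^-1)) + p.1 * (weight p)^-1 * (weight p * fx p)) * kap p.
  by apply/funext => p; have := wV p; set u := (weight p)^-1 => uw; ring: uw.
have E2 : (fun p : R * R => (1 * kap p + p.2 * (- (3 * p.2) * (weight p)^-1 * kap p)) * f p + p.2 * kap p * fy p) =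
  fun p => (f p * (1 - 3 * (p.2 ^+ 2 * (weight p)^-1)) + p.2 * (weight p)^-1 * (weight p * fy p)) * kap p.
  by apply/funext => p; have := wV p; set u := (weight p)^-1 => uw; ring: uw.
rewrite E1 in P1; rewrite E2 in P2.
have dec (g : R * R -> R) : (forall p, `|g p| * kap p <= (weight p)^-1) -> decay (fun p => g p * kap p * f p).
  move=> gk; exists B => p; rewrite 2!normrM [`|kap p|]gtr0_norm ?kap_gt0// mulrC.
  by apply: ler_pM => //; [rewrite mulr_ge0// ltW// kap_gt0|exact: le_trans (gk p) (winv_le_sqrt p)].
have I1 := Dplane_partial1 P1 (dec _ xkap) B1; have I2 := Dplane_partial2 P2 (dec _ ykap) B2.
have pfk := bc_PI_kap bf.
have := DplaneD B1 B2; rewrite I1 I2 addr0 => I0.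
rewrite -[leLHS]addr0 -I0 -DplaneD//; last exact: PID.
have bJ : bc (fun p => weight p * (`|fx p| + `|fy p|)).
  by have := bcD bnx bny; congr bc; apply/funext => p; rewrite mulrDr.
have b3 : bc (fun p => 3 * f p + weight p * (`|fx p| + `|fy p|)) by apply: bcD => //; exact: bcZ.
rewrite /Jn -int_muZ// -int_muD//; last exact: bcZ.
rewrite -Dplane_int_mu//; apply: Dplane_le; [by apply: PID => //; exact: PID|exact: bc_PI|].
move=> p; have := wV p; have := xkap p; have := ykap p; have := kw p; have := winv_ge0 p; have := f0 p.
have : weight p = 1 + (p.1 ^+ 2 + p.2 ^+ 2) by [].
have := kap_gt0 p.
move: (weight p) (weight p)^-1 (kap p) (f p) (fx p) (fy p) p.1 p.2 => w v k F X Y x y k0 we F0 v0 kv yk xk wv.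
have {}we : x ^+ 2 = w - 1 - y ^+ 2 by rewrite we; ring.
have -> : F * k + ((F * (1 - 3 * (x ^+ 2 * v)) + x * v * (w * X)) * k + (F * (1 - 3 * (y ^+ 2 * v)) + y * v * (w * Y)) * k)
  = 3 * F * v * k + x * k * X + y * k * Y.
  apply/eqP; rewrite -subr_eq0; apply/eqP.
  transitivity ((x * X * k + y * Y * k - 3 * F * k) * (w * v - 1) - 3 * F * k * v * (x ^+ 2 - (w - 1 - y ^+ 2))); first by ring.
  by rewrite wv we !subrr !mulr0 subrr.
have -> : (3 * F + w * (`|X| + `|Y|)) * v ^+ 2 = 3 * F * v * v + v * `|X| + v * `|Y| by ring: wv.
have aux (a b c : R) : `|a| * k <= v -> a * k * b <= v * `|b|.
  move=> ak; apply: le_trans (ler_norm _) _; rewrite !normrM (gtr0_norm k0).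
  by rewrite ler_wpM2r.
apply: lerD; last exact: aux. apply: lerD; last exact: aux.
by rewrite ler_wpM2l// !mulr_ge0.
Qed.

(** Gagliardo-Nirenberg for f / w, whose squared planar integral is pi times that of f^2 against mu.
    Differentiating 1 / w costs 2 |x| / w^2 <= 2 [kap], hence the need for [kap_bound]. *)
Lemma sobolev : int_mu (fun p => f p ^+ 2) <= pi * (6 * int_mu f + 3 * Jn fx fy) ^+ 2.
Proof.
have [d1 d2 _ _ _] := tf; have [cf [B fB]] := bf.
have P1 := partial1M partial1_winv d1.
have P2 := partial2M partial2_winv d2.
have wV p : weight p * (weight p)^-1 = 1 by rewrite divff ?weight_neq0.
have gl : bc (fun p => 2 * f p) by exact: bcZ.
have xk (a : R) p : `|a| <= Num.sqrt (weight p) -> `|a| * (weight p)^-1 ^+ 2 <= kap p.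
  by move=> h; rewrite -sqrt_weight_winv2 ler_wpM2r// exprn_ge0// winv_ge0.
have aux (a X : R) p : `|a| <= Num.sqrt (weight p) -> `|- (2 * a) * (weight p)^-1 ^+ 2 * f p + (weight p)^-1 * X| <=
    2 * f p * kap p + weight p * `|X| * (weight p)^-1 ^+ 2.
  move=> /xk ak; apply: le_trans (ler_normD _ _) _; apply: lerD.
    rewrite normrM normrM normrN normrM (ger0_norm (f0 p)) [`|_ ^+ 2|]ger0_norm ?exprn_ge0 ?winv_ge0//.
    rewrite ger0_norm// mulrAC -[leLHS]mulrA -[leLHS]mulrA -[leRHS]mulrA ler_wpM2l// [leLHS]mulrCA ler_wpM2l//.
  rewrite normrM (ger0_norm (winv_ge0 _)) expr2 le_eqVlt; apply/orP; left; apply/eqP.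
  by have := wV p; move: (weight p) (weight p)^-1 `|X| => w v n h; ring: h.
have X1 p := aux p.1 (fx p) p (norm1_sqrt_weight p).
have X2 p := aux p.2 (fy p) p (norm2_sqrt_weight p).
have R1 : PI (fun p => 2 * f p * kap p + weight p * `|fx p| * (weight p)^-1 ^+ 2).
  by apply: PID; [exact: bc_PI_kap|exact: bc_PI].
have R2 : PI (fun p => 2 * f p * kap p + weight p * `|fy p| * (weight p)^-1 ^+ 2).
  by apply: PID; [exact: bc_PI_kap|exact: bc_PI].
have Q1 : PI (fun p => - (2 * p.1) * (weight p)^-1 ^+ 2 * f p + (weight p)^-1 * fx p).
  apply: (PI_dom _ R1); last by move=> p; apply: le_trans (X1 p) (ler_norm _).
  apply: contD; apply: contM => //; last exact: cont_winv.
  apply: contM; last by apply: contX; exact: cont_winv.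
  by apply: contN; apply: contM; [exact: cont_cst|exact: cont_fst].
have Q2 : PI (fun p => - (2 * p.2) * (weight p)^-1 ^+ 2 * f p + (weight p)^-1 * fy p).
  apply: (PI_dom _ R2); last by move=> p; apply: le_trans (X2 p) (ler_norm _).
  apply: contD; apply: contM => //; last exact: cont_winv.
  apply: contM; last by apply: contX; exact: cont_winv.
  by apply: contN; apply: contM; [exact: cont_cst|exact: cont_snd].
have cg : continuous (fun p => (weight p)^-1 * f p) by apply: contM => //; exact: cont_winv.
have dg : decay (fun p => (weight p)^-1 * f p).
  exists B => p; rewrite normrM ger0_norm ?winv_ge0// mulrC.
  by apply: ler_pM => //; rewrite ?winv_ge0 ?winv_le_sqrt.
have G := gagliardo_nirenberg P1 P2 cg dg Q1 Q2.
have -> : int_mu (fun p => f p ^+ 2) = pi^-1 * Dplane (fun p => ((weight p)^-1 * f p) ^+ 2).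
  rewrite int_muE; last by apply: bc_PI; exact: bcX.
  by congr (_ * Dplane _); apply/funext => p; rewrite exprMn mulrC.
have K0 := kap_bound.
have PB (h g : R * R -> R) : PI h -> (forall p, `|h p| <= 2 * f p * kap p + weight p * `|g p| * (weight p)^-1 ^+ 2) ->
  bc (fun p => weight p * `|g p|) -> int_mu (fun p => weight p * `|g p|) <= Jn fx fy ->
  Dplane (fun p => `|h p|) <= pi * (6 * int_mu f + 3 * Jn fx fy).
  move=> ph hh bg gJ.
  have p1 : PI (fun p => f p * kap p) by exact: bc_PI_kap.
  have p2 : PI (fun p => 2 * (f p * kap p)) by exact: PIZ.
  have p3 : PI (fun p => weight p * `|g p| * (weight p)^-1 ^+ 2) by exact: bc_PI.
  apply: (@le_trans _ _ (Dplane (fun p => 2 * (f p * kap p) + weight p * `|g p| * (weight p)^-1 ^+ 2))).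
    apply: Dplane_le; [exact: PI_norm|exact: PID|].
    by move=> p; rewrite mulrA.
  rewrite DplaneD// DplaneZ// Dplane_int_mu//.
  have := ler_wpM2l (pi_ge0 R) gJ; move: K0; rewrite mulrDr mulrDr mulrCA [pi * (6 * _)]mulrCA [pi * (3 * _)]mulrCA; lra.
have x0 : 0 <= int_mu (fun p => weight p * `|fx p|).
  by apply: int_mu_ge0 => // p; rewrite mulr_ge0// ltW// weight_gt0.
have y0 : 0 <= int_mu (fun p => weight p * `|fy p|).
  by apply: int_mu_ge0 => // p; rewrite mulr_ge0// ltW// weight_gt0.
have A1 := PB _ _ Q1 X1 bnx ltac:(rewrite Jn_split lerDl; exact: y0).
have A2 := PB _ _ Q2 X2 bny ltac:(rewrite Jn_split lerDr; exact: x0).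
rewrite mulrC ler_pdivrMr ?pi_gt0//; apply: le_trans G _.
rewrite -mulrA [_ ^+ 2 * _]mulrC mulrA -expr2 -exprMn expr2; apply: ler_pM => //; apply: Dplane_ge0 => p; exact: normr_ge0.
Qed.
End Sobolev.

Lemma cauchy_schwarz f g : bc f -> bc g ->
  int_mu (fun p => f p * g p) ^+ 2 <= int_mu (fun p => f p ^+ 2) * int_mu (fun p => g p ^+ 2).
Proof.
move=> bf bg; have bfg := bcM bf bg; have bf2 := bcX 2 bf; have bg2 := bcX 2 bg.
set a := int_mu (fun p => f p ^+ 2); set b := int_mu (fun p => f p * g p); set c := int_mu (fun p => g p ^+ 2).
have q t : 0 <= a - 2 * t * b + t ^+ 2 * c.
  have : 0 <= int_mu (fun p => f p ^+ 2 - 2 * t * (f p * g p) + t ^+ 2 * g p ^+ 2).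
    apply: int_mu_ge0; first by apply: bcD; [apply: bcB => //; exact: bcZ|exact: bcZ].
    by move=> p; have := sqr_ge0 (f p - t * g p); congr (_ <= _); ring.
  rewrite int_muD ?int_muB ?int_muZ//; try exact: bcZ.
  by apply: bcB => //; exact: bcZ.
have c0 : 0 <= c by apply: int_mu_ge0 => // p; exact: sqr_ge0.
have a0 : 0 <= a by apply: int_mu_ge0 => // p; exact: sqr_ge0.
move: c0; rewrite le_eqVlt => /predU1P[c0|c0].
  have [b0|b0] := eqVneq b 0; first by rewrite b0 expr0n/= mulr_ge0// -c0.
  (* If c = 0 and b is nonzero, this t makes the quadratic form equal to a - (a + 1) = -1. *)
  have := q ((a + 1) / (2 * b)); rewrite -c0 mulr0 addr0.
  have -> : 2 * ((a + 1) / (2 * b)) * b = a + 1 by field.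
  by lra.
have := q (b / c).
have -> : a - 2 * (b / c) * b + (b / c) ^+ 2 * c = (a * c - b ^+ 2) / c by field; rewrite gt_eqF.
by rewrite pmulr_lge0 ?invr_gt0// subr_ge0.
Qed.

Lemma bc_DirR f fx fy : tameR f fx fy -> bc (fun p => (weight p / 2) ^+ 2 * (fx p ^+ 2 + fy p ^+ 2)).
Proof.
move=> [_ _ _ bx b_y].
by have := bcZ (2^-1 ^+ 2) (bcD (bcX 2 bx) (bcX 2 b_y)); congr bc; apply/funext => p; ring.
Qed.

Lemma DirR_ge0 f fx fy : tameR f fx fy -> 0 <= DirR fx fy.
Proof. by move=> tf; apply: int_mu_ge0 (bc_DirR tf) _ => p; rewrite mulr_ge0 ?sqr_ge0 ?addr_ge0 ?sqr_ge0. Qed.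

Lemma Mo00 f : bc f -> Mo 0 (fun p => (f p)%:C) 0 0 = (int_mu f)%:C.
Proof.
move=> bf; rewrite int_muE ?rcM -?cD_R; last exact: bc_PI.
rewrite /Mo /mom; congr (_ * cD _); apply/funext => p.
by rewrite /mono !expr0 !mul1r rcM.
Qed.

(** The case n = 0 of [sqr_gap], since Q_0(f) is the square of the mean. *)
Lemma poincare f fx fy : tameR f fx fy -> int_mu f = 0 -> int_mu (fun p => f p ^+ 2) <= DirR fx fy.
Proof.
move=> tf f0; have bf : bc f by case: tf.
have := sqr_gap 0 (tameR_tame tf) bf; rewrite (Dir_DirR tf) => h; apply: le_trans h _.
have -> : Qn 0 (fun p => (f p)%:C) = 0.
  rewrite /Qn /qC !big_ord1 /=.
  by rewrite Mo00// f0 nrm2R expr0n/= !mulr0.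
rewrite add0r ler_piMl ?(DirR_ge0 tf)//.
by rewrite invr1 gerBl divr_ge0// ?mulr_ge0// ltW// gape_gt0.
Qed.

Section WeakMT.
Variables (f fx fy : R * R -> R) (s : nat).
Hypothesis tf : tameR f fx fy.
Hypothesis f0 : int_mu f = 0.
Hypothesis s0 : (0 < s)%N.
Let D := DirR fx fy.
Hypothesis sD : 352 * s%:R ^+ 2 * D <= 1.

Let bf : bc f. Proof. by have [] := tf. Qed.

Let bx : bc (fun p => weight p * fx p). Proof. by have [] := tf. Qed.

Let b_y : bc (fun p => weight p * fy p). Proof. by have [] := tf. Qed.

Let c : R := s%:R / 2.
Let F p := chh (c * f p) - 1.
Let Sh p := shh (c * f p).
Let U := int_mu (fun p => 4 * Sh p ^+ 2).

Let c_ge0 : 0 <= c. Proof. by rewrite divr_ge0. Qed.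

Let bSh : bc Sh.
Proof. by apply: (bc_comp (h := shh)) (bcZ c bf); exact: is_derive_continuous is_derive_shh. Qed.

Let bF : bc F.
Proof. by apply: bcB (bc_cst 1); apply: (bc_comp (h := chh)) (bcZ c bf); exact: is_derive_continuous is_derive_chh. Qed.

Let tF : tameR F (fun p => Sh p * (c * fx p)) (fun p => Sh p * (c * fy p)).
Proof.
have [d1 d2 _ _ _] := tf.
have chain (u : R -> R) (t a : R) : is_derive t 1 u a -> is_derive t 1 (fun r => chh (c * u r) - 1) (shh (c * u t) * (c * a)).
  move=> du; have dc := is_derive_mul (is_derive_cst1 t c) du.
  have := is_derive_sub (is_derive1_comp (f := chh) (g := fun r => c * u r) (is_derive_chh (c * u t)) dc) (is_derive_cst1 t 1).
  by move=> h; apply: is_derive_eq; rewrite /GRing.scale /=; ring.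
split.
- by move=> x y; exact: (chain (fun t => f (t, y))).
- by move=> x y; exact: (chain (fun t => f (x, t))).
- exact: bF.
- by have := bcM bSh (bcZ c bx); congr bc; apply/funext => p; ring.
- by have := bcM bSh (bcZ c b_y); congr bc; apply/funext => p; ring.
Qed.

Let D0 : 0 <= D. Proof. exact: DirR_ge0 tf. Qed.

Let bU : bc (fun p => 4 * Sh p ^+ 2). Proof. by apply: bcZ; exact: bcX. Qed.

Let U_ge0 : 0 <= U.
Proof. by apply: int_mu_ge0 => // p; rewrite mulr_ge0 ?sqr_ge0. Qed.

Let U4 : int_mu (fun p => Sh p ^+ 2) = U / 4.
Proof. by rewrite /U int_muZ; [field|exact: bcX]. Qed.

Let j := Jn (fun p => Sh p * (c * fx p)) (fun p => Sh p * (c * fy p)).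
Let l := int_mu F.

(** The gradient of [F] is c sinh(c f) times that of f, and Cauchy-Schwarz separates the two
    factors; the 8 is 2 for (|a| + |b|)^2 <= 2 (a^2 + b^2) times 4 for the weight (w / 2)^2. *)
Let j2 : j ^+ 2 <= s%:R ^+ 2 * U * D / 2.
Proof.
have bnx := bc_norm bx; have bny := bc_norm b_y.
have wn p (a : R) : `|weight p * a| = weight p * `|a| by rewrite normrM gtr0_norm ?weight_gt0.
have b3 : bc (fun p => weight p * (`|fx p| + `|fy p|)).
  by have := bcD bnx bny; congr bc; apply/funext => p; rewrite !wn mulrDr.
have bnS := bc_norm bSh.
have -> : j = c * int_mu (fun p => `|Sh p| * (weight p * (`|fx p| + `|fy p|))).
  rewrite -int_muZ; last exact: bcM.
  congr int_mu; apply/funext => p; rewrite 2!(normrM (Sh p)) 2!(normrM c) (ger0_norm c_ge0); ring.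
have h1 := cauchy_schwarz bnS b3.
have h2 : int_mu (fun p => `|Sh p| ^+ 2) = U / 4.
  by rewrite -U4; congr int_mu; apply/funext => p; rewrite real_normK ?num_real.
have h3 : int_mu (fun p => (weight p * (`|fx p| + `|fy p|)) ^+ 2) <= 8 * D.
  rewrite /D /DirR -int_muZ; last exact: bc_DirR tf.
  apply: int_mu_le; [exact: bcX|by apply: bcZ; exact: bc_DirR tf|].
  move=> p; rewrite exprMn -[fx p ^+ 2]real_normK ?num_real// -[fy p ^+ 2]real_normK ?num_real//.
  have := mulr_ge0 (sqr_ge0 (weight p)) (sqr_ge0 (`|fx p| - `|fy p|)).
  rewrite -subr_ge0 => h; rewrite -subr_ge0; by apply: le_trans h _; rewrite le_eqVlt; apply/orP; left; apply/eqP; field.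
rewrite exprMn; rewrite h2 in h1.
have := ler_wpM2l (sqr_ge0 c) (le_trans h1 (ler_wpM2l (divr_ge0 U_ge0 (ler0n _ 4)) h3)).
by congr (_ <= _); rewrite /c; field.
Qed.

(** From cosh x - 1 <= x sinh x / 2, Cauchy-Schwarz and the Poincare inequality for f. *)
Let l2 : l ^+ 2 <= s%:R ^+ 2 * U * D / 64.
Proof.
have l0 : 0 <= l by apply: int_mu_ge0 => // p; exact: chh_ge1.
have bfS := bcM bf bSh.
have h1 : l <= 2^-1 * c * int_mu (fun p => f p * Sh p).
  rewrite -int_muZ//; apply: int_mu_le => //; first exact: bcZ.
  by move=> p; have := chh_le (c * f p); rewrite -/(Sh p) !mulrA.
have h2 : l ^+ 2 <= (2^-1 * c) ^+ 2 * int_mu (fun p => f p * Sh p) ^+ 2.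
  by rewrite -exprMn lerXn2r// ?nnegrE// (le_trans l0).
have h3 := cauchy_schwarz bf bSh; rewrite U4 in h3.
have h4 := le_trans h3 (ler_wpM2r (divr_ge0 U_ge0 (ler0n _ 4)) (poincare tf f0)).
apply: le_trans h2 _; have := ler_wpM2l (sqr_ge0 (2^-1 * c)) h4.
by congr (_ <= _); rewrite /c -/D; field.
Qed.

Let U_eq : U = 4 * int_mu (fun p => F p ^+ 2) + 8 * l.
Proof.
have bF2 := bcX 2 bF.
rewrite /l -!int_muZ// -int_muD; [|exact: bcZ|exact: bcZ].
by congr int_mu; apply/funext => p; rewrite /Sh shh2 /F; ring.
Qed.

(** By [sobolev], the integral of [F]^2 is at most a constant times s^2 D U. For small s^2 D this
    part of [U_eq] is absorbed into U, leaving U <= 16 l; as l^2 is itself linear in U, one factor U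
    can be divided out. *)
Lemma shh_int_le : U <= 4 * s%:R ^+ 2 * D.
Proof.
have h1 := sobolev tF (fun p => chh_ge1 _).
have pi4 : pi <= 4 :> R by have /andP[_ h] := @pihalf_02 R; lra.
move: h1 U_eq j2 l2 sD D0 U_ge0; rewrite -/j -/l.
set q := int_mu _; move: (s%:R ^+ 2) (sqr_ge0 (s%:R : R)) => S S0.
move: (pi_ge0 R) pi4 => pi0 pi4.
move=> h1 Ue hj hl hS hD hU.
(* With pi <= 4 and the bounds on j^2 and l^2, the constant is 4 (72 / 64 + 18 / 2) = 40.5. *)
have h2 : q <= 41 * (S * U * D).
  apply: le_trans h1 _; apply: (@le_trans _ _ (4 * (72 * l ^+ 2 + 18 * j ^+ 2))).
    apply: ler_pM => //; first exact: sqr_ge0.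
    by have := sqr_ge0 (6 * l - 3 * j); nra.
  have : 0 <= S * U * D by rewrite !mulr_ge0.
  by lra.
(* This needs 8 * 41 = 328 times s^2 D to be at most 1; the hypothesis has 352. *)
have h3 : 4 * q <= U / 2.
  have := ler_wpM2r hU hS; nra.
have h4 : U <= 16 * l by lra.
have h5 : U ^+ 2 <= 4 * S * D * U.
  apply: (@le_trans _ _ ((16 * l) ^+ 2)); last by rewrite exprMn; nra.
  by rewrite lerXn2r// ?nnegrE// (le_trans hU).
move: hU; rewrite le_eqVlt => /predU1P[<-|U0]; first by rewrite !mulr_ge0.
by rewrite -(ler_pM2r U0) -expr2.
Qed.

Lemma int_r3_le : int_mu (fun p => r3 (f p)) <= 4 * D / s%:R.
Proof.
have sp : 0 < s%:R :> R by rewrite ltr0n.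
have br : bc (fun p => r3 (f p)).
  apply: (bc_comp (h := @r3 R)) => //; rewrite /r3.
  have ci : continuous (fun x : R => x) by move=> x; exact: cvg_id.
  apply: contB; last by apply: contM; [exact: contX|exact: cont_cst].
  by apply: contB => //; apply: contB; [exact: continuous_expR|exact: cont_cst].
apply: (@le_trans _ _ ((s%:R ^+ 3)^-1 * U)).
  rewrite -int_muZ//; apply: int_mu_le => //; first exact: bcZ.
  by move=> p; have := r3_le (f p) s0; rewrite mulrAC.
apply: (@le_trans _ _ ((s%:R ^+ 3)^-1 * (4 * s%:R ^+ 2 * D))).
  by rewrite ler_wpM2l ?shh_int_le// invr_ge0 exprn_ge0// ltW.
by rewrite le_eqVlt; apply/orP; left; apply/eqP; field; rewrite gt_eqF.
Qed.
End WeakMT.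
End MT.

(** * Smooth functions on the sphere *)

Section Smooth.
Context {R : realType}.
Implicit Types (p q : R * R) (f : R * R -> R) (phi : @CP1 R -> R).

(** Contains the disc of radius 2. Inversion maps |p| >= 1/2 into that disc, so this one compact
    square controls both charts. *)
Definition box : set (R * R) := `[-2, 2]%classic `*` `[-2, 2]%classic.
Lemma boxE p : box p <-> `|p.1| <= 2 /\ `|p.2| <= 2.
Proof. by rewrite /box /= !in_itv /= !ler_norml; split=> -[-> ->]. Qed.

Lemma box_bounded f : continuous f -> exists2 B, 0 <= B & forall p, box p -> `|f p| <= B.
Proof.
move=> cf; have cb : compact box by apply: compact_setX; exact: segment_compact.
have [] := @compact_EVT_max _ R (fun p => `|f p|) box _ cb.
- by exists (0, 0); apply/boxE; rewrite normr0.
- by apply: continuous_subspaceT; exact: cont_norm.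
move=> c _ cM; exists `|f c| => // p pb; apply: cM; exact: mem_set.
Qed.

Definition C1 f := [/\ continuous f, forall p, derivable f p (1, 0) /\ derivable f p (0, 1),
  continuous (dx f) & continuous (dy f)].
Lemma smooth_C1 f : smooth f -> C1 f.
Proof. by move=> /(_ 1) [cf [d [[cx _] [cy _]]]]; split. Qed.

Lemma C1_partial1 f : C1 f -> partial1 f (dx f).
Proof.
move=> [_ d _ _] x y; have [d1 _] := d (x, y).
have E : (fun h : R => h^-1 *: (f (h *: (1, 0) + (x, y)) - f (x, y))) =
         (fun h : R => h^-1 *: (f (h *: 1 + x, y) - f (x, y))).
  apply/funext => h; congr (_ *: (f _ - _)).
  by transitivity (h * 1 + x, h * 0 + y); [|rewrite mulr0 add0r].
apply: DeriveDef; first by rewrite /derivable; move: d1; rewrite /derivable /= E.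
by rewrite /dx /derive /= E.
Qed.

Lemma C1_partial2 f : C1 f -> partial2 f (dy f).
Proof.
move=> [_ d _ _] x y; have [_ d1] := d (x, y).
have E : (fun h : R => h^-1 *: (f (h *: (0, 1) + (x, y)) - f (x, y))) =
         (fun h : R => h^-1 *: (f (x, h *: 1 + y) - f (x, y))).
  apply/funext => h; congr (_ *: (f _ - _)).
  by transitivity (h * 0 + x, h * 1 + y); [|rewrite mulr0 add0r].
apply: DeriveDef; first by rewrite /derivable; move: d1; rewrite /derivable /= E.
by rewrite /dy /derive /= E.
Qed.

Lemma lip_line (g g' : R -> R) (L a b : R) : (forall t : R, is_derive t 1 g (g' t)) ->
  `|a| <= 2 -> `|b| <= 2 -> (forall t, `|t| <= 2 -> `|g' t| <= L) -> `|g b - g a| <= L * `|b - a|.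
Proof.
move=> dg; have cg := is_derive_continuous dg.
wlog ab : a b / a <= b.
  move=> W a2 b2 gL; have [ab|ab] := leP a b; first exact: W.
  by rewrite distrC [`|b - a|]distrC; apply: W => //; exact: ltW.
move=> a2 b2 gL; have [t tab ->] := MVT_segment ab (fun t _ => dg t) (continuous_subspaceT cg).
rewrite normrM ler_wpM2r// gL//; move: tab a2 b2; rewrite in_itv /= !ler_norml; lra.
Qed.

Lemma lip_box f : C1 f -> exists2 L, 0 <= L & forall p q, box p -> box q -> `|f q - f p| <= L * (`|q.1 - p.1| + `|q.2 - p.2|).
Proof.
move=> cf; have [_ _ cx cy] := cf.
have [A A0 xA] := box_bounded cx; have [B B0 yB] := box_bounded cy.
exists (A + B); first exact: addr_ge0.
move=> [a b] [c d] /boxE /= [a2 b2] /boxE /= [c2 d2].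
rewrite -(subrKA (f (c, b))) mulrDr.
apply: le_trans (ler_normD _ _) _; rewrite addrC; apply: lerD.
  apply: (@le_trans _ _ (A * `|c - a|)); last by rewrite ler_wpM2r// lerDl.
  apply: (lip_line (g := fun t => f (t, b)) (g' := fun t => dx f (t, b))) => //.
    by move=> t; exact: (C1_partial1 cf).
  by move=> t t2; apply: xA; apply/boxE.
apply: (@le_trans _ _ (B * `|d - b|)); last by rewrite ler_wpM2r// lerDr.
apply: (lip_line (g := fun t => f (c, t)) (g' := fun t => dy f (c, t))) => //.
  by move=> t; exact: (C1_partial2 cf).
by move=> t t2; apply: yB; apply/boxE.
Qed.

Definition n2 p : R := p.1 ^+ 2 + p.2 ^+ 2.
Definition inv2 p : R * R := (p.1 / n2 p, - (p.2 / n2 p)).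
Lemma toC_inv2 p : toC (inv2 p) = (toC p)^-1.
Proof. by []. Qed.

Lemma toC_eq0 p : (toC p == 0) = (n2 p == 0).
Proof.
apply/eqP/eqP => [h|].
  have -> : n2 p = complex.Re (toC p) ^+ 2 + complex.Im (toC p) ^+ 2 by [].
  by rewrite h /= !expr0n addr0.
move/eqP; rewrite paddr_eq0 ?sqr_ge0// !sqrf_eq0 => /andP[/eqP a /eqP b].
by rewrite /toC a b.
Qed.

Lemma chart0_inv2 phi p : n2 p != 0 -> chart0 phi p = chartoo phi (inv2 p).
Proof.
move=> p0; rewrite /chart0 /chartoo toC_inv2 invr_eq0 toC_eq0 (negbTE p0).
by rewrite invrK.
Qed.

Lemma inv2_box p : 4^-1 <= n2 p -> box (inv2 p).
Proof.
move=> h; have n0 : 0 < n2 p by apply: lt_le_trans h.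
apply/boxE => /=; rewrite normrN !normrM normfV (gtr0_norm n0) !ler_pdivrMr//.
have s1 := sqr_ge0 p.1; have s2 := sqr_ge0 p.2.
have aux (t : R) : t ^+ 2 <= n2 p -> `|t| <= 2 * n2 p.
  move=> tn; rewrite -(ler_pXn2r (n := 2)) ?nnegrE ?mulr_ge0 ?(ltW n0)//.
  by rewrite real_normK ?num_real//; apply: le_trans tn _; rewrite exprMn; nra.
by split; apply: aux; rewrite /n2; lra.
Qed.

Lemma inv2_dist p q : n2 p != 0 -> n2 q != 0 ->
  ((inv2 q).1 - (inv2 p).1) ^+ 2 + ((inv2 q).2 - (inv2 p).2) ^+ 2 = ((q.1 - p.1) ^+ 2 + (q.2 - p.2) ^+ 2) / (n2 p * n2 q).
Proof.
by rewrite /inv2 /n2 /= => p0 q0; field; rewrite p0 q0.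
Qed.

(** Inversion multiplies the distance of p and q by 1 / (|p| |q|), so a Lipschitz bound in the chart
    at infinity yields the decay 1 / |p|^2 in the affine chart. *)
Lemma chart0_lip phi : C1 (chartoo phi) -> exists2 L, 0 <= L & forall p q h, 1 <= n2 p -> n2 p / 4 <= n2 q ->
  (q.1 - p.1) ^+ 2 + (q.2 - p.2) ^+ 2 = h ^+ 2 -> `|chart0 phi q - chart0 phi p| <= L * `|h| / n2 p.
Proof.
(* The two coordinate increments satisfy (|a| + |b|)^2 <= 2 (a^2 + b^2) <= 8 (h / |p|^2)^2, and 8 <=
   3^2. *)
move=> /lip_box [L L0 lL]; exists (3 * L); first by rewrite mulr_ge0.
move=> p q h np nq hh; have p0 : 0 < n2 p by lra. have q0 : 0 < n2 q by lra.
rewrite !chart0_inv2 ?gt_eqF//.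
apply: le_trans (lL _ _ _ _) _; [apply: inv2_box; lra|apply: inv2_box; lra|].
have := inv2_dist (lt0r_neq0 p0) (lt0r_neq0 q0); rewrite hh.
set a := _ - _; set b := _ - _ => ab.
have -> : 3 * L * `|h| / n2 p = L * (3 * (`|h| / n2 p)) by ring.
apply: ler_wpM2l => //.
have hn : 0 <= 3 * (`|h| / n2 p) by rewrite mulr_ge0// divr_ge0// ltW.
rewrite -(ler_pXn2r (n := 2)) ?nnegrE ?addr_ge0//.
have : (`|a| + `|b|) ^+ 2 <= 2 * (a ^+ 2 + b ^+ 2).
  by rewrite -[a ^+ 2]real_normK ?num_real// -[b ^+ 2]real_normK ?num_real//; have := sqr_ge0 (`|a| - `|b|); lra.
move/le_trans; apply; rewrite ab !exprMn real_normK ?num_real//.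
rewrite invfM mulrA.
have : (n2 q)^-1 <= 4 * (n2 p)^-1.
  by rewrite -[4]invrK -invfM lef_pV2 ?posrE ?mulr_gt0//; lra.
move=> /(ler_wpM2l (divr_ge0 (sqr_ge0 h) (ltW p0))).
have := sqr_ge0 (h / n2 p); rewrite expr2; move: (n2 p)^-1 (n2 q)^-1 => u v; nra.
Qed.

(** Bounding difference quotients gives the decay of the derivatives directly from [chart0_lip],
    without a chain rule for the inversion. *)
Lemma derive_bound (g : R -> R) (x d c : R) : is_derive x 1 g d -> (forall h, `|h| <= 4^-1 -> `|g (h + x) - g x| <= c * `|h|) ->
  `|d| <= c.
Proof.
move=> [dg <-] hc.
have hl : (fun h => `|h^-1 *: ((g \o shift x) (h *: 1) - g x)|) @ 0^' --> `|'D_1 g x|.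
  by apply: cvg_norm; exact: dg.
apply: (cvgr_to_le hl).
near=> h.
have h0 : h != 0 by near: h; exact: nbhs_dnbhs_neq.
have h4 : `|h| <= 4^-1.
  near: h; apply: nbhs_dnbhs; exists 4^-1 => [|t] /=; first by rewrite invr_gt0.
  by rewrite /ball_ /= sub0r normrN => /ltW.
have -> : (g \o shift x) (h *: 1) = g (h + x) by congr (g (_ + _)); exact: mulr1.
rewrite normrM normfV.
by rewrite mulrC ler_pdivrMr ?normr_gt0//; exact: hc.
Unshelve. all: by end_near.
Qed.

Lemma smooth_tameR phi : smooth_CP1 phi -> tameR (chart0 phi) (dx (chart0 phi)) (dy (chart0 phi)).
Proof.
move=> [/smooth_C1 c0 /smooth_C1 c1]; have [cf _ cx cy] := c0; have [cf1 _ _ _] := c1.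
have [L L0 lL] := chart0_lip c1.
have out p : ~ box p -> 1 <= n2 p.
  move=> nb; rewrite leNgt; apply/negP => n1; apply: nb; apply/boxE.
  have aux (t : R) : t ^+ 2 <= n2 p -> `|t| <= 2.
    by move=> tn; rewrite -(ler_pXn2r (n := 2)) ?nnegrE// real_normK ?num_real//; apply: le_trans tn _; lra.
  have s1 := sqr_ge0 p.1; have s2 := sqr_ge0 p.2.
  by split; apply: aux; rewrite /n2; lra.
(* Steps of length at most 1/4 keep |q|^2 >= |p|^2 / 4, the range in which [chart0_lip] applies. *)
have sl p h : 1 <= n2 p -> `|h| <= 4^-1 -> n2 p / 4 <= n2 (h + p.1, p.2) /\ n2 p / 4 <= n2 (p.1, h + p.2).
  move=> n1 h4; have hh : h ^+ 2 <= 4^-1 ^+ 2 by rewrite -[h ^+ 2]real_normK ?num_real// lerXn2r ?nnegrE.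
  have aux (a b : R) : 1 <= a ^+ 2 + b ^+ 2 -> (a ^+ 2 + b ^+ 2) / 4 <= (h + a) ^+ 2 + b ^+ 2.
    by move=> ab; have := sqr_ge0 (2 * h + a); have := sqr_ge0 b; lra.
  split; first exact: aux.
  by rewrite /n2 /= [leRHS]addrC [X in X / 4]addrC; apply: aux; rewrite addrC.
have wn p : 1 <= n2 p -> weight p <= 2 * n2 p by rewrite /weight /n2; lra.
split; [exact: C1_partial1|exact: C1_partial2|..].
- split => //; have [B B0 fB] := box_bounded cf; have [B' B'0 fB'] := box_bounded cf1.
  exists (B + B') => p; have [/fB h|/out h] := pselect (box p); first by rewrite ler_wpDr.
  rewrite chart0_inv2 ?gt_eqF//; last exact: lt_le_trans h.
  by rewrite ler_wpDl// fB'//; apply: inv2_box; lra.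
- have cw : continuous (fun p => weight p * dx (chart0 phi) p) by apply: contM; [exact: cont_weight|exact: cx].
  split => //; have [B B0 fB] := box_bounded cw; exists (B + 2 * L) => p.
  have [/fB h|/out h] := pselect (box p); first by rewrite ler_wpDr// mulr_ge0.
  rewrite ler_wpDl// normrM gtr0_norm ?weight_gt0//.
  have db : `|dx (chart0 phi) p| <= L / n2 p.
    have dp : is_derive p.1 1 (fun t => chart0 phi (t, p.2)) (dx (chart0 phi) p).
      by have := C1_partial1 c0 p.1 p.2; rewrite -surjective_pairing.
    apply: (derive_bound dp) => t t4; rewrite mulrAC -surjective_pairing.
    by apply: lL => //=; [case: (sl p t h t4)|ring].
  apply: le_trans (ler_wpM2l (ltW (weight_gt0 _)) db) _.
  rewrite mulrCA [2 * L]mulrC ler_wpM2l// ler_pdivrMr ?(lt_le_trans ltr01)//; exact: wn.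
- have cw : continuous (fun p => weight p * dy (chart0 phi) p) by apply: contM; [exact: cont_weight|exact: cy].
  split => //; have [B B0 fB] := box_bounded cw; exists (B + 2 * L) => p.
  have [/fB h|/out h] := pselect (box p); first by rewrite ler_wpDr// mulr_ge0.
  rewrite ler_wpDl// normrM gtr0_norm ?weight_gt0//.
  have db : `|dy (chart0 phi) p| <= L / n2 p.
    have dp : is_derive p.2 1 (fun t => chart0 phi (p.1, t)) (dy (chart0 phi) p).
      by have := C1_partial2 c0 p.1 p.2; rewrite -surjective_pairing.
    apply: (derive_bound dp) => t t4; rewrite mulrAC -surjective_pairing.
    by apply: lL => //=; [case: (sl p t h t4)|ring].
  apply: le_trans (ler_wpM2l (ltW (weight_gt0 _)) db) _.
  rewrite mulrCA [2 * L]mulrC ler_wpM2l// ler_pdivrMr ?(lt_le_trans ltr01)//; exact: wn.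
Qed.
End Smooth.

(** * Determinants and Toeplitz matrices *)

Section LogDet.
Context {R : realType}.
Local Open Scope complex_scope.
Local Notation "z ^J" := (conjc z) (at level 2, format "z ^J").
Local Notation C := R[i].

Lemma is_derive_expr_pred (k : nat) (x c : R) : is_derive x 1 (fun t => t ^+ k.+1 / c) (k.+1%:R * x ^+ k / c).
Proof.
elim: k => [|k IH].
  have := is_derive_scaler c (is_derive_id1 x); rewrite expr0 mulr1.
  by under [fun t => _ ^+ 1 / c]eq_fun do rewrite expr1.
have := is_derive_mul IH (is_derive_id1 x).
under [fun t => _ * t]eq_fun do rewrite mulrAC -exprSr.
by move=> h; apply: is_derive_eq; rewrite -[in RHS]natr1 !exprS; ring.
Qed.

Lemma expR_ge_cubic (y : R) : 1 + y + y ^+ 2 / 2 + y ^+ 3 / 6 <= expR y.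
Proof.
have d2 (t : R) : is_derive t 1 (fun t : R => expR t - 1 - t) (expR t - 1).
  have := is_derive_sub (is_derive_sub (is_derive_expR1 t) (is_derive_cst1 t 1)) (is_derive_id1 t).
  by rewrite subr0.
have d3 (t : R) : is_derive t 1 (@r3 R) (expR t - 1 - t).
  have := is_derive_sub (d2 t) (is_derive_expr_pred 1 t 2).
  by move=> h; apply: is_derive_eq; rewrite expr1; field.
have d4 (t : R) : is_derive t 1 (fun t : R => r3 t - t ^+ 3 / 6) (r3 t).
  have := is_derive_sub (d3 t) (is_derive_expr_pred 2 t 6).
  by move=> h; apply: is_derive_eq; rewrite /r3; field.
have r30 : r3 0 = 0 :> R by rewrite /r3 expR0 expr0n/=; ring.
have h : 0 <= r3 y - y ^+ 3 / 6.
  apply: (mul_derive_ge0 y d4); first by rewrite r30 expr0n/= mul0r subrr.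
  by move=> t; apply: (mul_monotone_ge0 t d3 r30) => u; exact: r2_ge0.
by move: h; rewrite /r3; lra.
Qed.

(** Exponentiated form of ln (1 + x) <= x - (1/2 - k) x^2: the true coefficient 1/2 is weakened by k
    to pay for the terms of third order. *)
Lemma ln_quadratic_bound (k x : R) : 0 <= k <= 1 / 2 -> `|x| <= k -> 1 + x <= expR (x - (1 / 2 - k) * x ^+ 2).
Proof.
move=> /andP[k0 k1] xk; set a := 1 / 2 - k.
apply: le_trans (expR_ge_cubic _).
set z := `|x| in xk; have z0 : 0 <= z by exact: normr_ge0.
have xz : x ^+ 2 = z ^+ 2 by rewrite /z real_normK ?num_real.
have zx : - z <= x <= z by rewrite -ler_norml.
have a0 : 0 <= a by rewrite /a; lra.
have a1 : a <= 1 / 2 by rewrite /a; lra.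
have ke : k = 1 / 2 - a by rewrite /a; lra.
(* The excess over 1 + x has quadratic part (1/2 - a) x^2 = k x^2; the terms gathered in the last
   summand are at least - |x|^3 >= - k x^2. *)
have -> : 1 + (x - a * x ^+ 2) + (x - a * x ^+ 2) ^+ 2 / 2 + (x - a * x ^+ 2) ^+ 3 / 6 =
  1 + x + (k * z ^+ 2 + (a ^+ 2 * z ^+ 4 / 2) + z ^+ 2 * (x * (- a + (1 - a * x) ^+ 3 / 6))).
  have -> : z ^+ 4 = x ^+ 4 by rewrite (exprM x 2 2) (exprM z 2 2) xz.
  by rewrite -xz ke; field.
rewrite lerDl.
have h0 : 0 <= a ^+ 2 * z ^+ 4 / 2 by rewrite divr_ge0// mulr_ge0// exprn_ge0.
suff h1 : - z <= x * (- a + (1 - a * x) ^+ 3 / 6).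
  have z2 := sqr_ge0 z; have := ler_wpM2l z2 h1; have := ler_wpM2l z2 xk.
  rewrite mulrN [z ^+ 2 * k]mulrC; lra.
have z12 : z <= 1 / 2 by lra.
have ax : - (1 / 4) <= a * x <= 1 / 4 by apply/andP; split; nra.
set b := a * x in ax *.
have c1 : 0 <= (1 - b) ^+ 3 <= 2.
  apply/andP; split; first by rewrite exprn_ge0//; lra.
  have -> : (1 - b) ^+ 3 = (1 - b) * (1 - b) ^+ 2 by ring.
  have : (1 - b) ^+ 2 <= 25 / 16 by nra.
  have := sqr_ge0 (1 - b); nra.
move: ((1 - b) ^+ 3) c1 => c /andP[c0 c2].
have : `|x * (- a + c / 6)| <= z * 1.
  by rewrite normrM; apply: ler_pM => //; rewrite ler_norml; apply/andP; split; lra.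
by rewrite mulr1 ler_norml => /andP[].
Qed.

Lemma rc_sum (I : Type) (r : seq I) (F : I -> R) : (\sum_(i <- r) F i)%:C = \sum_(i <- r) (F i)%:C.
Proof. exact: (rmorph_sum (real_complex R)). Qed.

Lemma rc_prod (I : Type) (r : seq I) (F : I -> R) : (\prod_(i <- r) F i)%:C = \prod_(i <- r) (F i)%:C.
Proof. exact: (rmorph_prod (real_complex R)). Qed.

Definition hs N (E : 'M[C]_N) : R := \sum_i \sum_j nrm2 (E i j).

Lemma hermitian_diag N (E : 'M[C]_N) : (forall i j, (E i j)^J = E j i) ->
  exists2 P : 'M[C]_N, P \in unitmx & exists l : 'I_N -> R, E = invmx P *m diag_mx (\row_i (l i)%:C) *m P.
Proof.
move=> hE; have herm : E \is hermsymmx.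
  apply/is_hermitianmxP; rewrite expr0 scale1r; apply/matrixP => i j; rewrite !mxE.
  exact: (esym (hE j i)).
have /orthomx_spectralP e := hermitian_normalmx herm.
have /mxOverP rl := hermitian_spectral_diag_real herm.
exists (spectralmx E); first exact: spectral_unit.
exists (fun i => complex.Re (spectral_diag E 0 i)).
suff <- : spectral_diag E = \row_i (complex.Re (spectral_diag E 0 i))%:C by exact: e.
apply/rowP => i; rewrite !mxE.
have := rl 0 i; move: (spectral_diag E 0 i) => z /CrealP zr.
apply: complexE2 => //=; have : - complex.Im z = complex.Im z by rewrite -cImJ; congr complex.Im; exact: zr.
lra.
Qed.

Lemma hs_mx N (E : 'M[C]_N) : (forall i j, (E i j)^J = E j i) -> (hs E)%:C = \tr (E *m E).
Proof.
move=> hE; rewrite /hs rc_sum; apply: eq_bigr => i _; rewrite rc_sum mxE; apply: eq_bigr => j _.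
by rewrite nrm2RE hE.
Qed.

Lemma mxtrace_conj N (P X : 'M[C]_N) : P \in unitmx -> \tr (invmx P *m X *m P) = \tr X.
Proof. by move=> uP; rewrite mxtrace_mulC mulmxA mulmxV// mul1mx. Qed.

(** Every eigenvalue is bounded by the Hilbert-Schmidt norm, hence by k, so [ln_quadratic_bound]
    applies to each factor of the determinant. *)
Lemma ln_det_le N (E : 'M[C]_N) (k : R) : (forall i j, (E i j)^J = E j i) ->
  0 <= k <= 1 / 2 -> hs E <= k ^+ 2 -> k < 1 ->
  0 < complex.Re (\det (1%:M + E)) /\
  ln (complex.Re (\det (1%:M + E))) <= complex.Re (\tr E) - (1 / 2 - k) * hs E.
Proof.
move=> hE k12 hk k1; have [P uP [l El]] := hermitian_diag hE.
set D := diag_mx _ in El.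
have trE : \tr E = (\sum_i l i)%:C.
  rewrite El mxtrace_conj// mxtrace_diag rc_sum.
  by apply: eq_bigr => i _; rewrite mxE.
have hsE : hs E = \sum_i l i ^+ 2.
  have : (hs E)%:C = (\sum_i l i ^+ 2)%:C.
    rewrite hs_mx// El.
    have -> : invmx P *m D *m P *m (invmx P *m D *m P) = invmx P *m (D *m D) *m P.
      by rewrite !mulmxA mulmxK.
    rewrite mxtrace_conj// /D mulmx_diag mxtrace_diag rc_sum.
    by apply: eq_bigr => i _; rewrite !mxE -rcM expr2.
  by move=> /(congr1 (@complex.Re R)).
have detE : \det (1%:M + E) = (\prod_i (1 + l i))%:C.
  have -> : 1%:M + E = invmx P *m (1%:M + D) *m P.
    by rewrite mulmxDr mulmxDl mulmx1 mulVmx// -El.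
  rewrite !det_mulmx det_inv mulrAC mulVr ?mul1r -?unitmxE//.
  have -> : 1%:M + D = diag_mx (\row_i (1 + l i)%:C).
    apply/matrixP => i j; rewrite !mxE rcD.
    by case: eqP => _; rewrite ?mulr1n ?mulr0n ?addr0.
  by rewrite det_diag rc_prod; apply: eq_bigr => i _; rewrite mxE.
have lk i : `|l i| <= k.
  rewrite -(ler_pXn2r (n := 2))// ?nnegrE//; last by case/andP: k12.
  rewrite real_normK ?num_real//; apply: le_trans hk; rewrite hsE (bigD1 i)//= lerDl.
  by apply: sumr_ge0 => j _; exact: sqr_ge0.
have l0 i : 0 < 1 + l i by have := lk i; rewrite ler_norml => /andP[]; lra.
have p0 : 0 < \prod_i (1 + l i) by apply: prodr_gt0.
split; first by rewrite detE.
rewrite trE detE hsE /= mulr_sumr -sumrB -[leRHS]expRK ler_ln ?posrE ?expR_gt0//.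
rewrite expR_sum; apply: ler_prod => i _; rewrite ltW//=.
exact: ln_quadratic_bound.
Qed.

Lemma hsD_le N (A B : 'M[C]_N) : hs (A + B) <= 2 * (hs A + hs B).
Proof.
rewrite /hs -big_split mulr_sumr; apply: ler_sum => i _; rewrite -big_split mulr_sumr.
by apply: ler_sum => j _; rewrite mxE; exact: nrm2D_le.
Qed.

(** Young's inequality, with only a fraction k of the main term x given up; the large factor 1 / k
    falls on y, which will be of second order. *)
Lemma nrm2D_ge (k : R) (x y : C) : 0 < k -> (1 - k) * nrm2 x - nrm2 y / k <= nrm2 (x + y).
Proof.
move=> k0; rewrite /nrm2 cReD cImD -subr_ge0.
set a := complex.Re x; set b := complex.Im x; set c := complex.Re y; set d := complex.Im y.
have -> : (a + c) ^+ 2 + (b + d) ^+ 2 - ((1 - k) * (a ^+ 2 + b ^+ 2) - (c ^+ 2 + d ^+ 2) / k) =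
  ((k * a + c) ^+ 2 + (k * b + d) ^+ 2) / k + (c ^+ 2 + d ^+ 2) by field; rewrite gt_eqF.
by rewrite !addr_ge0 ?sqr_ge0// divr_ge0 ?(ltW k0)// addr_ge0 ?sqr_ge0.
Qed.

Lemma hsD_ge N (k : R) (A B : 'M[C]_N) : 0 < k -> (1 - k) * hs A - hs B / k <= hs (A + B).
Proof.
move=> k0; rewrite /hs mulr_sumr mulr_suml -sumrB; apply: ler_sum => i _.
rewrite mulr_sumr mulr_suml -sumrB; apply: ler_sum => j _.
by rewrite mxE; exact: nrm2D_ge.
Qed.

End LogDet.

(** * Toeplitz matrices and the Gram matrix *)

Section Gram.
Context {R : realType}.
Local Open Scope complex_scope.
Local Notation "z ^J" := (conjc z) (at level 2, format "z ^J").
Local Notation C := R[i].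
Implicit Types (p q : R * R) (f g : R * R -> R) (phi : @CP1 R -> R).

Definition acoef n i : R := Num.sqrt (n.+1%:R * 'C(n, i)%:R).
Lemma acoef_sqr n i : acoef n i ^+ 2 = n.+1%:R * 'C(n, i)%:R.
Proof. by rewrite sqr_sqrtr// mulr_ge0. Qed.

(* The Toeplitz operator with symbol [f] in the basis [alpha]. *)
Definition toeplitz n f : 'M[C]_n.+1 :=
  \matrix_(i, j) ((acoef n i * acoef n j)%:C * Mo n (fun p => (f p)%:C) i j).

Lemma bc_cB1 f : bc f -> cB (fun p => (f p)%:C).
Proof. by move=> bf; exact: (bc_cB bf (bc_cst 0)). Qed.

Lemma cPI_Mo n f i j : bc f -> (i <= n)%N -> (j <= n)%N -> cPI (fun p => (f p)%:C * mono i j n.+2 p).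
Proof. by move=> bf i_n j_n; apply: cPI_mono; [exact: bc_cB1|lia]. Qed.

Lemma MoD n f g i j : bc f -> bc g -> (i <= n)%N -> (j <= n)%N ->
  Mo n (fun p => (f p + g p)%:C) i j = Mo n (fun p => (f p)%:C) i j + Mo n (fun p => (g p)%:C) i j.
Proof.
move=> bf bg i_n j_n; rewrite /Mo -mulrDr /mom -cDD; try exact: cPI_Mo.
by congr (_ * cD _); apply/funext => p; rewrite rcD mulrDl.
Qed.

Lemma MoZ n c f i j : bc f -> (i <= n)%N -> (j <= n)%N ->
  Mo n (fun p => (c * f p)%:C) i j = c%:C * Mo n (fun p => (f p)%:C) i j.
Proof.
move=> bf i_n j_n; rewrite /Mo [in RHS]mulrCA /mom -[c%:C * cD _]cDZ; try exact: cPI_Mo.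
by congr (_ * cD _); apply/funext => p; rewrite rcM mulrA.
Qed.

Lemma MoJ n f i j : bc f -> (i <= n)%N -> (j <= n)%N ->
  (Mo n (fun p => (f p)%:C) i j)^J = Mo n (fun p => (f p)%:C) j i.
Proof.
move=> bf i_n j_n; rewrite /Mo cJM cJR /mom -cDJ; last exact: cPI_Mo.
congr (_ * cD _); apply/funext => p; rewrite cJM cJR /mono !cJM !cJX cJK cJR.
by congr (_ * (_ * _)); rewrite mulrC.
Qed.

Lemma toeplitzD n f g : bc f -> bc g -> toeplitz n (fun p => f p + g p) = toeplitz n f + toeplitz n g.
Proof.
move=> bf bg; apply/matrixP => i j; rewrite !mxE MoD ?mulrDr//; first exact: ltn_ord i.
exact: ltn_ord j.
Qed.

Lemma toeplitzZ n c f : bc f -> toeplitz n (fun p => c * f p) = c%:C *: toeplitz n f.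
Proof.
move=> bf; apply/matrixP => i j; rewrite !mxE MoZ 1?mulrCA//; first exact: ltn_ord i.
exact: ltn_ord j.
Qed.

Lemma toeplitz_herm n f i j : bc f -> (toeplitz n f i j)^J = toeplitz n f j i.
Proof.
move=> bf; rewrite !mxE cJM cJR MoJ 1?[acoef n j * _]mulrC//; first exact: ltn_ord i.
exact: ltn_ord j.
Qed.

Lemma toeplitz1 n : toeplitz n (fun=> 1) = 1%:M.
Proof.
apply/matrixP => i j; rewrite !mxE.
have i_n : (i <= n)%N by exact: ltn_ord i. have j_n : (j <= n)%N by exact: ltn_ord j.
have -> : (fun p : R * R => (1 : R)%:C) = fun=> 1 by [].
have [<-|ij] := eqVneq i j; last by rewrite Mo1_neq// mulr0.
by rewrite -expr2 acoef_sqr rcM !rcn Mo1_eq.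
Qed.

Lemma hs_toeplitz n f : hs (toeplitz n f) = n.+1%:R * Qn n (fun p => (f p)%:C).
Proof.
rewrite /hs /Qn /qC !mulr_sumr; apply: eq_bigr => i _; rewrite !mulr_sumr; apply: eq_bigr => j _.
by rewrite mxE nrm2M nrm2R exprMn !acoef_sqr; ring.
Qed.

Lemma tr_toeplitz n f : bc f -> \tr (toeplitz n f) = (n.+1%:R * int_mu f)%:C.
Proof.
move=> bf; rewrite rcM rcn -Mo00// -(sum_Mo_diag n (bc_cB1 bf)).
rewrite mulr_sumr; apply: eq_bigr => i _.
by rewrite mxE -expr2 acoef_sqr rcM !rcn mulrA.
Qed.

Lemma cint_muE (G : R * R -> C) : cint_mu G = cD (fun p => G p * ((pi * weight p ^+ 2)^-1)%:C).
Proof.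
apply: complexE2 => /=; rewrite /int_mu; congr Dplane; apply/funext => p /=.
  by rewrite cReM /= mulr0 subr0.
by rewrite cImM /= mulr0 add0r.
Qed.

Lemma gram_toeplitz n phi : bc (chart0 phi) -> gram n phi = toeplitz n (fun p => expR (chart0 phi p)).
Proof.
move=> bp; have be : bc (fun p => expR (chart0 phi p)) by apply: bc_comp => //; exact: continuous_expR.
apply/matrixP => i j; rewrite !mxE.
have i_n : (i <= n)%N by exact: ltn_ord i. have j_n : (j <= n)%N by exact: ltn_ord j.
have h := cPI_Mo be i_n j_n.
rewrite /sec_prod cint_muE /Mo mulrA /mom -cDZ//; congr cD; apply/funext => p.
rewrite /alpha -/(acoef n i) -/(acoef n j).
transitivity ((acoef n i)%:C * toC p ^+ i * ((acoef n j)%:C * toC p ^+ j)^J * (expR (chart0 phi p) / weight p ^+ n)%:C * ((pi * weight p ^+ 2)^-1)%:C); first by [].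
rewrite cJM cJR cJX /mono !exprVn -[n.+2]addn2 exprD !invfM !rcM.
by move: (toC p) => z; move: ((acoef n j)%:C : C) ((acoef n i)%:C : C) => u v; ring.
Qed.

(** Since [kap2] <= 1, the Berezin transform of a nonnegative f is at most (n + 1) times its
    integral. This gives a Hilbert-Schmidt bound on the remainder of e^psi, for which only the
    integral is small. *)
Lemma Qn_le_int n f : bc f -> (forall p, 0 <= f p) -> Qn n (fun p => (f p)%:C) <= n.+1%:R * int_mu f ^+ 2.
Proof.
move=> bf f0; have [cf [B fB]] := bf.
rewrite (Qn_Bn _ cf fB).
have K0 : 0 <= n.+1%:R * int_mu f by rewrite mulr_ge0// int_mu_ge0.
have bK M p : bc (fun q => f q * kap2 p q ^+ M) by apply: bcM => //; apply: bcX; exact: bc_kap2.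
have le p : Bn n f p <= n.+1%:R * int_mu f.
  rewrite /Bn ler_wpM2l//; apply: int_mu_le => // q.
  by rewrite ler_piMr// exprn_ile1 ?kap2_ge0 ?kap2_le1.
have Bn0 p : 0 <= Bn n f p.
  by rewrite /Bn mulr_ge0// int_mu_ge0// => q; rewrite mulr_ge0// exprn_ge0// kap2_ge0.
have bB : bc (Bn n f).
  by split; [exact: cont_Bn fB|exists (n.+1%:R * int_mu f) => p; rewrite ger0_norm].
rewrite expr2 mulrA -int_muZ//; apply: int_mu_le; [exact: bcM|exact: bcZ|].
by move=> p; rewrite mulrC ler_wpM2r.
Qed.
End Gram.

(** * The local maximum *)

Section Assembly.
Context {R : realType}.
Local Open Scope complex_scope.
Local Notation "z ^J" := (conjc z) (at level 2, format "z ^J").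
Local Notation C := R[i].
Implicit Types (p q : R * R) (f g : R * R -> R) (phi : @CP1 R -> R).

Lemma tameR_subC f fx fy (c : R) : tameR f fx fy -> tameR (fun p => f p - c) fx fy.
Proof.
move=> [d1 d2 bf bx b_y]; split => //; last by apply: bcB => //; exact: bc_cst.
  by move=> x y; have := is_derive_sub (d1 x y) (is_derive_cst1 x c); rewrite subr0.
by move=> x y; have := is_derive_sub (d2 x y) (is_derive_cst1 y c); rewrite subr0.
Qed.

(** In the application N is n + 1, p the integral of psi^2, q is Q_n(psi), rho the integral of r =
    e^psi - 1 - psi, and h, hS, hR are the squared Hilbert-Schmidt norms of E, T(psi) and T(r). The
    gap gives - e N D / 2, against losses e N D times 1/8 from r3, 1/16 from the weakened
    coefficient k, and 1/416 from hR. *)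
Lemma small_energy_arith (N e k D p q rho r3 h hS hR : R) :
  1 <= N -> 0 < e -> e <= 1 -> k = e / 32 -> 0 <= D -> N * D <= (e / 82) ^+ 2 ->
  p <= D -> q <= p -> 0 <= q -> p <= q + (N^-1 - e) * D -> 0 <= rho -> rho = p / 2 + r3 -> r3 <= e * D / 8 ->
  hS = N * q -> hR <= (N * rho) ^+ 2 -> h <= 2 * (hS + hR) -> (1 - k) * hS - hR / k <= h ->
  h <= k ^+ 2 /\ - (1 / 2) * D + (N * rho - (1 / 2 - k) * h) <= 0.
Proof.
move=> N1 e0 e1 ke D0; rewrite expr_div_n => Dx pD qp q0 gap r0 re r3e hSe hRe h1 h2.
have N0 : 0 < N by lra.
have rD : rho <= D by rewrite re; have := ler_wpM2r D0 e1; lra.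
set x := N * D in Dx.
have x0 : 0 <= x by rewrite mulr_ge0// ltW.
have hSx : hS <= x by rewrite hSe ler_pM2l//; exact: le_trans qp pD.
have hS0 : 0 <= hS by rewrite hSe mulr_ge0// ltW.
have hRx : hR <= x ^+ 2.
  apply: le_trans hRe _; rewrite lerXn2r ?nnegrE ?mulr_ge0 ?(ltW N0)//.
  by rewrite ler_wpM2l// ltW.
have e2 : e ^+ 2 <= 1 by rewrite expr_le1// ltW.
have x1 : x <= 1 by lra.
have xx : x ^+ 2 <= x by rewrite expr2 ler_piMl.
split.
  by rewrite ke expr_div_n; have := sqr_ge0 e; lra.
have k0 : 0 < k by rewrite ke; lra.
have k1 : k <= 1 / 32 by rewrite ke; lra.
have g2 : N * p <= N * q + D - e * x.
  have := ler_wpM2l (ltW N0) gap; have -> : N * (q + (N^-1 - e) * D) = N * q + D - e * x.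
    by rewrite /x; field; rewrite gt_eqF.
  by [].
have hh : (1 / 2 - 2 * k) * hS - x ^+ 2 / (2 * k) <= (1 / 2 - k) * h.
  have h3 : (1 - k) * hS - x ^+ 2 / k <= h.
    by apply: le_trans h2; rewrite lerB// ler_wpM2r// invr_ge0 ltW.
  have h4 : 0 <= 1 / 2 - k by lra.
  have h5 := ler_wpM2l h4 h3.
  apply: le_trans h5; rewrite -subr_ge0.
  have -> : (1 / 2 - k) * ((1 - k) * hS - x ^+ 2 / k) - ((1 / 2 - 2 * k) * hS - x ^+ 2 / (2 * k))
    = hS * (k / 2 + k ^+ 2) + x ^+ 2 by field; rewrite gt_eqF.
  by rewrite addr_ge0 ?sqr_ge0// mulr_ge0// addr_ge0 ?sqr_ge0// divr_ge0// ltW.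
(* As k = e / 32, this requires x <= e^2 / (16 * 416), which holds because 82^2 = 6724 >= 6656. *)
have x2k : x ^+ 2 / (2 * k) <= x * e / 416.
  have -> : x ^+ 2 / (2 * k) = x * (x / (2 * k)) by field; rewrite gt_eqF.
  rewrite -mulrA ler_wpM2l// ler_pdivrMr; last by lra.
  by rewrite ke; move: Dx; rewrite expr2; lra.
have kS : k * hS <= k * x by rewrite ler_wpM2l// ltW.
have nr : N * rho <= N * p / 2 + e * x / 8.
  have := ler_wpM2l (ltW N0) r3e; rewrite re /x mulrDr.
  have -> : N * (e * D / 8) = e * (N * D) / 8 by ring. lra.
have ex : 0 <= e * x by rewrite mulr_ge0// ltW.
have kx : k * x = e * x / 32 by rewrite ke; ring.
move: hh; have -> : (1 / 2 - 2 * k) * hS = N * q / 2 - 2 * (k * hS) by rewrite hSe; ring.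
move: x2k nr kS g2; rewrite kx [x * e]mulrC.
move: (e * x) ex ((1 / 2 - k) * h) (x ^+ 2 / (2 * k)) (k * hS) (N * rho) (N * p) (N * q) => u u0 a b c v w z.
clear - u0; lra.
Qed.

Definition del_gap n : R := gape n.+1 / (n.+1%:R * n.+2%:R).

Lemma anomaly_le0 n (s : nat) phi : (0 < s)%N -> s%:R^-1 <= del_gap n / 32 -> smooth_CP1 phi ->
  n.+1%:R * dirichlet phi <= (del_gap n / 82) ^+ 2 -> 352 * s%:R ^+ 2 * dirichlet phi <= 1 ->
  anomaly_rhs n phi <= 0.
Proof.
move=> s0 se /smooth_tameR tf; set N : R := n.+1%:R; set e := del_gap n in se *; set D := dirichlet phi => ND sD.
have bf : bc (chart0 phi) by case: tf.
set m := int_mu (chart0 phi).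
have tpsi := tameR_subC m tf; set psi := fun p => chart0 phi p - m in tpsi.
have bpsi : bc psi by case: tpsi.
have psi0 : int_mu psi = 0 by rewrite int_muB ?int_mu_cst ?subrr//; exact: bc_cst.
pose r p := expR (psi p) - 1 - psi p.
have bexp : bc (fun p => expR (psi p)) by apply: bc_comp => //; exact: continuous_expR.
have br : bc r by apply: bcB => //; apply: bcB => //; exact: bc_cst.
have r0 p : 0 <= r p by exact: r2_ge0.
pose E := toeplitz n psi + toeplitz n r.
have e0 : 0 < e.
  by rewrite /e /del_gap divr_gt0 ?gape_gt0// mulr_gt0.
have e1 : e <= 1.
  rewrite /e /del_gap ler_pdivrMr ?mulr_gt0// mul1r; apply: le_trans (gape_le1 _) _.
  by rewrite -natrM ler1n muln_gt0.
have D0 : 0 <= D by exact: DirR_ge0 tf.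
have gramE : gram n phi = (expR m)%:C *: (1%:M + E).
  rewrite gram_toeplitz// -(toeplitz1 n) /E -toeplitzD// -toeplitzD//; [|exact: bc_cst|exact: bcD].
  rewrite -toeplitzZ; last by apply: bcD; [exact: bc_cst|exact: bcD].
  congr toeplitz; apply/funext => p; rewrite /r /psi.
  have -> : 1 + (chart0 phi p - m + (expR (chart0 phi p - m) - 1 - (chart0 phi p - m))) = expR (chart0 phi p - m) by ring.
  by rewrite -expRD subrKC.
have hE i j : (E i j)^J = E j i by rewrite /E [_ i j]mxE cJD !toeplitz_herm// [RHS]mxE.
pose rho := int_mu r.
have trE : complex.Re (\tr E) = N * rho.
  by rewrite /E raddfD/= cReD !tr_toeplitz//= psi0 mulr0 add0r.
pose q := Qn n (fun p => (psi p)%:C).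
pose k := e / 32.
have q0 : 0 <= q by rewrite mulr_ge0// qC_ge0.
have bpsi2 := bcX 2 bpsi.
have qp : q <= int_mu (fun p => psi p ^+ 2).
  apply: le_trans (Qn_le n (bc_cB1 bpsi)) _.
  by rewrite le_eqVlt; apply/orP; left; apply/eqP; congr int_mu; apply/funext => p; rewrite nrm2R.
have gap := sqr_gap n (tameR_tame tpsi) bpsi; rewrite (Dir_DirR tpsi) in gap.
have pD := poincare tpsi psi0.
have br3 : bc (fun p => r3 (psi p)).
  have := bcB br (bcZ 2^-1 bpsi2); congr bc; apply/funext => p.
  by rewrite /r /r3; field.
have rhoE : rho = int_mu (fun p => psi p ^+ 2) / 2 + int_mu (fun p => r3 (psi p)).
  rewrite mulrC -int_muZ// -int_muD//; last exact: bcZ.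
  by congr int_mu; apply/funext => p; rewrite /r /r3; field.
have r3D : int_mu (fun p => r3 (psi p)) <= e * D / 8.
  apply: le_trans (int_r3_le tpsi psi0 s0 sD) _.
  by have := ler_wpM2r D0 se; rewrite -[DirR _ _]/D; lra.
have k0 : 0 < k by rewrite divr_gt0.
have N1 : 1 <= N by rewrite ler1n.
have rho0 : 0 <= rho by exact: int_mu_ge0.
have hR : hs (toeplitz n r) <= (N * rho) ^+ 2.
  by rewrite hs_toeplitz exprMn [N ^+ 2]expr2 -mulrA ler_wpM2l// Qn_le_int.
have [hk fin] := small_energy_arith N1 e0 e1 (erefl k) D0 ND pD qp q0 gap rho0 rhoE r3D
  (hs_toeplitz n psi) hR (hsD_le _ _) (hsD_ge _ _ k0).
have k12 : 0 <= k <= 1 / 2 by rewrite (ltW k0)/= /k; lra.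
have k1 : k < 1 by rewrite /k; lra.
have [det0 lndet] := ln_det_le hE k12 hk k1.
(* The scalar e^m contributes (n + 1) m to the logarithm and cancels the linear term of the
   functional. *)
rewrite /anomaly_rhs gramE detZ -rcX cReM/= mul0r subr0 lnM ?posrE ?exprn_gt0 ?expR_gt0//.
rewrite lnXn ?expR_gt0// expRK -[m *+ _]mulr_natl -/N -/m -/D.
rewrite trE in lndet; move: fin lndet; rewrite -/E.
move: ((1 / 2 - k) * hs E) (ln _) => a b; clear; lra.
Qed.

Lemma Ck_cst k (c : R) : Ck k (fun _ : R * R => c).
Proof.
have d0 (v : R * R) : (fun p => 'D_v (fun _ : R * R => c) p) = fun=> 0.
  by apply/funext => p; rewrite derive_cst.
elim: k c d0 => [|k IH] c d0 /=; first by split => //; exact: cst_continuous.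
split; first exact: cst_continuous.
split; first by move=> p; split; exact: derivable_cst.
by rewrite /dx /dy !d0; split; apply: IH => v; apply/funext => p; rewrite derive_cst.
Qed.

Lemma smooth_CP1_cst (c : R) : smooth_CP1 (fun _ : @CP1 R => c).
Proof.
split=> k; first exact: Ck_cst.
have -> : chartoo (fun _ : @CP1 R => c) = fun=> c by apply/funext => p; rewrite /chartoo if_same.
exact: Ck_cst.
Qed.

Lemma anomaly_rhs0 n : anomaly_rhs n (fun _ : @CP1 R => 0) = 0.
Proof.
have b0 : bc (chart0 (fun _ : @CP1 R => 0)) by exact: bc_cst.
rewrite /anomaly_rhs gram_toeplitz//.
have -> : (fun p => expR (chart0 (fun _ : @CP1 R => 0) p)) = fun=> 1.
  by apply/funext => p; rewrite /chart0 expR0.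
rewrite toeplitz1 det1 /= ln1 addr0.
have -> : int_mu (chart0 (fun _ : @CP1 R => 0)) = 0 by exact: int_mu_cst.
have -> : dirichlet (fun _ : @CP1 R => 0) = 0.
  rewrite /dirichlet (_ : grad_sq _ = fun=> 0) ?int_mu_cst//; apply/funext => p.
  by rewrite /grad_sq /dx /dy /chart0 !derive_cst expr0n/= addr0 mulr0.
by rewrite !mulr0 subr0.
Qed.

Lemma local_maximum n : exists delta : R, 0 < delta /\ forall phi, smooth_CP1 phi -> dirichlet phi < delta ->
  anomaly_rhs n phi <= 0.
Proof.
have e0 : 0 < del_gap n by rewrite /del_gap divr_gt0 ?gape_gt0// mulr_gt0.
(* Chosen so that 1 / s <= e / 32, which turns the error 4 D / s into at most e D / 8. *)
pose s := (Num.truncn (32 / del_gap n)).+1.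
have s0 : 0 < s%:R :> R by rewrite ltr0n.
have K0 : 0 < 352 * s%:R ^+ 2 :> R by apply: mulr_gt0; [rewrite ltr0n|exact: exprn_gt0].
have d0 : 0 < del_gap n / 32 by apply: divr_gt0; [exact: e0|rewrite ltr0n].
exists (Num.min ((del_gap n / 82) ^+ 2 / n.+1%:R) (352 * s%:R ^+ 2)^-1); split.
  rewrite lt_min invr_gt0 K0 andbT; apply: divr_gt0; last by rewrite ltr0n.
  by apply: exprn_gt0; apply: divr_gt0; [exact: e0|rewrite ltr0n].
move=> phi sphi; rewrite lt_min => /andP[/ltW h1 /ltW h2].
apply: (@anomaly_le0 n s) sphi _ _; first by [].
- rewrite -[del_gap n / 32]invrK lef_pV2 ?posrE ?invr_gt0//.
  by rewrite invf_div ltW// truncnS_gt.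
- by rewrite mulrC -ler_pdivlMr ?ltr0n.
by rewrite -ler_pdivlMl// mulr1.
Qed.
End Assembly.

Unset Implicit Arguments.
Set Strict Implicit.
Set Printing Implicit Defensive.

Theorem theorem3 (R : realType) (n : nat) (hn : (0 < n)%N) :
  exists delta : R, 0 < delta /\
    ((* the functional given by the explicit formula *)
     anomaly_rhs n (fun _ : @CP1 R => 0) = 0 /\
     forall phi : @CP1 R -> R, smooth_CP1 phi -> dirichlet phi < delta ->
       anomaly_rhs n phi <= anomaly_rhs n (fun _ : @CP1 R => 0)) /\
    ((* the functional defined by zeta-regularized determinants *)
     anomaly_formula R n ->
     A n (fun _ : @CP1 R => 0) = 0 /\
     forall phi : @CP1 R -> R, smooth_CP1 phi -> dirichlet phi < delta ->
       A n phi <= A n (fun _ : @CP1 R => 0)).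
Proof.
have [delta [delta0 h]] := @local_maximum R n; exists delta; split; first exact: delta0.
split; first by rewrite anomaly_rhs0; split; [by []|exact: h].
move=> af; have s0 := smooth_CP1_cst (0 : R); rewrite !af// anomaly_rhs0; split => // phi sphi.
by rewrite af//; exact: h.
Qed.
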